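(* Let $X=\bigsqcup_{n\in\mathbb{N}}X_n$ be a coarse disjoint union of expander graphs. Then the quasi-local algebra $\mathrm{C}^*_{ql}(X)$ does not have a Cartan subalgebra isomorphic (as a $\mathrm{C}^*$-algebra) to $\ell_\infty=\ell_\infty(\mathbb{N})$.
   Context: **Expander graphs.** For $k\in\mathbb{N}$ and $h>0$, a finite undirected graph $G=(V,E)$ is a $(k,h)$-expander if every vertex is incident to at most $k$ edges and, for all $A\subseteq V$ with $|A|\le |V|/2$, one has $|\partial A|\ge h|A|$, where $\partial A=\{v\in V\setminus A : \exists u\in A,\ (v,u)\in E\}$. Such a graph is connected, and $V$ is regarded as a metric space with the shortest path distance. **Coarse disjoint union of expander graphs.** Let $k\in\mathbb{N}$ and $h>0$ be fixed (independent of $n$) and let $(X_n,d_n)_{n\in\mathbb{N}}$ be finite metric spaces, each being the vertex set of some $(k,h)$-expander graph with its shortest path distance, with $|X_n|\to\infty$ as $n\to\infty$. The disjoint union $X=\bigsqcup_{n\in\mathbb{N}}X_n$ is endowed with a metric $d$ such that (1) $d$ restricted to $X_n\times X_n$ equals $d_n$ for all $n$, and (2) $d(X_n,X_m)\to\infty$ as $n,m\to\infty$ with $n\ne m$, where $d(A,B)=\inf\{d(x,y): x\in A, y\in B\}$. Any such $(X,d)$ is called a coarse disjoint union of expander graphs. **Quasi-local algebra.** For a metric space $(X,d)$ that is uniformly locally finite (balls of a given radius are finite and uniformly bounded in cardinality), $\ell_2(X)$ is the Hilbert space of square-summable functions $X\to\mathbb{C}$, $\mathcal{B}(\ell_2(X))$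 the algebra of bounded linear operators on it, and for $A\subseteq X$, $\chi_A$ is the orthogonal projection of $\ell_2(X)$ onto $\ell_2(A)$. The (uniform) quasi-local algebra $\mathrm{C}^*_{ql}(X)$ is the $\mathrm{C}^*$-subalgebra of $\mathcal{B}(\ell_2(X))$ consisting of all $a$ such that: for every $\varepsilon>0$ there is $r>0$ such that for all $A,B\subseteq X$ with $d(A,B)>r$ one has $\|\chi_A a\chi_B\|\le\varepsilon$. **Cartan subalgebra.** A $\mathrm{C}^*$-subalgebra $B$ of a unital $\mathrm{C}^*$-algebra $C$ is a Cartan subalgebra of $C$ if $B$ is a maximal abelian ($*$-)subalgebra of $C$, the normalizer $\{a\in C: aBa^*\cup a^*Ba\subseteq B\}$ of $B$ in $C$ generates $C$ as a $\mathrm{C}^*$-algebra, and there is a faithful conditional expectation $C\to B$. *)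

(* Defs.v *)
From HB Require Import structures.
From mathcomp Require Import all_boot all_order all_algebra.
From mathcomp Require Import ring lra finmap complex.
From mathcomp Require Import all_classical all_reals all_analysis.

Set Implicit Arguments.
Unset Strict Implicit.
Unset Printing Implicit Defensive.
Import Order.TTheory GRing.Theory Num.Theory.
Import Normc.

Local Open Scope classical_set_scope.
Local Open Scope ring_scope.

Section Sums.
Context {R : realType} {T : choiceType}.
Implicit Types (F G : T -> R) (f g : T -> R[i]).

Definition rsummable F := summable [set: T] (EFin \o F).

(* Unordered sum of an absolutely summable family, as the difference of the
   sums of its positive and negative parts. *)
Definition rsum F : R :=
  fine (\esum_(x in [set: T]) (EFin \o F)^\+ x)%E -
  fine (\esum_(x in [set: T]) (EFin \o F)^\- x)%E.

Definition csum f : R[i] :=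
  Complex (rsum (fun x => complex.Re (f x))) (rsum (fun x => complex.Im (f x))).

Let S F := fine (\esum_(x in [set: T]) (F x)%:E)%E.

Lemma rsummableP F G : (forall x, `|F x| <= G x) -> rsummable G -> rsummable F.
Proof.
move=> FG; apply: le_lt_trans; apply: le_esum => x _ /=.
by rewrite lee_fin (le_trans (FG x))// ler_norm.
Qed.

Lemma rsummable_ge0 F : (forall x, 0 <= F x) -> rsummable F ->
  (\esum_(x in [set: T]) (F x)%:E)%E = (S F)%:E.
Proof.
move=> F0 sF; rewrite /S fineK//.
have := sF; rewrite /rsummable summableE; congr (_ \is a fin_num).
by apply: eq_esum => x _ /=; rewrite ger0_norm.
Qed.

Lemma rsummableN F : rsummable F -> rsummable (fun x => - F x).
Proof. by apply: le_lt_trans; apply: le_esum => x _ /=; rewrite normrN. Qed.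

Lemma rsummableD F G : rsummable F -> rsummable G ->
  rsummable (fun x => F x + G x).
Proof. by move=> sF sG; have := summableD sF sG. Qed.

Lemma esumZ_le (c : R) F : 0 <= c -> (forall x, 0 <= F x) ->
  (\esum_(x in [set: T]) (c * F x)%:E <= c%:E * \esum_(x in [set: T]) (F x)%:E)%E.
Proof.
move=> c0 F0; apply: ge_ereal_sup => _ [A [fA _] <-].
apply: (@le_trans _ _ (c%:E * \sum_(x \in A) (F x)%:E)%E); last first.
  by rewrite lee_wpmul2l ?lee_fin//; apply: ereal_sup_ubound; exists A.
rewrite ge0_mule_fsumr//.
Qed.

Lemma rsummableZ (c : R) F : rsummable F -> rsummable (fun x => c * F x).
Proof.
rewrite /rsummable /summable /= => sF.
under eq_esum do rewrite normrM.
apply: le_lt_trans (esumZ_le _ _) _ => //.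
rewrite (@rsummable_ge0 (fun x => `|F x|))//; first by rewrite -EFinM ltry.
by rewrite /rsummable /summable /=; under eq_esum do rewrite normr_id.
Qed.

Lemma rsum_pn F G H : (forall x, 0 <= G x) -> (forall x, 0 <= H x) ->
  rsummable G -> rsummable H -> (forall x, F x = G x - H x) ->
  rsum F = S G - S H.
Proof.
move=> G0 H0 sG sH FGH.
have sF : rsummable F.
  rewrite (_ : F = fun x => G x + - H x); last exact/funext.
  by apply: rsummableD => //; exact: rsummableN.
have FE : EFin \o F = ((EFin \o G) \- (EFin \o H))%E.
  by apply/funext => x /=; rewrite FGH EFinB.
have := esumB sG sH (fun i _ => G0 i) (fun i _ => H0 i).
rewrite -FE !rsummable_ge0// => E.
have finp (f : T -> \bar R) : (forall x, 0 <= f x)%E -> summable [set: T] f ->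
    (\esum_(x in [set: T]) f x)%E \is a fin_num.
  move=> f0; rewrite summableE.
  by congr (_ \is a fin_num); apply: eq_esum => x _; rewrite gee0_abs.
apply/EFin_inj; rewrite !EFinB -E /rsum. rewrite !fineK//; apply: finp => //.
- by apply: summable_funeneg; exact: sF.
- by apply: summable_funepos; exact: sF.
Qed.

Lemma rsummable_funrpos F : rsummable F -> rsummable (fun x => Num.max (F x) 0).
Proof.
move=> sF; apply: (@rsummableP _ (fun x => `|F x|)).
  by move=> x; rewrite ger0_norm ?le_max ?lexx ?orbT// ge_max ler_norm/=.
by apply: le_lt_trans sF; apply: le_esum => x _ /=; rewrite normr_id.
Qed.

Lemma rsum_split F : rsummable F -> exists G H,
  [/\ forall x, 0 <= G x, forall x, 0 <= H x, rsummable G, rsummable H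
    & forall x, F x = G x - H x].
Proof.
move=> sF; exists (fun x => Num.max (F x) 0), (fun x => Num.max (- F x) 0).
split => [x|x|||x]; rewrite ?le_max ?lexx ?orbT//.
- exact: rsummable_funrpos.
- by apply: rsummable_funrpos; exact: rsummableN.
- case: (leP 0 (F x)) => Fx.
    rewrite (max_idPr _) ?oppr_le0//; lra.
  rewrite (max_idPl _) ?oppr_ge0//; lra.
Qed.

Let SD F G : (forall x, 0 <= F x) -> (forall x, 0 <= G x) ->
  rsummable F -> rsummable G -> S (fun x => F x + G x) = S F + S G.
Proof.
move=> F0 G0 sF sG; apply/EFin_inj; rewrite EFinD -(rsummable_ge0 F0 sF) -(rsummable_ge0 G0 sG).
have FG0 x : 0 <= F x + G x by rewrite addr_ge0.
rewrite -(rsummable_ge0 FG0 (rsummableD sF sG)).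
rewrite -esumD => [|x _|x _]; rewrite ?lee_fin//.
Qed.

Let SZ (c : R) F : 0 <= c -> (forall x, 0 <= F x) -> rsummable F ->
  S (fun x => c * F x) = c * S F.
Proof.
rewrite le_eqVlt => /predU1P[<-|c0] F0 sF.
  by rewrite mul0r /S esum1// => x _; rewrite mul0r.
have cF0 x : 0 <= c * F x by rewrite mulr_ge0// ltW.
have scF : rsummable (fun x => c * F x) by exact: rsummableZ.
apply/eqP; rewrite eq_le -!lee_fin EFinM -(rsummable_ge0 F0 sF).
rewrite -(rsummable_ge0 cF0 scF).
rewrite esumZ_le ?(ltW c0)//= -lee_pdivlMl//.
apply: le_trans (esumZ_le _ _); rewrite ?invr_ge0 ?(ltW c0)//.
by apply: le_esum => x _; rewrite mulKf ?gt_eqF.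
Qed.

Lemma rsum_ge0 F : (forall x, 0 <= F x) -> rsummable F ->
  (rsum F)%:E = (\esum_(x in [set: T]) (F x)%:E)%E.
Proof.
move=> F0 sF; rewrite rsummable_ge0//.
have s0 : rsummable (fun=> 0).
  by rewrite /rsummable /summable esum1// => x _; rewrite /= normr0.
rewrite (rsum_pn F0 _ sF s0)//; last by move=> x; rewrite subr0.
have S0 : S (fun=> 0) = 0 by rewrite /S esum1.
by rewrite -/(S (fun=> 0)) S0 subr0.
Qed.

Lemma rsumD F G : rsummable F -> rsummable G ->
  rsum (fun x => F x + G x) = rsum F + rsum G.
Proof.
move=> /rsum_split[F1 [F2 [F10 F20 sF1 sF2 FE]]].
move=> /rsum_split[G1 [G2 [G10 G20 sG1 sG2 GE]]].
rewrite (@rsum_pn F F1 F2)// (@rsum_pn G G1 G2)//.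
rewrite (@rsum_pn _ (fun x => F1 x + G1 x) (fun x => F2 x + G2 x)); first last.
- by move=> x; rewrite FE GE; ring.
- exact: rsummableD.
- exact: rsummableD.
- by move=> x; rewrite addr_ge0.
- by move=> x; rewrite addr_ge0.
by rewrite !SD//; ring.
Qed.

Lemma rsumN F : rsummable F -> rsum (fun x => - F x) = - rsum F.
Proof.
move=> /rsum_split[F1 [F2 [F10 F20 sF1 sF2 FE]]].
rewrite (@rsum_pn F F1 F2)// (@rsum_pn (fun x => - F x) F2 F1) ?opprB//.
by move=> x; rewrite FE opprB.
Qed.

Lemma rsumZ (c : R) F : rsummable F -> rsum (fun x => c * F x) = c * rsum F.
Proof.
wlog c0 : c / 0 <= c => [hw sF|].
  have [c0|c0] := leP 0 c; first by apply: hw.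
  rewrite -[in RHS](opprK c) mulNr -hw ?oppr_ge0 ?(ltW c0)//.
  rewrite -rsumN; last exact: rsummableZ.
  by congr rsum; apply/funext => x; rewrite mulNr opprK.
move=> /rsum_split[F1 [F2 [F10 F20 sF1 sF2 FE]]].
rewrite (@rsum_pn F F1 F2)//.
rewrite (@rsum_pn _ (fun x => c * F1 x) (fun x => c * F2 x)).
- by rewrite !SZ// mulrBr.
- by move=> x; rewrite mulr_ge0.
- by move=> x; rewrite mulr_ge0.
- exact: rsummableZ.
- exact: rsummableZ.
- by move=> x; rewrite FE mulrBr.
Qed.

Lemma ler_rsum F G : rsummable F -> rsummable G -> (forall x, F x <= G x) ->
  rsum F <= rsum G.
Proof.
move=> sF sG FG; rewrite -subr_ge0 -rsumN// -rsumD//; last exact: rsummableN.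
rewrite -lee_fin rsum_ge0.
- by apply: esum_ge0 => x _; rewrite lee_fin subr_ge0.
- by move=> x; rewrite subr_ge0.
- by apply: rsummableD => //; exact: rsummableN.
Qed.

Lemma rsum_fin (s : seq T) F : uniq s -> (forall x, x \notin s -> F x = 0) ->
  rsummable F /\ rsum F = \sum_(x <- s) F x.
Proof.
elim: s F => [|y s IH] F /=.
  move=> _ F0; have -> : F = fun=> 0 by apply/funext => x; exact: F0.
  have s0 : rsummable (fun=> 0).
    by rewrite /rsummable /summable esum1// => x _; rewrite /= normr0.
  split => //; rewrite big_nil; apply/EFin_inj; rewrite rsum_ge0//.
  exact: esum1.
move=> /andP[ys us] Fs.
pose D := fun x => if x == y then F y else 0.
have [] := IH (fun x => F x - D x) us.
  move=> x xs; rewrite /D; case: eqVneq => [->|xy]; rewrite ?subrr//.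
  by rewrite subr0 Fs// inE negb_or xy.
move=> sG Gs.
have sD1 (c : R) : 0 <= c -> (\esum_(x in [set: T]) (if x == y then c else 0)%:E)%E = c%:E.
  move=> c0; rewrite -[RHS](@esum_set1 R T y (fun=> c%:E))//.
  rewrite [RHS]esum_mkcond; apply: eq_esum => x _.
  have [->|xy] := eqVneq x y; first by rewrite mem_set.
  by rewrite memNset//= => xy'; move: xy; rewrite xy' eqxx.
have s1 : rsummable (fun x => if x == y then 1 else 0).
  rewrite /rsummable /summable.
  rewrite (@eq_esum _ _ _ _ (fun x => (if x == y then 1 else 0)%:E)) ?sD1 ?ltry//.
  by move=> x _ /=; case: ifP; rewrite ?normr1 ?normr0.
have DE : D = (fun x => F y * if x == y then 1 else 0).
  by apply/funext => x; rewrite /D; case: ifP; rewrite ?mulr1 ?mulr0.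
have sD : rsummable D by rewrite DE; exact: rsummableZ.
have FE : F = (fun x => (F x - D x) + D x) by apply/funext => x; rewrite subrK.
split; first by rewrite FE; exact: rsummableD.
rewrite [in LHS]FE rsumD// Gs big_cons addrC; congr (_ + _).
  rewrite DE rsumZ// -[RHS]mulr1; congr (_ * _); apply/EFin_inj.
  by rewrite rsum_ge0 ?sD1// => x; case: ifP.
rewrite !big_seq; apply: eq_bigr => x xs; rewrite /D.
case: eqVneq xs ys => [-> -> //|]; by rewrite subr0.
Qed.

End Sums.

Lemma complexDE (R : rcfType) (a b c d : R) :
  Complex a b + Complex c d = Complex (a + c) (b + d).
Proof. by []. Qed.

Lemma complexNE (R : rcfType) (a b : R) :
  - Complex a b = Complex (- a) (- b).
Proof. by []. Qed.

Lemma complexME (R : rcfType) (a b c d : R) :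
  Complex a b * Complex c d = Complex (a * c - b * d) (a * d + b * c).
Proof. by []. Qed.

Lemma complexJE (R : rcfType) (a b : R) : (Complex a b)^*%C = Complex a (- b).
Proof. by []. Qed.

Lemma sqr_normcE (R : rcfType) (z : R[i]) :
  normc z ^+ 2 = complex.Re z ^+ 2 + complex.Im z ^+ 2.
Proof. by case: z => a b /=; rewrite sqr_sqrtr// addr_ge0 ?sqr_ge0. Qed.

Section SquareSummable.
Context {R : realType} {T : choiceType}.
Implicit Types f g : T -> R[i].

Definition sqsum f : \bar R := (\esum_(x in [set: T]) ((normc (f x)) ^+ 2)%:E)%E.

Definition l2_pred : {pred T -> R[i]} := fun f => (sqsum f < +oo)%E.

Lemma l2_predE f : (f \in l2_pred) = (sqsum f < +oo)%E.
Proof. by []. Qed.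

Lemma l2_predP f : f \in l2_pred <-> rsummable (fun x => normc (f x) ^+ 2).
Proof.
rewrite l2_predE /rsummable /summable /sqsum.
rewrite [in X in _ <-> X](eq_esum (b := fun x => (normc (f x) ^+ 2)%:E))//.
by move=> x _ /=; rewrite ger0_norm ?sqr_ge0.
Qed.

Lemma l2_submod : submod_closed l2_pred.
Proof.
split.
  rewrite l2_predE /sqsum esum1 ?ltry// => x _.
  by rewrite normc0 expr0n.
move=> c f g /l2_predP sf /l2_predP sg; apply/l2_predP.
have sH := rsummableD (rsummableZ (2 * normc c ^+ 2) sf) (rsummableZ 2 sg).
apply: rsummableP sH => x; rewrite ger0_norm ?sqr_ge0// !sqr_normcE.
rewrite [(_ + _) x]/(c * f x + g x).
case: c (f x) (g x) => [a b] [p q] [u v] /=.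
rewrite -subr_ge0 [leRHS](_ : _ =
  ((a * p - b * q) - u) ^+ 2 + ((a * q + b * p) - v) ^+ 2); last by ring.
by rewrite addr_ge0 ?sqr_ge0.
Qed.

HB.instance Definition _ :=
  GRing.isSubmodClosed.Build R[i] (T -> R[i]) l2_pred l2_submod.

End SquareSummable.

Record l2 (R : realType) (T : choiceType) := L2 {
  l2_fun :> T -> R[i];
  l2_funP : l2_fun \in l2_pred }.

HB.instance Definition _ R T := [isSub for @l2_fun R T].
HB.instance Definition _ R T := [Choice of l2 R T by <:].
HB.instance Definition _ R T := [SubChoice_isSubLmodule of l2 R T by <:].

Section L2Theory.
Context {R : realType} {T : choiceType}.
Implicit Types (u v w : l2 R T).

Lemma l2P u v : (forall x, u x = v x) -> u = v.
Proof. by move=> uv; apply/val_inj/funext => x; exact: uv. Qed.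

Lemma l2DE u v x : (u + v) x = u x + v x. Proof. by []. Qed.
Lemma l2NE u x : (- u) x = - u x. Proof. by []. Qed.
Lemma l2ZE c u x : (c *: u) x = c * u x. Proof. by []. Qed.
Lemma l20E x : (0 : l2 R T) x = 0. Proof. by []. Qed.
Lemma l2_sumE (I : Type) (s : seq I) (F : I -> l2 R T) x :
  (\sum_(i <- s) F i) x = \sum_(i <- s) F i x.
Proof. by elim/big_ind2 : _ => // ? ? ? ? <- <-. Qed.

Definition inner u v : R[i] := csum (fun x => u x * (v x)^*%C).

Definition l2norm u : R := Num.sqrt (fine (sqsum u)).

Definition sqnorm u : R := fine (sqsum u).

Lemma sqnorm_summable u : rsummable (fun x => normc (u x) ^+ 2).
Proof. exact: (proj1 (l2_predP u) (l2_funP u)). Qed.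

Lemma sqnormE u : sqnorm u = rsum (fun x => normc (u x) ^+ 2).
Proof.
apply/EFin_inj; rewrite (rsum_ge0 _ (sqnorm_summable u)).
  rewrite /sqnorm fineK// /sqsum -(rsum_ge0 _ (sqnorm_summable u))// => x.
  by rewrite sqr_ge0.
by move=> x; rewrite sqr_ge0.
Qed.

Lemma sqnorm_ge0 u : 0 <= sqnorm u.
Proof. by rewrite /sqnorm fine_ge0// esum_ge0// => x _; rewrite lee_fin sqr_ge0. Qed.

Lemma sqr_l2norm u : l2norm u ^+ 2 = sqnorm u.
Proof. by rewrite sqr_sqrtr// sqnorm_ge0. Qed.

Lemma l2norm_ge0 u : 0 <= l2norm u. Proof. exact: sqrtr_ge0. Qed.

Let dominated u v (F : T -> R) :
  (forall x, let N := normc (u x) ^+ 2 + normc (v x) ^+ 2 in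
    - N <= 2 * F x /\ 2 * F x <= N) -> rsummable F.
Proof.
move=> H; have := rsummableZ 2^-1 (rsummableD (sqnorm_summable u) (sqnorm_summable v)).
apply: rsummableP => x; have [] := H x.
by rewrite ler_norml; move=> *; apply/andP; split; lra.
Qed.

Lemma inner_Re_summable u v : rsummable (fun x => complex.Re (u x * (v x)^*%C)).
Proof.
apply: (@dominated u v) => x; rewrite !sqr_normcE.
case: (u x) (v x) => [a b] [c d] /=.
have := sqr_ge0 (a - c); have := sqr_ge0 (b - d).
have := sqr_ge0 (a + c); have := sqr_ge0 (b + d).
by split; lra.
Qed.

Lemma inner_Im_summable u v : rsummable (fun x => complex.Im (u x * (v x)^*%C)).
Proof.
apply: (@dominated u v) => x; rewrite !sqr_normcE.
case: (u x) (v x) => [a b] [c d] /=.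
have := sqr_ge0 (a - d); have := sqr_ge0 (b - c).
have := sqr_ge0 (a + d); have := sqr_ge0 (b + c).
by split; lra.
Qed.

Lemma innerDl u v w : inner (u + v) w = inner u w + inner v w.
Proof.
rewrite /inner /csum complexDE.
rewrite -(rsumD (inner_Re_summable u w) (inner_Re_summable v w)).
rewrite -(rsumD (inner_Im_summable u w) (inner_Im_summable v w)).
by congr Complex; congr rsum; apply/funext => x; rewrite l2DE mulrDl;
  case: (u x * _) (v x * _) => [a b] [c d].
Qed.

Lemma innerC u v : inner v u = (inner u v)^*%C.
Proof.
rewrite /inner /csum complexJE -(rsumN (inner_Im_summable u v)).
by congr Complex; congr rsum; apply/funext => x;
  case: (u x) (v x) => [a b] [c d] /=; ring.
Qed.

Lemma innerZl c u v : inner (c *: u) v = c * inner u v.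
Proof.
case: c => a b; rewrite /inner /csum complexME.
have sR := @inner_Re_summable u v; have sI := @inner_Im_summable u v.
rewrite -!mulNr -(rsumZ a sR) -(rsumZ (- b) sI) -(rsumZ a sI) -(rsumZ b sR).
rewrite -(rsumD (rsummableZ a sR) (rsummableZ (- b) sI)).
rewrite -(rsumD (rsummableZ a sI) (rsummableZ b sR)).
by congr Complex; congr rsum; apply/funext => x; rewrite l2ZE -mulrA;
  case: (u x * _) => [p q]; rewrite complexME /= ?mulNr.
Qed.

Lemma innerDr u v w : inner u (v + w) = inner u v + inner u w.
Proof. by rewrite !(innerC _ u) innerDl rmorphD. Qed.

Lemma innerZr c u v : inner u (c *: v) = c^*%C * inner u v.
Proof. by rewrite !(innerC _ u) innerZl rmorphM. Qed.

Lemma inner0l u : inner 0 u = 0.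
Proof. by rewrite -(scale0r 0) innerZl mul0r. Qed.

Lemma inner_suml (I : Type) (s : seq I) (F : I -> l2 R T) v :
  inner (\sum_(i <- s) F i) v = \sum_(i <- s) inner (F i) v.
Proof.
elim: s => [|i s IH]; first by rewrite !big_nil inner0l.
by rewrite !big_cons innerDl IH.
Qed.

Lemma inner_sumr (I : Type) (s : seq I) (F : I -> l2 R T) v :
  inner v (\sum_(i <- s) F i) = \sum_(i <- s) inner v (F i).
Proof.
by rewrite innerC inner_suml rmorph_sum; apply: eq_bigr => i _; rewrite (innerC (F i) v).
Qed.

Lemma sqnorm_inner u : inner u u = Complex (sqnorm u) 0.
Proof.
rewrite sqnormE /inner /csum; congr Complex.
  congr rsum; apply/funext => x; rewrite sqr_normcE; case: (u x) => a b /=; ring.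
have -> : (fun x => complex.Im (u x * (u x)^*%C)) = (fun x => 0).
  by apply/funext => x; case: (u x) => a b /=; ring.
by have [|_ ->] := @rsum_fin R T [::] (fun=> 0) isT; rewrite ?big_nil.
Qed.

Lemma Re_inner_le (t : R) u v : 0 < t ->
  2 * complex.Re (inner u v) <= t * sqnorm u + t^-1 * sqnorm v.
Proof.
move=> t0; rewrite !sqnormE /=.
rewrite -(rsumZ 2 (inner_Re_summable u v)) -(rsumZ t (sqnorm_summable u)).
rewrite -(rsumZ t^-1 (sqnorm_summable v)).
have sZu := rsummableZ t (sqnorm_summable u).
have sZv := rsummableZ t^-1 (sqnorm_summable v).
rewrite -(rsumD sZu sZv).
apply: (ler_rsum (rsummableZ 2 (inner_Re_summable u v)) (rsummableD sZu sZv)).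
move=> x; rewrite !sqr_normcE; case: (u x) (v x) => [a b] [c d] /=.
rewrite -subr_ge0.
have -> : t * (a ^+ 2 + b ^+ 2) + t^-1 * (c ^+ 2 + d ^+ 2) -
    2 * (a * c - b * - d) = t^-1 * ((t * a - c) ^+ 2 + (t * b - d) ^+ 2).
  by field; rewrite gt_eqF.
by rewrite mulr_ge0 ?invr_ge0 ?(ltW t0)// addr_ge0 ?sqr_ge0.
Qed.

Lemma sqnormD_le u v : sqnorm (u + v) <= 2 * sqnorm u + 2 * sqnorm v.
Proof.
rewrite !sqnormE -(rsumZ 2 (sqnorm_summable u)) -(rsumZ 2 (sqnorm_summable v)).
have sZu := rsummableZ 2 (sqnorm_summable u).
have sZv := rsummableZ 2 (sqnorm_summable v).
rewrite -(rsumD sZu sZv).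
apply: (ler_rsum (sqnorm_summable _) (rsummableD sZu sZv)).
move=> x; rewrite l2DE !sqr_normcE; case: (u x) (v x) => [a b] [c d] /=.
by have := sqr_ge0 (a - c); have := sqr_ge0 (b - d); lra.
Qed.

Lemma sqnormZ c u : sqnorm (c *: u) = normc c ^+ 2 * sqnorm u.
Proof.
rewrite !sqnormE -(rsumZ _ (sqnorm_summable u)).
by congr rsum; apply/funext => x; rewrite l2ZE normcM exprMn.
Qed.

Lemma sqnormN u : sqnorm (- u) = sqnorm u.
Proof. by rewrite !sqnormE; congr rsum; apply/funext => x; rewrite l2NE normcN. Qed.

Lemma finsupp_l2 (s : seq T) (f : T -> R[i]) : uniq s ->
  (forall x, x \notin s -> f x = 0) -> f \in l2_pred.
Proof.
move=> us fs; apply/l2_predP.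
have [|//] := @rsum_fin R T s (fun x => normc (f x) ^+ 2) us.
by move=> x /fs ->; rewrite normc0 expr0n.
Qed.

Lemma sqnorm_finsupp (s : seq T) u : uniq s -> (forall x, x \notin s -> u x = 0) ->
  sqnorm u = \sum_(x <- s) normc (u x) ^+ 2.
Proof.
move=> us fs; rewrite sqnormE.
have [|_ ->//] := @rsum_fin R T s (fun x => normc (u x) ^+ 2) us.
by move=> x /fs ->; rewrite normc0 expr0n.
Qed.

Fact delta_subproof (x : T) : (fun y => (y == x)%:R : R[i]) \in l2_pred.
Proof.
apply: (@finsupp_l2 [:: x]) => // y; rewrite inE => /negbTE ->.
by [].
Qed.

Definition delta x : l2 R T := L2 (delta_subproof x).

Lemma deltaE x y : delta x y = (y == x)%:R. Proof. by []. Qed.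

Lemma inner_deltal x u : inner (delta x) u = (u x)^*%C.
Proof.
have H y : y \notin [:: x] -> (delta x) y * (u y)^*%C = 0.
  by rewrite inE => /negbTE /= ->; rewrite mul0r.
have E : delta x x * (u x)^*%C = (u x)^*%C by rewrite /= eqxx mul1r.
rewrite /inner /csum.
have [|_ ->] := @rsum_fin R T [:: x] (fun x0 => complex.Re (delta x x0 * (u x0)^*%C)) isT.
  by move=> y /H ->.
have [|_ ->] := @rsum_fin R T [:: x] (fun x0 => complex.Im (delta x x0 * (u x0)^*%C)) isT.
  by move=> y /H ->.
by rewrite !big_seq1 E; case: (_^*%C).
Qed.

Lemma inner_deltar x u : inner u (delta x) = u x.
Proof. by rewrite innerC inner_deltal conjcK. Qed.

Lemma sum_deltaE (s : seq T) (F : T -> R[i]) y : uniq s ->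
  (\sum_(x <- s) F x *: delta x) y = if y \in s then F y else 0.
Proof.
move=> us; rewrite l2_sumE (eq_bigr (fun x => F x * (y == x)%:R))//; case: ifPn => ys.
  rewrite (bigD1_seq y)// eqxx mulr1 big1 => [|x xy]; first exact: addr0.
  by rewrite eq_sym (negbTE xy) mulr0.
rewrite big_seq big1// => x xs; case: eqVneq => [yx|_]; last by rewrite mulr0.
by move: ys; rewrite yx xs.
Qed.

Lemma sqsum_le (f : T -> R[i]) (K : R) :
  (forall s : seq T, uniq s -> \sum_(x <- s) normc (f x) ^+ 2 <= K) ->
  (sqsum f <= K%:E)%E.
Proof.
move=> H; apply: ge_ereal_sup => _ [A [fA _] <-].
rewrite fsbig_finite//= sumEFin lee_fin; apply: H; exact: fset_uniq.
Qed.

Lemma sqsum_adherent u (e : R) : 0 < e -> exists s : seq T, uniq s /\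
  sqnorm (u - \sum_(x <- s) u x *: delta x) <= e.
Proof.
move=> e0; have fu : (sqsum u)%E = (sqnorm u)%:E.
  by rewrite sqnormE (rsum_ge0 _ (sqnorm_summable u))// => x; rewrite sqr_ge0.
have : ((sqnorm u - e)%:E < sqsum u)%E by rewrite fu lte_fin ltrBlDr ltrDl.
move=> /ereal_sup_gt[_ [A [fA _] <-]].
rewrite fsbig_finite//= sumEFin lte_fin => H.
exists (fset_set A); split; first exact: fset_uniq.
set s : seq T := fset_set A; set w := \sum_(x <- s) _.
have us : uniq s by exact: fset_uniq.
have wE y : w y = if y \in s then u y else 0 by exact: sum_deltaE.
have -> : sqnorm (u - w) = sqnorm u - sqnorm w.
  apply/eqP; rewrite eq_sym subr_eq eq_sym !sqnormE -(rsumD (sqnorm_summable _) (sqnorm_summable _)).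
  apply/eqP; congr rsum; apply/funext => x; rewrite l2DE l2NE wE.
  by case: ifP; rewrite ?subrr ?subr0 ?normc0 ?expr0n ?addr0 ?add0r.
rewrite (@sqnorm_finsupp s w us); last by move=> x xs; rewrite wE (negbTE xs).
rewrite [X in _ - X](_ : _ = \sum_(x <- s) normc (u x) ^+ 2); last first.
  by rewrite !big_seq; apply: eq_bigr => x xs; rewrite wE xs.
by rewrite lerBlDr addrC -lerBlDr ltW.
Qed.

End L2Theory.

Definition bounded_op (R : realType) (T : choiceType) (f : l2 R T -> l2 R T) :=
  exists M : R, forall v, l2norm (f v) <= M * l2norm v.

Record bop (R : realType) (T : choiceType) := Bop {
  bop_fun :> l2 R T -> l2 R T;
  bop_linear : linear bop_fun;
  bop_bounded : bounded_op bop_fun }.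

HB.instance Definition _ R T := gen_eqMixin (bop R T).
HB.instance Definition _ R T := gen_choiceMixin (bop R T).
HB.instance Definition _ R T (a : bop R T) :=
  GRing.isLinear.Build R[i] (l2 R T) (l2 R T) *:%R a (bop_linear a).

Section BopTheory.
Context {R : realType} {T : choiceType}.
Implicit Types (u v w : l2 R T) (a b c : bop R T).

Lemma bopP a b : (forall v, a v = b v) -> a = b.
Proof.
case: a b => [f lf bf] [g lg bg] /= fg.
have E : f = g by exact/funext.
by subst g; congr Bop; exact: Prop_irrelevance.
Qed.

Lemma bopZr a (z : R[i]) v : a (z *: v) = z *: a v.
Proof. exact: linearZ. Qed.

Lemma bop_sumr a (I : Type) (s : seq I) (F : I -> l2 R T) :
  a (\sum_(i <- s) F i) = \sum_(i <- s) a (F i).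
Proof. exact: linear_sum. Qed.

Lemma bounded_sqnormP (f : l2 R T -> l2 R T) :
  bounded_op f <-> exists2 M : R, 0 < M & forall v, sqnorm (f v) <= M * sqnorm v.
Proof.
split=> [[M H]|[M M0 H]].
  exists (M ^+ 2 + 1) => [|v]; first by rewrite ltr_wpDl// sqr_ge0.
  have := H v; rewrite -!sqr_l2norm.
  have := l2norm_ge0 v; have := l2norm_ge0 (f v).
  move: (l2norm v) (l2norm (f v)) => x y y0 x0 yMx.
  rewrite mulrDl mul1r -exprMn ler_wpDr ?sqr_ge0//.
  by rewrite ler_sqr ?nnegrE// (le_trans y0).
exists (Num.sqrt M) => v; have Mv0 : 0 <= Num.sqrt M * l2norm v.
  by rewrite mulr_ge0 ?sqrtr_ge0 ?l2norm_ge0.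
rewrite -(ler_sqr (l2norm_ge0 _) Mv0) exprMn !sqr_l2norm.
rewrite (sqr_sqrtr (ltW M0)); exact: H.
Qed.

Fact zero_bop_bounded : bounded_op (fun _ : l2 R T => 0 : l2 R T).
Proof.
apply/bounded_sqnormP; exists 1 => // v.
by rewrite mul1r -(scale0r 0) sqnormZ normc0 expr0n mul0r sqnorm_ge0.
Qed.
Fact zero_bop_linear : linear (fun _ : l2 R T => 0 : l2 R T).
Proof. by move=> c u v; rewrite scaler0 addr0. Qed.
Definition zero_bop := Bop zero_bop_linear zero_bop_bounded.

Fact one_bop_bounded : bounded_op (fun v : l2 R T => v).
Proof. by exists 1 => v; rewrite mul1r. Qed.
Fact one_bop_linear : linear (fun v : l2 R T => v).
Proof. by []. Qed.
Definition one_bop := Bop one_bop_linear one_bop_bounded.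

Fact add_bop_bounded a b : bounded_op (fun v => a v + b v).
Proof.
have /bounded_sqnormP[M M0 aM] := bop_bounded a.
have /bounded_sqnormP[N N0 bN] := bop_bounded b.
apply/bounded_sqnormP; exists (2 * M + 2 * N) => [|v]; first lra.
apply: le_trans (sqnormD_le _ _) _; have := aM v; have := bN v; lra.
Qed.
Fact add_bop_linear a b : linear (fun v => a v + b v).
Proof. by move=> c u v; rewrite !linearP scalerDr addrACA. Qed.
Definition add_bop a b := Bop (add_bop_linear a b) (add_bop_bounded a b).

Fact opp_bop_bounded a : bounded_op (fun v => - a v).
Proof.
have /bounded_sqnormP[M M0 aM] := bop_bounded a.
by apply/bounded_sqnormP; exists M => // v; rewrite sqnormN.
Qed.
Fact opp_bop_linear a : linear (fun v => - a v).
Proof. by move=> c u v; rewrite linearP opprD scalerN. Qed.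
Definition opp_bop a := Bop (opp_bop_linear a) (opp_bop_bounded a).

Fact scale_bop_bounded (z : R[i]) a : bounded_op (fun v => z *: a v).
Proof.
have /bounded_sqnormP[M M0 aM] := bop_bounded a.
apply/bounded_sqnormP; exists (normc z ^+ 2 * M + 1) => [|v].
  by rewrite ltr_wpDl// mulr_ge0 ?sqr_ge0// ltW.
rewrite sqnormZ mulrDl mul1r ler_wpDr ?sqnorm_ge0// -[leRHS]mulrA.
by rewrite ler_wpM2l// sqr_ge0.
Qed.
Fact scale_bop_linear (z : R[i]) a : linear (fun v => z *: a v).
Proof. by move=> c u v; rewrite linearP scalerDr !scalerA mulrC. Qed.
Definition scale_bop z a := Bop (scale_bop_linear z a) (scale_bop_bounded z a).

Fact mul_bop_bounded a b : bounded_op (fun v => a (b v)).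
Proof.
have /bounded_sqnormP[M M0 aM] := bop_bounded a.
have /bounded_sqnormP[N N0 bN] := bop_bounded b.
apply/bounded_sqnormP; exists (M * N) => [|v]; first exact: mulr_gt0.
by rewrite (le_trans (aM _))// -mulrA ler_wpM2l// ltW.
Qed.
Fact mul_bop_linear a b : linear (fun v => a (b v)).
Proof. by move=> c u v; rewrite !linearP. Qed.
Definition mul_bop a b := Bop (mul_bop_linear a b) (mul_bop_bounded a b).

Let addA : associative add_bop.
Proof. by move=> a b c; apply/bopP => v /=; rewrite addrA. Qed.
Let addC : commutative add_bop.
Proof. by move=> a b; apply/bopP => v /=; rewrite addrC. Qed.
Let add0 : left_id zero_bop add_bop.
Proof. by move=> a; apply/bopP => v /=; rewrite add0r. Qed.
Let addN : left_inverse zero_bop opp_bop add_bop.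
Proof. by move=> a; apply/bopP => v /=; rewrite addNr. Qed.
HB.instance Definition _ := GRing.isZmodule.Build (bop R T) addA addC add0 addN.

Let mulA : associative mul_bop.
Proof. by move=> a b c; apply/bopP. Qed.
Let mul1 : left_id one_bop mul_bop.
Proof. by move=> a; apply/bopP. Qed.
Let mulr1_ : right_id one_bop mul_bop.
Proof. by move=> a; apply/bopP. Qed.
Let mulDl : left_distributive mul_bop +%R.
Proof. by move=> a b c; apply/bopP. Qed.
Let mulDr : right_distributive mul_bop +%R.
Proof. by move=> a b c; apply/bopP => v /=; rewrite raddfD. Qed.
HB.instance Definition _ :=
  GRing.Zmodule_isPzRing.Build (bop R T) mulA mul1 mulr1_ mulDl mulDr.

Let scaleA (x y : R[i]) a : scale_bop x (scale_bop y a) = scale_bop (x * y) a.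
Proof. by apply/bopP => v /=; rewrite scalerA. Qed.
Let scale1 : left_id 1 scale_bop.
Proof. by move=> a; apply/bopP => v /=; rewrite scale1r. Qed.
Let scaleDr_ : right_distributive scale_bop +%R.
Proof. by move=> z a b; apply/bopP => v /=; rewrite scalerDr. Qed.
Let scaleDl a : {morph scale_bop^~ a : x y / x + y}.
Proof. by move=> x y; apply/bopP => v /=; rewrite scalerDl. Qed.
HB.instance Definition _ :=
  GRing.Zmodule_isLmodule.Build R[i] (bop R T) scaleA scale1 scaleDr_ scaleDl.

Lemma bopDE a b v : (a + b) v = a v + b v. Proof. by []. Qed.
Lemma bopNE a v : (- a) v = - a v. Proof. by []. Qed.
Lemma bopME a b v : (a * b) v = a (b v). Proof. by []. Qed.
Lemma bopZE z a v : (z *: a) v = z *: a v. Proof. by []. Qed.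
Lemma bop1E v : (1 : bop R T) v = v. Proof. by []. Qed.
Lemma bop0E v : (0 : bop R T) v = 0. Proof. by []. Qed.

Definition opnorm a : R := sup [set l2norm (a v) | v in [set v | l2norm v <= 1]].

(* The adjoint: (adj a v) x = <adj a v, delta x> = <v, a (delta x)>. *)
Let adj_val a v := fun x => inner v (a (delta x)).

Let adj_bound a (M : R) v : 0 < M -> (forall w, sqnorm (a w) <= M * sqnorm w) ->
  (sqsum (adj_val a v) <= (M * sqnorm v)%:E)%E.
Proof.
move=> M0 aM; apply: sqsum_le => s us.
set K := \sum_(x <- s) _.
pose w := \sum_(x <- s) adj_val a v x *: delta x.
have wE y : w y = if y \in s then adj_val a v y else 0 by exact: sum_deltaE.
have nw : sqnorm w = K.
  rewrite (@sqnorm_finsupp _ _ s)//; last by move=> x xs; rewrite wE (negbTE xs).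
  by rewrite /K !big_seq; apply: eq_bigr => x xs; rewrite wE xs.
have iw : inner v (a w) = Complex K 0.
  rewrite /w bop_sumr inner_sumr /K.
  rewrite (eq_bigr (fun x => Complex (normc (adj_val a v x) ^+ 2) 0)).
    by elim/big_ind2 : _ => // [x1 y1 x2 y2 -> ->]; rewrite complexDE addr0.
  move=> x _; rewrite bopZr innerZr -/(adj_val a v x) sqr_normcE.
  by case: (adj_val a v x) => p q; rewrite complexJE complexME /=; congr Complex; ring.
have := @Re_inner_le R T M v (a w) M0; rewrite iw /=.
have : M^-1 * sqnorm (a w) <= K by rewrite -nw ler_pdivrMl.
lra.
Qed.

Let adj_l2 a v : adj_val a v \in l2_pred.
Proof.
have /bounded_sqnormP[M M0 aM] := bop_bounded a.
by rewrite l2_predE (le_lt_trans (adj_bound v M0 aM))// ltry.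
Qed.

Let adj_fun a v : l2 R T := L2 (adj_l2 a v).

Let adj_linear a : linear (adj_fun a).
Proof.
move=> c u v; apply/l2P => x; rewrite l2DE l2ZE.
by rewrite [LHS]innerDl innerZl.
Qed.

Let adj_sqnorm a (M : R) v : 0 < M -> (forall w, sqnorm (a w) <= M * sqnorm w) ->
  sqnorm (adj_fun a v) <= M * sqnorm v.
Proof.
move=> M0 aM; have := adj_bound v M0 aM.
rewrite -lee_fin {1}/sqnorm fineK//.
rewrite ge0_fin_numE; first exact: adj_l2.
by apply: esum_ge0 => x _; rewrite lee_fin sqr_ge0.
Qed.

Let adj_bounded a : bounded_op (adj_fun a).
Proof.
have /bounded_sqnormP[M M0 aM] := bop_bounded a.
by apply/bounded_sqnormP; exists M => // v; exact: adj_sqnorm.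
Qed.

Definition adj a : bop R T := Bop (@adj_linear a) (adj_bounded a).

Let adj_Re_le a u v :
  complex.Re (inner (a u) v) <= complex.Re (inner u (adj a v)).
Proof.
have /bounded_sqnormP[M M0 aM] := bop_bounded a.
apply/ler_addgt0Pr => e e0.
pose K := sqnorm v + sqnorm (adj a v) + 1.
have K0 : 0 < K by rewrite ltr_wpDl// addr_ge0 ?sqnorm_ge0.
pose t := K / e; have t0 : 0 < t by rewrite divr_gt0.
pose d := e / (t * (M + 1)).
have M10 : 0 < M + 1 by rewrite addr_gt0.
have d0 : 0 < d by rewrite divr_gt0// mulr_gt0.
have [s [us rd]] := sqsum_adherent u d0.
set w := \sum_(x <- s) u x *: delta x in rd.
set r := u - w in rd.
have ur : u = w + r by rewrite addrC subrK.
have Ew : inner (a w) v = inner w (adj a v).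
  rewrite /w bop_sumr !inner_suml; apply: eq_bigr => x _.
  rewrite bopZr !innerZl; congr (_ * _).
  by rewrite inner_deltal /= [RHS](_ : _ = (inner v (a (delta x)))^*%C)// -innerC.
have H1 := @Re_inner_le R T t (a r) v t0.
have H2 := @Re_inner_le R T t (- r) (adj a v) t0.
have -> : inner (a u) v = inner w (adj a v) + inner (a r) v.
  by rewrite [in LHS]ur linearD innerDl Ew.
have -> : inner u (adj a v) = inner w (adj a v) - inner (- r) (adj a v).
  by rewrite [in LHS]ur innerDl -[- r]scaleN1r innerZl mulN1r opprK.
have ReD (z1 z2 : R[i]) : complex.Re (z1 + z2) = complex.Re z1 + complex.Re z2.
  by case: z1 z2 => [? ?] [? ?].
have ReN (z : R[i]) : complex.Re (- z) = - complex.Re z by case: z.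
rewrite !ReD ReN; rewrite sqnormN in H2.
have tK : t^-1 * K = e by rewrite /t invf_div divfK// gt_eqF.
have td : t * (M + 1) * d = e.
  by rewrite /d mulrC divfK// gt_eqF// mulr_gt0.
have H3 : t * sqnorm (a r) + t * sqnorm r <= e.
  rewrite -td -mulrDr -mulrA ler_pM2l// (le_trans (lerD (aM r) (lexx _)))//.
  by rewrite -[X in _ + X]mul1r -mulrDl ler_pM2l.
have H4 : t^-1 * sqnorm v + t^-1 * sqnorm (adj a v) <= e.
  by rewrite -tK -mulrDr ler_pM2l ?invr_gt0// lerDl.
lra.
Qed.

Lemma adjP a u v : inner (a u) v = inner u (adj a v).
Proof.
have Re_eq w : complex.Re (inner (a w) v) = complex.Re (inner w (adj a v)).
  apply/eqP; rewrite eq_le adj_Re_le andTb.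
  have := @adj_Re_le a (- w) v.
  rewrite -[- w]scaleN1r bopZr !innerZl !mulN1r.
  by case: (inner (a w) v) (inner w _) => [? ?] [? ?]; rewrite !complexNE /= lerN2.
have := Re_eq u; have := Re_eq (Complex 0 1 *: u).
rewrite bopZr !innerZl.
case: (inner (a u) v) (inner u _) => [p q] [p' q'].
by rewrite !complexME /= !mul0r !mul1r !sub0r => /oppr_inj -> ->.
Qed.

Lemma adj_unique a b : (forall u v, inner (a u) v = inner u (b v)) -> b = adj a.
Proof.
move=> H; apply/bopP => v; apply/l2P => x.
by apply: (can_inj (@conjcK R)); rewrite -!inner_deltal -H adjP.
Qed.

End BopTheory.

Section Cutdown.
Context {R : realType} {T : choiceType}.
Implicit Types (A : set T) (u v : l2 R T).

Let chi_val A v := fun x => if x \in A then v x else 0.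

Let chi_normc A v x : normc (chi_val A v x) ^+ 2 <= normc (v x) ^+ 2.
Proof. by rewrite /chi_val; case: ifP; rewrite ?normc0 ?expr0n ?sqr_ge0. Qed.

Let chi_l2 A v : chi_val A v \in l2_pred.
Proof.
rewrite l2_predE (le_lt_trans _ (l2_funP v))//.
by apply: le_esum => x _; rewrite lee_fin chi_normc.
Qed.

Let chi_fun A v : l2 R T := L2 (chi_l2 A v).

Let chi_linear A : linear (chi_fun A).
Proof.
move=> c u v; apply/l2P => x; rewrite l2DE l2ZE /= /chi_val.
by case: ifP; rewrite ?mulr0 ?addr0.
Qed.

Let chi_bounded A : bounded_op (chi_fun A).
Proof.
apply/bounded_sqnormP; exists 1 => // v; rewrite mul1r !sqnormE.
by apply: (ler_rsum (sqnorm_summable _) (sqnorm_summable _)) => x;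
  exact: chi_normc.
Qed.

Definition chi A : bop R T := Bop (@chi_linear A) (chi_bounded A).

Lemma chiE A v x : chi A v x = if x \in A then v x else 0.
Proof. by []. Qed.

End Cutdown.

(* The infimum is +oo when A or B is empty. *)
Definition setdist (R : realType) (X : metricType R) (A B : set X) : \bar R :=
  ereal_inf [set (mdist x y)%:E | x in A & y in B].

Definition quasi_local (R : realType) (X : metricType R) : set (bop R X) :=
  [set a | forall eps : R, 0 < eps -> exists2 r : R, 0 < r &
    forall A B : set X, (r%:E < setdist A B)%E ->
      opnorm (chi A * a * chi B) <= eps].

Section Cartan.
Context {R : realType} {T : choiceType}.
Implicit Types (B C D S : set (bop R T)).

Record star_subalgebra D : Prop := StarSubalgebra {
  star_sub0 : D 0;
  star_subD : forall a b, D a -> D b -> D (a + b);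
  star_subZ : forall (z : R[i]) a, D a -> D (z *: a);
  star_subM : forall a b, D a -> D b -> D (a * b);
  star_subJ : forall a, D a -> D (adj a) }.

Definition norm_closed D := forall a,
  (forall eps : R, 0 < eps -> exists2 b, D b & opnorm (a - b) < eps) -> D a.

Definition cstar_subalgebra D := star_subalgebra D /\ norm_closed D.

Definition cstar_generated S : set (bop R T) := smallest cstar_subalgebra S.

Definition abelian_set D := forall a b, D a -> D b -> a * b = b * a.

Definition maximal_abelian C B :=
  abelian_set B /\
  forall D, star_subalgebra D -> abelian_set D -> D `<=` C -> B `<=` D -> D = B.

Definition normalizer C B : set (bop R T) :=
  [set a | C a /\ forall b, B b -> B (a * b * adj a) /\ B (adj a * b * a)].

(* Complete positivity needs no separate clause: by the bimodule property,
   sum_ij b_i^* E(a_i^* a_j) b_j = E(c^* c) for c = sum_i a_i b_i. *)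
Record conditional_expectation C B (E : bop R T -> bop R T) : Prop := CondExp {
  cexp_in : forall a, C a -> B (E a);
  cexpD : forall a b, C a -> C b -> E (a + b) = E a + E b;
  cexpZ : forall (z : R[i]) a, C a -> E (z *: a) = z *: E a;
  cexp_id : forall b, B b -> E b = b;
  cexp_contractive : forall a, C a -> opnorm (E a) <= opnorm a;
  cexp_pos : forall a, C a -> exists2 b, B b & E (adj a * a) = adj b * b;
  cexp_bimodule : forall b1 a b2, B b1 -> C a -> B b2 ->
    E (b1 * a * b2) = b1 * E a * b2 }.

Definition faithful_on C (E : bop R T -> bop R T) :=
  forall a, C a -> E (adj a * a) = 0 -> a = 0.

Record cartan_subalgebra C B : Prop := CartanSubalgebra {
  cartan_cstar : cstar_subalgebra B;
  cartan_sub : B `<=` C;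
  cartan_masa : maximal_abelian C B;
  cartan_regular : cstar_generated (normalizer C B) = C;
  cartan_cexp : exists2 E, conditional_expectation C B E & faithful_on C E }.

Definition linf : set (nat -> R[i]) :=
  [set f | exists M : R, forall n, normc (f n) <= M].

Record star_isomorphism_from_linf B (phi : (nat -> R[i]) -> bop R T) : Prop :=
  StarIsoLinf {
    isoD : forall f g, linf f -> linf g -> phi (f + g) = phi f + phi g;
    isoZ : forall (z : R[i]) f, linf f -> phi (z *: f) = z *: phi f;
    isoM : forall f g, linf f -> linf g -> phi (f * g) = phi f * phi g;
    isoJ : forall f, linf f -> phi (fun n => (f n)^*%C) = adj (phi f);
    iso_bij : set_bij linf B phi }.

Definition isomorphic_to_linf B := exists phi, star_isomorphism_from_linf B phi.

End Cartan.

Section Expanders.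
Context {R : realType}.

Definition vertex_boundary (V : finType) (e : rel V) (A : {set V}) : {set V} :=
  [set v in ~: A | [exists u in A, e v u]].

Record expander (k : nat) (h : R) (V : finType) (e : rel V) : Prop := Expander {
  expander_sym : symmetric e;
  expander_deg : forall v, (#|[set u | e v u]| <= k)%N;
  expander_iso : forall A : {set V}, #|A|%:R <= #|V|%:R / 2 :> R ->
    h * #|A|%:R <= #|vertex_boundary e A|%:R }.

(* The infimum is +oo when y is not reachable from x. *)
Definition graph_dist (V : finType) (e : rel V) (x y : V) : \bar R :=
  ereal_inf [set (size p)%:R%:E | p in [set p | path e x p /\ last x p = y]].

(* The maps iota n identify X with the disjoint union of the V n. *)
Record coarse_union_of_expanders (k : nat) (h : R) (V : nat -> finType)
    (e : forall n, rel (V n)) (X : metricType R) (iota : forall n, V n -> X) :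
    Prop := CoarseUnionOfExpanders {
  cue_expander : forall n, expander k h (e n);
  cue_card : #|V n| @[n --> \oo] --> \oo;
  cue_bij : bijective (fun p : {n : nat & V n} => iota (tag p) (tagged p));
  cue_dist : forall n (x y : V n),
    (mdist (iota n x) (iota n y))%:E = graph_dist (e n) x y;
  cue_far : forall M : R, \forall n & m \near \oo, n != m ->
    (M%:E <= setdist (range (iota n)) (range (iota m)))%E }.

End Expanders.

(* Main.v *)
Require Import Defs.
From HB Require Import structures.
From mathcomp Require Import all_boot all_order all_algebra.
From mathcomp Require Import ring lra zify complex.
From mathcomp Require Import all_classical all_reals all_analysis.

(** Let [C] be the quasi-local algebra and suppose that it has a Cartan subalgebra
    [B] isomorphic to l_infty.

    Since [C] contains all rank-one operators and [B] is maximal abelian, the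
    atoms of [B] have rank one; since the conditional expectation onto [B] is
    faithful, their unit vectors [xi n] form an orthonormal basis of l_2
    ([cartan_linf_basis]). So [B] consists of the operators that are diagonal in
    this basis, a normalizer of [B] is monomial in it, and regularity of [B] makes
    every element of [C] a norm limit of sparse matrices, those with a bounded
    number of nonzero entries per row and column ([cartan_linf_structure]). The
    contradiction is an element of [C] which is not such a limit.

    If [xi] were the canonical basis of l_2, it would be enough to find one with a
    flat kernel. On an expander [X_n] two distant sets cannot both have large
    density ([far_sets_small]). So an operator on l_2 of [X_n] is quasi-local,
    uniformly in [n], as soon as cutting it down to sets of small density on
    either side makes its norm small. This holds for sums of [w t] times the
    projections onto orthogonal functions [g t] of modulus one whose combinations
    have fourth moments comparable to their second ones. With quadratic phases
    over a prime field as [g t] and cubic phases as [w t], moreover, Weyl's bound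
    on exponential sums makes the kernel small, uniformly, compared with the
    number of functions [g t] ([flat_system_exists]). The trace pairing of this
    operator with itself is that number, its pairing with a sparse operator is
    much smaller, so that no sparse operator is close to it.

    The basis [xi] may be a different one, but it is related to the canonical
    one. The operators with diagonal [+1] and [-1] in [xi] are in [C] whatever
    the signs, and balls in [X] have boundedly many points. If some points [x] had
    much of their mass on basis vectors with arbitrarily small coefficients,
    suitable signs would move this mass away from [x], and a gliding hump would
    give a sign operator that is not quasi-local. Hence the small entries of the
    change of basis have little mass at each point ([points_spread_little]), while
    its large entries form a sparse matrix, which does no harm to flat kernels.
    Multiplying the functions [g t] by well chosen signs makes the contribution of
    the small entries to the trace pairing negligible ([trace_estimate]).

    This gives, for every [K], an operator on each large enough block that is far
    from all [K]-sparse ones ([delocalized_far_from_sparse]). The direct sum of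
    such operators, with [K] tending to infinity along the blocks, is in [C] and
    is not a limit of sparse operators. *)

Set Implicit Arguments.
Unset Strict Implicit.
Unset Printing Implicit Defensive.
Import Order.TTheory GRing.Theory Num.Theory.
Import Normc numFieldNormedType.Exports.

Local Open Scope classical_set_scope.
Local Open Scope ring_scope.

(** * Moduli of complex numbers and the geometry of l_2 *)

Section ComplexModulus.
Context {R : rcfType}.
Implicit Types z : R[i].

Lemma normc_opp z : normc (- z) = normc z.
Proof. exact: normcN. Qed.

Lemma normcD_le z1 z2 : normc (z1 + z2) <= normc z1 + normc z2.
Proof. exact: le_normcD. Qed.

Lemma normc_ge0 z : 0 <= normc z.
Proof. by case: z => a b; exact: sqrtr_ge0. Qed.

Lemma normcJ_eq z : normc (z^*)%C = normc z.
Proof. by case: z => a b /=; rewrite sqrrN. Qed.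

Lemma mulcJ_eq z : z * (z^*)%C = Complex (normc z ^+ 2) 0.
Proof.
by rewrite sqr_normcE; case: z => a b; rewrite complexJE complexME; congr Complex => /=; ring.
Qed.

Lemma ReD z1 z2 : complex.Re (z1 + z2) = complex.Re z1 + complex.Re z2.
Proof. by case: z1 z2 => [? ?] [? ?]. Qed.

Lemma Re_le_normc z : complex.Re z <= normc z.
Proof.
apply: le_trans (ler_norm _) _; case: z => a b /=.
by rewrite -sqrtr_sqr ler_sqrt ?addr_ge0 ?sqr_ge0// lerDl sqr_ge0.
Qed.

Lemma normc_sum (I : Type) (s : seq I) (P : pred I) (F : I -> R[i]) :
  normc (\sum_(i <- s | P i) F i) <= \sum_(i <- s | P i) normc (F i).
Proof.
elim/big_ind2 : _ => [|x1 x2 y1 y2 le1 le2|//]; first by rewrite normc0.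
by apply: le_trans (le_normcD _ _) _; exact: lerD.
Qed.

Lemma normcX z n : normc (z ^+ n) = normc z ^+ n.
Proof. by elim: n => [|n IH]; rewrite ?expr0 ?normc1// !exprS normcM IH. Qed.

Lemma normc_real (x : R) : 0 <= x -> normc (Complex x 0) = x.
Proof. by move=> x0 /=; rewrite expr0n addr0 sqrtr_sqr ger0_norm. Qed.

Lemma normc_sqrB z1 z2 : normc z2 ^+ 2 <= 2 * normc z1 ^+ 2 + 2 * normc (z1 - z2) ^+ 2.
Proof.
rewrite !sqr_normcE; case: z1 z2 => [a b] [c d] /=.
by have := sqr_ge0 (2 * a - c); have := sqr_ge0 (2 * b - d); lra.
Qed.

End ComplexModulus.

Section L2Geometry.
Context {R : realType} {T : choiceType}.
Implicit Types (u v w : l2 R T) (a b : bop R T).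

Lemma inner_scalel (c : R[i]) u v : inner (c *: u) v = c * inner u v.
Proof. exact: innerZl. Qed.

Lemma inner_scaler (c : R[i]) u v : inner u (c *: v) = (c^*)%C * inner u v.
Proof. exact: innerZr. Qed.

Lemma inner_sumZl (I : Type) (s : seq I) (c : I -> R[i]) (F : I -> l2 R T) v :
  inner (\sum_(i <- s) c i *: F i) v = \sum_(i <- s) c i * inner (F i) v.
Proof. by rewrite inner_suml; apply: eq_bigr => i _; rewrite inner_scalel. Qed.

Lemma inner_sumZr (I : Type) (s : seq I) (c : I -> R[i]) (F : I -> l2 R T) v :
  inner v (\sum_(i <- s) c i *: F i) = \sum_(i <- s) (c i)^*%C * inner v (F i).
Proof. by rewrite inner_sumr; apply: eq_bigr => i _; rewrite inner_scaler. Qed.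

Lemma bopDr a u v : a (u + v) = a u + a v.
Proof. exact: raddfD. Qed.

Lemma bopNr a u : a (- u) = - a u.
Proof. exact: raddfN. Qed.

Lemma cauchy_schwarz u v : normc (inner u v) ^+ 2 <= sqnorm u * sqnorm v.
Proof.
set z := inner u v.
have [z0|z0] := eqVneq (normc z ^+ 2) 0.
  by rewrite z0 mulr_ge0 ?sqnorm_ge0.
have zp : 0 < normc z ^+ 2 by rewrite lt_def z0 sqr_ge0.
have E : complex.Re (inner ((z^*)%C *: u) v) = normc z ^+ 2.
  by rewrite innerZl -/z mulrC mulcJ_eq.
(* [sqnorm u] may vanish, so the optimal parameter is perturbed by [e]. *)
suff H e : 0 < e -> normc z ^+ 2 <= sqnorm u * sqnorm v + e * sqnorm v.
  apply/ler_addgt0Pr => e e0.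
  have v1 : 0 < sqnorm v + 1 by rewrite ltr_wpDl ?sqnorm_ge0.
  apply: le_trans (H (e / (sqnorm v + 1)) _) _; first exact: divr_gt0.
  rewrite lerD2l mulrAC ler_pdivrMr// ler_pM2l//; lra.
move=> e0; have ue : 0 < sqnorm u + e by rewrite ltr_wpDl ?sqnorm_ge0.
have t0 : 0 < (sqnorm u + e)^-1 by rewrite invr_gt0.
have := Re_inner_le ((z^*)%C *: u) v t0.
rewrite E sqnormZ normcJ_eq invrK.
have : (sqnorm u + e)^-1 * (normc z ^+ 2 * sqnorm u) <= normc z ^+ 2.
  by rewrite mulrC ler_pdivrMr// ler_pM2l//; lra.
lra.
Qed.

Lemma sqnormD u v :
  sqnorm (u + v) = sqnorm u + sqnorm v + 2 * complex.Re (inner u v).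
Proof.
have := congr1 (@complex.Re R) (sqnorm_inner (u + v)).
rewrite innerDl !innerDr (innerC u v) !ReD !sqnorm_inner /= => <-.
by case: (inner u v) => p q /=; ring.
Qed.

Lemma inner_scaleN u v : inner u (- v) = - inner u v.
Proof. by rewrite -scaleN1r innerZr rmorphN rmorph1 mulN1r. Qed.

Lemma parallelogram u v :
  sqnorm (u + v) + sqnorm (u - v) = 2 * sqnorm u + 2 * sqnorm v.
Proof.
rewrite !sqnormD sqnormN inner_scaleN; case: (inner u v) => p q /=; ring.
Qed.

Lemma sqnorm0 : sqnorm (0 : l2 R T) = 0.
Proof. by rewrite -(scale0r 0) sqnormZ normc0 expr0n mul0r. Qed.

Lemma sqnorm_delta (x : T) : sqnorm (delta x : l2 R T) = 1.
Proof.
rewrite (@sqnorm_finsupp _ _ [:: x])//; last first.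
  by move=> y; rewrite inE deltaE => /negbTE ->.
by rewrite big_seq1 deltaE eqxx normc1 expr1n.
Qed.

Lemma normc_le_sqnorm u x : normc (u x) ^+ 2 <= sqnorm u.
Proof.
by have := cauchy_schwarz u (delta x); rewrite inner_deltar sqnorm_delta mulr1.
Qed.

Lemma sqnorm_eq0 u : sqnorm u = 0 -> u = 0.
Proof.
move=> u0; apply/l2P => x; rewrite l20E; apply: eq0_normc.
have := normc_le_sqnorm u x; rewrite u0 => H.
by apply/eqP; rewrite -sqrf_eq0 eq_le H sqr_ge0.
Qed.

Lemma sqnorm_le_pointwise u v (C : R) :
  (forall x, normc (u x) ^+ 2 <= C * normc (v x) ^+ 2) ->
  sqnorm u <= C * sqnorm v.
Proof.
move=> H; rewrite !sqnormE -rsumZ; last exact: sqnorm_summable.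
by apply: ler_rsum => //; [exact: sqnorm_summable|apply: rsummableZ; exact: sqnorm_summable].
Qed.

Lemma sqnorm_le_sums u (C : R) :
  (forall s : seq T, uniq s -> \sum_(x <- s) normc (u x) ^+ 2 <= C) -> sqnorm u <= C.
Proof.
move=> H; have := sqsum_le H; rewrite -lee_fin {1}/sqnorm fineK//.
rewrite ge0_fin_numE; first exact: l2_funP.
by apply: esum_ge0 => x _; rewrite lee_fin sqr_ge0.
Qed.

Lemma sums_le_sqnorm u (s : seq T) : uniq s -> \sum_(x <- s) normc (u x) ^+ 2 <= sqnorm u.
Proof.
move=> us.
pose r := \sum_(x <- s) u x *: delta x.
have rE y : r y = if y \in s then u y else 0 by exact: sum_deltaE.
have -> : \sum_(x <- s) normc (u x) ^+ 2 = sqnorm r.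
  rewrite (@sqnorm_finsupp _ _ s)//; last by move=> x xs; rewrite rE (negbTE xs).
  by rewrite !big_seq; apply: eq_bigr => x xs; rewrite rE xs.
rewrite -[leRHS]mul1r; apply: sqnorm_le_pointwise => x; rewrite mul1r rE.
by case: ifP; rewrite ?normc0 ?expr0n ?sqr_ge0.
Qed.

Let opnorm_has_sup a :
  has_sup [set l2norm (a v) | v in [set v : l2 R T | l2norm v <= 1]].
Proof.
have [M aM] := bop_bounded a; split.
  by exists (l2norm (a 0)); exists 0 => //=; rewrite /l2norm -/(sqnorm _) sqnorm0 sqrtr0.
exists `|M| => _ [u /= u1 <-]; apply: le_trans (aM u) _.
apply: le_trans (ler_norm _) _; rewrite normrM -[leRHS]mulr1.
by rewrite ler_wpM2l// ger0_norm// l2norm_ge0.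
Qed.

Lemma opnorm_ge0 a : 0 <= opnorm a.
Proof.
apply: le_trans (sup_upper_bound (opnorm_has_sup a) _); last first.
  by exists 0 => //=; rewrite /l2norm -/(sqnorm _) sqnorm0 sqrtr0.
exact: l2norm_ge0.
Qed.

Lemma opnorm_bound a v : sqnorm (a v) <= opnorm a ^+ 2 * sqnorm v.
Proof.
have [v0|v0] := eqVneq (sqnorm v) 0.
  by rewrite v0 (sqnorm_eq0 v0) linear0 sqnorm0 mulr0.
have vp : 0 < sqnorm v by rewrite lt_def v0 sqnorm_ge0.
have np : 0 < l2norm v by rewrite sqrtr_gt0.
pose w := Complex (l2norm v)^-1 0 *: v.
have nw : sqnorm w = 1.
  rewrite sqnormZ normc_real ?invr_ge0 ?l2norm_ge0// exprVn sqr_l2norm.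
  by rewrite mulVf.
have w1 : l2norm (a w) <= opnorm a.
  apply: (sup_upper_bound (opnorm_has_sup a)); exists w => //=.
  by rewrite /l2norm -/(sqnorm _) nw sqrtr1.
have : sqnorm (a w) <= opnorm a ^+ 2.
  by rewrite -sqr_l2norm ler_sqr ?nnegrE ?l2norm_ge0// (le_trans (l2norm_ge0 _) w1).
rewrite /w bopZr sqnormZ normc_real ?invr_ge0 ?l2norm_ge0// exprVn sqr_l2norm.
by rewrite mulrC ler_pdivrMr.
Qed.

Lemma opnorm_le a (e : R) : 0 <= e ->
  (forall v, sqnorm (a v) <= e ^+ 2 * sqnorm v) -> opnorm a <= e.
Proof.
move=> e0 H; apply: ge_sup.
  by exists (l2norm (a 0)); exists 0 => //=; rewrite /l2norm -/(sqnorm _) sqnorm0 sqrtr0.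
move=> _ [u /= u1 <-].
have n1 : sqnorm u <= 1.
  by rewrite -sqr_l2norm -(expr1n _ 2) ler_sqr ?nnegrE ?l2norm_ge0.
rewrite -ler_sqr ?nnegrE ?l2norm_ge0// sqr_l2norm (le_trans (H u))//.
by rewrite -[leRHS]mulr1 ler_wpM2l// sqr_ge0.
Qed.

Lemma sqnorm_chi_le A v : sqnorm (chi A v) <= sqnorm v.
Proof.
rewrite -[leRHS]mul1r; apply: sqnorm_le_pointwise => x; rewrite mul1r chiE.
by case: ifP; rewrite ?normc0 ?expr0n ?sqr_ge0.
Qed.

Lemma adjK a : adj (adj a) = a.
Proof. by apply/esym/adj_unique => u v; rewrite innerC -adjP -innerC. Qed.

Lemma adj_mul a b : adj (a * b) = adj b * adj a.
Proof. by apply/esym/adj_unique => u v; rewrite !bopME !adjP. Qed.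

Lemma adj_add a b : adj (a + b) = adj a + adj b.
Proof. by apply/esym/adj_unique => u v; rewrite !bopDE innerDl innerDr !adjP. Qed.

Lemma adj_scale (z : R[i]) a : adj (z *: a) = (z^*)%C *: adj a.
Proof. by apply/esym/adj_unique => u v; rewrite !bopZE innerZl innerZr conjcK adjP. Qed.

(** [sqnorm (adj a v)] is the inner product of [a (adj a v)] with [v]; one factor
    [sqnorm (adj a v)] cancels in the Cauchy-Schwarz inequality. *)
Lemma sqnorm_adj a (M : R) : (forall v, sqnorm (a v) <= M * sqnorm v) ->
  forall v, sqnorm (adj a v) <= M * sqnorm v.
Proof.
move=> H v.
have E : inner (a (adj a v)) v = Complex (sqnorm (adj a v)) 0 by rewrite adjP sqnorm_inner.
have := cauchy_schwarz (a (adj a v)) v; rewrite E normc_real ?sqnorm_ge0// => H1.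
have [z|z] := eqVneq (sqnorm (adj a v)) 0.
  rewrite z; have := H v; have := sqnorm_ge0 (a v); lra.
have p : 0 < sqnorm (adj a v) by rewrite lt_def z sqnorm_ge0.
rewrite -(ler_pM2l p) -expr2 (le_trans H1)//.
rewrite mulrCA mulrA ler_wpM2r ?sqnorm_ge0//; exact: H.
Qed.

End L2Geometry.

(** * Orthonormal bases and Parseval's theorem *)

Section Completeness.
Context {R : realType} {T : choiceType}.
Implicit Types (u v w : l2 R T).

Let real_cauchy_limit (f : nat -> R) :
  (forall e, 0 < e -> exists N, forall m n, (N <= m)%N -> (N <= n)%N -> (f m - f n) ^+ 2 <= e) ->
  exists l : R, f @ \oo --> l.
Proof.
move=> H; suff : cvgn f by move=> /cvg_ex.
apply/cauchy_cvgP; apply: cauchy_exP => e e0.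
have [N HN] := H ((e / 2) ^+ 2) (exprn_gt0 _ (divr_gt0 e0 (ltr0n _ 2))).
exists (f N); exists N => // n /= Nn.
rewrite /ball /=.
have := HN N n (leqnn _) Nn.
rewrite -[X in X <= _]real_normK ?num_real// ler_sqr ?nnegrE ?normr_ge0//; last by rewrite ltW// divr_gt0.
move=> h; lra.
Qed.

(** The coordinatewise limit is a limit in norm: the distance to it is tested on
    finite sets, where it is a limit of distances between terms of the sequence. *)
Lemma l2_complete (u_ : nat -> l2 R T) :
  (forall e, 0 < e -> exists N, forall m n, (N <= m)%N -> (N <= n)%N ->
     sqnorm (u_ m - u_ n) <= e) ->
  exists v, forall e, 0 < e -> exists N, forall n, (N <= n)%N -> sqnorm (u_ n - v) <= e.
Proof.
move=> H.
have pt x m n : normc (u_ m x - u_ n x) ^+ 2 <= sqnorm (u_ m - u_ n).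
  exact: (normc_le_sqnorm (u_ m - u_ n) x).
have limRe x : exists l : R, (fun n => complex.Re (u_ n x)) @ \oo --> l.
  apply: real_cauchy_limit => e /H[N HN]; exists N => m n Nm Nn.
  apply: le_trans (HN m n Nm Nn); apply: le_trans (pt x m n).
  rewrite sqr_normcE; case: (u_ m x) (u_ n x) => [a b] [c d] /=.
  by rewrite lerDl sqr_ge0.
have limIm x : exists l : R, (fun n => complex.Im (u_ n x)) @ \oo --> l.
  apply: real_cauchy_limit => e /H[N HN]; exists N => m n Nm Nn.
  apply: le_trans (HN m n Nm Nn); apply: le_trans (pt x m n).
  rewrite sqr_normcE; case: (u_ m x) (u_ n x) => [a b] [c d] /=.
  by rewrite lerDr sqr_ge0.
have {limRe} [p Hp] := choice limRe; have {limIm} [q Hq] := choice limIm.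
pose f x := Complex (p x) (q x).
have lim_sum (s : seq T) n :
    \sum_(x <- s) normc (u_ n x - u_ m x) ^+ 2 @[m --> \oo] -->
    \sum_(x <- s) normc (u_ n x - f x) ^+ 2.
  elim: s => [|x s IH].
    by under eq_fun do rewrite big_nil; rewrite big_nil; exact: cvg_cst.
  under eq_fun do rewrite big_cons.
  rewrite big_cons; apply: cvgD IH.
  have -> : (fun m => normc (u_ n x - u_ m x) ^+ 2) =
      (fun m => (complex.Re (u_ n x) - complex.Re (u_ m x)) * (complex.Re (u_ n x) - complex.Re (u_ m x))
              + (complex.Im (u_ n x) - complex.Im (u_ m x)) * (complex.Im (u_ n x) - complex.Im (u_ m x))).
    by apply/funext => m; rewrite sqr_normcE !expr2; case: (u_ n x) (u_ m x) => [? ?] [? ?].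
  have -> : normc (u_ n x - f x) ^+ 2 =
      (complex.Re (u_ n x) - p x) * (complex.Re (u_ n x) - p x)
    + (complex.Im (u_ n x) - q x) * (complex.Im (u_ n x) - q x).
    by rewrite sqr_normcE !expr2; case: (u_ n x) => ? ? /=.
  by apply: cvgD; apply: cvgM; apply: cvgB => //; exact: cvg_cst.
have key e : 0 < e -> exists N, forall n, (N <= n)%N -> forall s : seq T, uniq s ->
    \sum_(x <- s) normc (u_ n x - f x) ^+ 2 <= e.
  move=> /H[N HN]; exists N => n Nn s us.
  apply: (cvgr_to_le (lim_sum s n)).
  exists N => // m /= Nm; apply: le_trans (HN n m Nn Nm).
  exact: (sums_le_sqnorm (u_ n - u_ m) us).
have [N0 HN0] := key 1 ltr01.
have f2 : f \in l2_pred.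
  rewrite l2_predE (@le_lt_trans _ _ (2 * sqnorm (u_ N0) + 2)%:E) ?ltry//.
  apply: sqsum_le => s us.
  have S1 := sums_le_sqnorm (u_ N0) us; have S2 := HN0 N0 (leqnn _) s us.
  apply: (@le_trans _ _ (\sum_(x <- s) (2 * normc (u_ N0 x) ^+ 2 + 2 * normc (u_ N0 x - f x) ^+ 2))).
    by apply: ler_sum => x _; exact: normc_sqrB.
  by rewrite big_split -!mulr_sumr /=; lra.
exists (L2 f2) => e /key[N HN]; exists N => n Nn.
by apply: sqnorm_le_sums => s us; exact: HN.
Qed.

End Completeness.

Definition onb (R : realType) (T : choiceType) (xi : nat -> l2 R T) : Prop :=
  (forall i j, inner (xi i) (xi j) = (i == j)%:R) /\
  (forall u, (forall i, inner u (xi i) = 0) -> u = 0).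

Section OrthonormalBasis.
Context {R : realType} {T : choiceType} (xi : nat -> l2 R T).
Hypothesis xi_onb : onb xi.
Implicit Types (u v w : l2 R T).

Lemma sqnorm_onb i : sqnorm (xi i) = 1.
Proof. by have := sqnorm_inner (xi i); rewrite xi_onb.1 eqxx => -[]. Qed.

Definition partial_expansion (J : nat) u : l2 R T :=
  \sum_(i < J) inner u (xi i) *: xi i.

Lemma inner_onb_sum (J : nat) (c : nat -> R[i]) (j : nat) :
  inner (\sum_(i < J) c i *: xi i) (xi j) = if (j < J)%N then c j else 0.
Proof.
rewrite inner_suml; case: ltnP => [jJ|Jj].
  rewrite (bigD1 (Ordinal jJ))//= inner_scalel xi_onb.1 eqxx mulr1 big1 ?addr0// => i.
  rewrite -val_eqE/= => ij; by rewrite inner_scalel xi_onb.1 (negbTE ij) mulr0.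
rewrite big1// => i _; rewrite inner_scalel xi_onb.1 ltn_eqF ?mulr0//.
exact: leq_trans (ltn_ord i) Jj.
Qed.

Lemma sqnorm_onb_sum (J : nat) (c : nat -> R[i]) :
  sqnorm (\sum_(i < J) c i *: xi i) = \sum_(i < J) normc (c i) ^+ 2.
Proof.
have := sqnorm_inner (\sum_(i < J) c i *: xi i).
rewrite inner_sumZr (eq_bigr (fun i : 'I_J => Complex (normc (c i) ^+ 2) 0)).
  2: by move=> i _; rewrite inner_onb_sum ltn_ord mulrC mulcJ_eq.
suff -> : \sum_(i < J) Complex (normc (c i) ^+ 2) 0 = Complex (\sum_(i < J) normc (c i) ^+ 2) 0.
  by case.
by elim/big_ind2 : _ => // [x1 y1 x2 y2 -> ->]; rewrite complexDE addr0.
Qed.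

Lemma sqnorm_expansion J u :
  sqnorm (partial_expansion J u) = \sum_(i < J) normc (inner u (xi i)) ^+ 2.
Proof. exact: (sqnorm_onb_sum J (fun i => inner u (xi i))). Qed.

Lemma bessel_eq J u : sqnorm (u - partial_expansion J u) =
  sqnorm u - \sum_(i < J) normc (inner u (xi i)) ^+ 2.
Proof.
rewrite sqnormD sqnormN sqnorm_expansion inner_scaleN /partial_expansion inner_sumZr.
rewrite (eq_bigr (fun i : 'I_J => Complex (normc (inner u (xi i)) ^+ 2) 0)).
  2: by move=> i _; rewrite mulrC mulcJ_eq.
have -> : \sum_(i < J) Complex (normc (inner u (xi i)) ^+ 2) 0 =
    Complex (\sum_(i < J) normc (inner u (xi i)) ^+ 2) 0.
  by elim/big_ind2 : _ => // [x1 y1 x2 y2 -> ->]; rewrite complexDE addr0.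
rewrite complexNE /=; ring.
Qed.

Lemma bessel J u : \sum_(i < J) normc (inner u (xi i)) ^+ 2 <= sqnorm u.
Proof. by rewrite -subr_ge0 -bessel_eq sqnorm_ge0. Qed.

Lemma bessel_pointwise J x : \sum_(i < J) normc (xi i x) ^+ 2 <= 1.
Proof.
have := bessel J (delta x); rewrite sqnorm_delta; apply: le_trans.
by apply: ler_sum => i _; rewrite inner_deltal normcJ_eq.
Qed.

(** The expansions form a Cauchy sequence by Bessel's inequality, and the defect of
    their limit is orthogonal to the basis. *)
Lemma parseval u (e : R) : 0 < e -> exists J, forall J', (J <= J')%N ->
  sqnorm (u - partial_expansion J' u) <= e.
Proof.
move=> e0.
pose S J := \sum_(i < J) normc (inner u (xi i)) ^+ 2.
have Smono J J' : (J <= J')%N -> S J <= S J'.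
  move=> JJ; rewrite /S -!(big_mkord xpredT (fun i => normc (inner u (xi i)) ^+ 2)).
  by rewrite [leRHS](big_cat_nat (leq0n _) JJ)/= lerDl sumr_ge0// => i _; rewrite sqr_ge0.
have diff J J' : (J <= J')%N ->
    sqnorm (partial_expansion J' u - partial_expansion J u) = S J' - S J.
  move=> JJ.
  pose c i := if (i < J)%N then 0 else inner u (xi i).
  have -> : partial_expansion J' u - partial_expansion J u = \sum_(i < J') c i *: xi i.
    rewrite /partial_expansion.
    rewrite -!(big_mkord xpredT (fun i => inner u (xi i) *: xi i)) -(big_mkord xpredT (fun i => c i *: xi i)).
    rewrite !(big_cat_nat (leq0n _) JJ)/= addrAC subrr add0r [X in _ = X + _]big1_seq ?add0r; last first.
      by move=> i /andP[_]; rewrite mem_index_iota /c => /andP[_ ->]; rewrite scale0r.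
    by apply: eq_big_nat => i /andP[Ji _]; rewrite /c ltnNge Ji.
  rewrite (sqnorm_onb_sum J' c) /S.
  rewrite -!(big_mkord xpredT (fun i => normc (inner u (xi i)) ^+ 2)) -(big_mkord xpredT (fun i => normc (c i) ^+ 2)).
  rewrite !(big_cat_nat (leq0n _) JJ)/= addrAC subrr add0r [X in X + _ = _]big1_seq ?add0r; last first.
    by move=> i /andP[_]; rewrite mem_index_iota /c => /andP[_ ->]; rewrite normc0 expr0n.
  by apply: eq_big_nat => i /andP[Ji _]; rewrite /c ltnNge Ji.
have Sbd J : S J <= sqnorm u by exact: bessel.
have supS : has_sup [set S J | J in [set: nat]].
  by split; [exists (S 0); exists 0|exists (sqnorm u) => _ [J _ <-]].
have cau d : 0 < d -> exists N, forall m n, (N <= m)%N -> (N <= n)%N ->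
    sqnorm (partial_expansion m u - partial_expansion n u) <= d.
  move=> d0; have [_ [N _ <-] HN] := sup_adherent d0 supS.
  have Sle J : S J <= sup [set S J | J in [set: nat]].
    by apply: sup_upper_bound => //; exists J.
  exists N => m n; wlog mn : m n / (n <= m)%N.
    move=> W Nm Nn; have [|/ltnW nm] := leqP n m; first by move=> h; exact: W.
    by rewrite -sqnormN opprB; exact: W.
  move=> Nm Nn; rewrite diff//.
  have := Smono _ _ Nn; have := Sle m; lra.
have [v Hv] := l2_complete cau.
suff uv : u - v = 0.
  have [J HJ] := Hv e e0; exists J => J' JJ.
  by have := HJ J' JJ; rewrite -(subr0_eq uv) -sqnormN opprB.
apply: xi_onb.2 => j; apply: eq0_normc; apply/eqP; rewrite -sqrf_eq0 eq_le sqr_ge0 andbT.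
apply/ler_addgt0Pr => d d0; rewrite add0r.
have [J HJ] := Hv d d0; pose J' := maxn J j.+1.
have E : inner (u - v) (xi j) = inner (partial_expansion J' u - v) (xi j).
  rewrite !innerDl; congr (_ + _); rewrite /partial_expansion.
  by rewrite (inner_onb_sum J' (fun i => inner u (xi i))) leq_maxr.
rewrite E; apply: le_trans (cauchy_schwarz _ _) _.
by rewrite sqnorm_onb mulr1; apply: HJ; rewrite leq_maxl.
Qed.

End OrthonormalBasis.

(** * Rank-one operators and quasi-locality *)

Section RankOne.
Context {R : realType} {T : choiceType}.
Implicit Types (u v w : l2 R T) (a b : bop R T).

Fact outer_linear v w : linear (fun u : l2 R T => inner u w *: v).
Proof. by move=> c x y; rewrite innerDl innerZl scalerDl scalerA. Qed.

Lemma sqnorm_outer v w u : sqnorm (inner u w *: v) <= sqnorm w * sqnorm v * sqnorm u.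
Proof.
rewrite sqnormZ [leRHS]mulrAC ler_wpM2r ?sqnorm_ge0// mulrC; exact: cauchy_schwarz.
Qed.

Fact outer_bounded v w : bounded_op (fun u : l2 R T => inner u w *: v).
Proof.
apply/bounded_sqnormP; exists (sqnorm w * sqnorm v + 1) => [|u].
  by rewrite ltr_wpDl// mulr_ge0 ?sqnorm_ge0.
apply: le_trans (sqnorm_outer v w u) _.
by rewrite ler_wpM2r ?sqnorm_ge0// lerDl.
Qed.

Definition outer v w : bop R T := Bop (outer_linear v w) (outer_bounded v w).

Lemma outerE v w u : outer v w u = inner u w *: v. Proof. by []. Qed.

Lemma adj_outer v w : adj (outer v w) = outer w v.
Proof.
apply/esym/adj_unique => x y; rewrite !outerE innerZl innerZr -innerC.
by rewrite mulrC.
Qed.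

Lemma mul_outerr a v w : a * outer v w = outer (a v) w.
Proof. by apply/bopP => u; rewrite bopME !outerE bopZr. Qed.

Lemma mul_outerl a v w : outer v w * a = outer v (adj a w).
Proof. by apply/bopP => u; rewrite bopME !outerE adjP. Qed.

Lemma outerZl (c : R[i]) v w : outer (c *: v) w = c *: outer v w.
Proof. by apply/bopP => u; rewrite bopZE !outerE !scalerA mulrC. Qed.

Lemma outerZr (c : R[i]) v w : outer v (c *: w) = (c^*)%C *: outer v w.
Proof. by apply/bopP => u; rewrite bopZE !outerE inner_scaler scalerA. Qed.

Lemma inner_chi (A : set T) u v : inner (chi A u) v = inner u (chi A v).
Proof.
rewrite /inner /csum; congr Complex; congr rsum; apply/funext => x;
  by rewrite !chiE; case: ifP; rewrite ?conjc0 ?mulr0 ?mul0r.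
Qed.

End RankOne.

Section QuasiLocal.
Context {R : realType} {X : metricType R}.
Implicit Types (A B : set X) (a b : bop R X) (u v w : l2 R X).

Lemma lt_setdist A B (r : R) x y : (r%:E < setdist A B)%E -> A x -> B y ->
  r < mdist x y.
Proof.
move=> rAB Ax By; rewrite -lte_fin; apply: lt_le_trans rAB _.
by apply: ereal_inf_lbound; exists x => //; exists y.
Qed.

Lemma setdist_ge A B (r : R) : (forall x y, A x -> B y -> r <= mdist x y) ->
  (r%:E <= setdist A B)%E.
Proof.
by move=> H; apply: le_ereal_inf_tmp => _ [x Ax [y By <-]]; rewrite lee_fin; exact: H.
Qed.

Lemma quasi_localP a : quasi_local a <-> forall e, 0 < e -> exists2 r : R, 0 < r &
  forall A B, (r%:E < setdist A B)%E ->
    forall u, sqnorm (chi A (a (chi B u))) <= e * sqnorm u.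
Proof.
split => H e e0.
  have s0 : 0 < Num.sqrt e by rewrite sqrtr_gt0.
  have [r r0 Hr] := H _ s0; exists r => // A B AB u.
  apply: le_trans (opnorm_bound (chi A * a * chi B) u) _.
  rewrite ler_wpM2r ?sqnorm_ge0// -[leRHS](sqr_sqrtr (ltW e0)).
  by rewrite ler_sqr ?nnegrE ?opnorm_ge0 ?(ltW s0)//; exact: Hr.
have [r r0 Hr] := H (e ^+ 2) (exprn_gt0 _ e0); exists r => // A B AB.
by apply: opnorm_le (ltW e0) _ => u; exact: Hr.
Qed.

Lemma quasi_localD a b : quasi_local a -> quasi_local b -> quasi_local (a + b).
Proof.
move=> /quasi_localP Ha /quasi_localP Hb; apply/quasi_localP => e e0.
have e4 : 0 < e / 4 by rewrite divr_gt0.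
have [r r0 Hr] := Ha _ e4; have [s s0 Hs] := Hb _ e4.
exists (r + s) => [|A B AB u]; first exact: addr_gt0.
have H1 : sqnorm (chi A (a (chi B u))) <= e / 4 * sqnorm u.
  by apply: Hr; apply: le_lt_trans AB; rewrite lee_fin lerDl ltW.
have H2 : sqnorm (chi A (b (chi B u))) <= e / 4 * sqnorm u.
  by apply: Hs; apply: le_lt_trans AB; rewrite lee_fin lerDr ltW.
rewrite bopDE raddfD; apply: le_trans (sqnormD_le _ _) _; lra.
Qed.

Lemma quasi_localZ (c : R[i]) a : quasi_local a -> quasi_local (c *: a).
Proof.
move=> /quasi_localP Ha; apply/quasi_localP => e e0.
have c1 : 0 < normc c ^+ 2 + 1 by rewrite ltr_wpDl ?sqr_ge0.
have [r r0 Hr] := Ha _ (divr_gt0 e0 c1); exists r => // A B AB u.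
rewrite bopZE bopZr sqnormZ; have H := Hr _ _ AB u.
have : normc c ^+ 2 * sqnorm (chi A (a (chi B u))) <=
    (normc c ^+ 2 + 1) * (e / (normc c ^+ 2 + 1) * sqnorm u).
  by rewrite ler_pM ?sqr_ge0 ?sqnorm_ge0// lerDl.
by rewrite mulrA [_ * (e / _)]mulrC divfK// gt_eqF.
Qed.

(** A rank-one operator is quasi-local because both vectors are concentrated on
    a finite set, and two sets further apart than its diameter cannot both meet it. *)
Lemma quasi_local_outer v w : quasi_local (outer v w).
Proof.
apply/quasi_localP => e e0.
have K0 : 0 < sqnorm v + sqnorm w + 1 by rewrite ltr_wpDl ?addr_ge0 ?sqnorm_ge0.
pose d := e / (sqnorm v + sqnorm w + 1).
have d0 : 0 < d by exact: divr_gt0.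
have [s [us Hs]] := sqsum_adherent v d0; have [t [ut Ht]] := sqsum_adherent w d0.
pose r := \sum_(x <- s) \sum_(y <- t) mdist x y.
have rP x y : x \in s -> y \in t -> mdist x y <= r.
  move=> xs yt; rewrite /r (bigD1_seq x)//= (bigD1_seq y)//= -addrA lerDl.
  by rewrite addr_ge0// sumr_ge0// => *; rewrite ?mdist_ge0// sumr_ge0// => *; rewrite mdist_ge0.
exists (r + 1).
  by rewrite ltr_wpDl// sumr_ge0// => *; rewrite sumr_ge0// => *; rewrite mdist_ge0.
have tail (C : set X) (z : l2 R X) (q : seq X) : uniq q ->
    sqnorm (z - \sum_(x <- q) z x *: delta x) <= d ->
    (forall x, x \in q -> ~ C x) -> sqnorm (chi C z) <= d.
  move=> uq Hq qC; apply: le_trans Hq; rewrite -[leRHS]mul1r; apply: sqnorm_le_pointwise => x.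
  rewrite mul1r chiE l2DE l2NE sum_deltaE//; case: ifP => [|_]; last by rewrite normc0 expr0n sqr_ge0.
  by rewrite inE => Cx; case: ifP => [/qC//|_]; rewrite subr0.
move=> A B AB u.
have E : sqnorm (chi A (outer v w (chi B u))) <= sqnorm (chi B w) * sqnorm (chi A v) * sqnorm u.
  by rewrite outerE bopZr inner_chi; exact: sqnorm_outer.
apply: le_trans E _; rewrite ler_wpM2r ?sqnorm_ge0//.
have : sqnorm (chi A v) <= d \/ sqnorm (chi B w) <= d.
  have [[x xs Ax]|nA] := pselect (exists2 x, x \in s & A x); last first.
    by left; apply: (tail _ _ s) => // x xs Ax; apply: nA; exists x.
  right; apply: (tail _ _ t) => // y yt By.
  have := lt_setdist AB Ax By; have := rP _ _ xs yt; lra.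
have := sqnorm_chi_le A v; have := sqnorm_chi_le B w.
have := sqnorm_ge0 (chi A v); have := sqnorm_ge0 (chi B w).
have -> : e = d * (sqnorm v + sqnorm w + 1) by rewrite /d divfK// gt_eqF.
move=> B0 A0 Bw Av [] H.
  rewrite mulrC ler_pM//; lra.
rewrite ler_pM//; lra.
Qed.

End QuasiLocal.

(** * The orthonormal basis given by a Cartan subalgebra *)

Section Atoms.
Context {R : realType} {X : metricType R}.
Local Notation C := (@quasi_local R X).
Context (B : set (bop R X)) (phi : (nat -> R[i]) -> bop R X).
Hypothesis cartanB : cartan_subalgebra C B.
Hypothesis isoB : star_isomorphism_from_linf B phi.
Implicit Types (u v w : l2 R X) (f g : nat -> R[i]).

Let ind (n : nat) : nat -> R[i] := fun m => (m == n)%:R.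

Let linf_ind n : linf (ind n).
Proof.
by exists 1 => m; rewrite /ind; case: (m == n); rewrite ?normc1 ?normc0.
Qed.

Let linfM f g : linf f -> linf g -> linf (f * g).
Proof.
move=> [M HM] [N HN]; exists (M * N) => n.
by rewrite [(f * g) n]/(f n * g n) normcM ler_pM ?normc_ge0.
Qed.

Let phi_in f : linf f -> B (phi f).
Proof. by move=> lf; have [h _ _] := iso_bij isoB; exact: h. Qed.

Let phi_surj b : B b -> exists2 f, linf f & b = phi f.
Proof. by move=> Bb; have [_ _ h] := iso_bij isoB; have [f lf <-] := h b Bb; exists f. Qed.

Let phi0 : phi 0 = 0.
Proof.
have l0 : linf (0 : nat -> R[i]) by exists 0 => n; rewrite normc0.
by rewrite -(scale0r (0 : nat -> R[i])) (isoZ isoB)// scale0r.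
Qed.

Let p n := phi (ind n).

Let mul_atom f n : linf f -> phi f * p n = f n *: p n.
Proof.
move=> lf; rewrite /p -(isoM isoB)// -(isoZ isoB)//; congr phi; apply/funext => m.
have E : f m * ind n m = f n * ind n m.
  by rewrite /ind; have [->//|_] := eqVneq m n; rewrite !mulr0.
exact: E.
Qed.

Let atom_mul n m : p n * p m = if n == m then p n else 0.
Proof.
rewrite {1}/p mul_atom// {1}/ind (eq_sym n m).
by case: eqVneq => [->|_] /=; rewrite ?mulr1n ?mulr0n ?scale1r ?scale0r.
Qed.

Let adj_atom n : adj (p n) = p n.
Proof.
rewrite /p -(isoJ isoB)//; congr phi; apply/funext => m; rewrite /ind.
by case: (m == n); rewrite ?conjc0 ?conjc1.
Qed.

Let atom_neq0 n : p n <> 0.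
Proof.
move=> pn0; have [_ h _] := iso_bij isoB.
have l0 : linf (0 : nat -> R[i]) by exists 0 => m; rewrite normc0.
have : ind n = 0 by apply: h; rewrite ?inE//= phi0.
move=> /(congr1 (fun f => f n)); rewrite /ind eqxx => /eqP.
by rewrite [X in _ == X](_ : _ = 0)// oner_eq0.
Qed.

Let subB : B `<=` C. Proof. exact: cartan_sub cartanB. Qed.
Let starB : star_subalgebra B. Proof. exact: (cartan_cstar cartanB).1. Qed.
Let comB b c : B b -> B c -> b * c = c * b.
Proof. by move=> Bb Bc; exact: (cartan_masa cartanB).1. Qed.

(** A rank-one projection onto a vector fixed by an atom [p n] commutes with
    [B]; maximality puts it in [B], below [p n], so it is proportional to [p n]. *)
Let outer_atom_in n v : p n v = v -> B (outer v v).
Proof.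
move=> pv; have [q qE] : exists q, q = outer v v by exists (outer v v).
rewrite -qE.
have qq : q * q = Complex (sqnorm v) 0 *: q.
  by rewrite qE mul_outerr outerE sqnorm_inner outerZl.
have bv b : B b -> exists c : R[i], b v = c *: v.
  move=> /phi_surj[f lf ->]; exists (f n).
  by rewrite -[in LHS]pv -bopME mul_atom// bopZE pv.
have adjB b : B b -> B (adj b) by exact: star_subJ starB b.
have bq b : B b -> exists c : R[i], b * q = c *: q /\ q * b = c *: q.
  move=> Bb; have [c bc] := bv b Bb; exists c; split.
    by rewrite qE mul_outerr bc outerZl.
  have [d bd] := bv _ (adjB _ Bb).
  have [v0|v0] := eqVneq (sqnorm v) 0.
    have -> : q = 0.
      by apply/bopP => u; rewrite qE (sqnorm_eq0 v0) outerE scaler0.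
    by rewrite mul0r scaler0.
  rewrite qE mul_outerl bd outerZr; congr (_ *: _).
  have := adjP b v v; rewrite bc bd inner_scalel inner_scaler sqnorm_inner.
  have z : Complex (sqnorm v) 0 != 0.
    by apply: contra v0 => /eqP[->].
  by move=> /(mulIf z).
pose D : set (bop R X) := [set a | exists b (z : R[i]), B b /\ a = b + z *: q].
have adjq : adj q = q by rewrite qE adj_outer.
have sD : star_subalgebra D.
  split.
  - by exists 0, 0; split; [exact: star_sub0 starB|rewrite scale0r addr0].
  - move=> _ _ [b [z [Bb ->]]] [c [y [Bc ->]]]; exists (b + c), (z + y); split.
      exact: star_subD starB b c Bb Bc.
    by rewrite scalerDl addrACA.
  - move=> y _ [b [z [Bb ->]]]; exists (y *: b), (y * z); split.
      exact: star_subZ starB y b Bb.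
    by rewrite scalerDr scalerA.
  - move=> _ _ [b [z [Bb ->]]] [c [y [Bc ->]]].
    have [k [bk _]] := bq b Bb; have [l [_ cl]] := bq c Bc.
    exists (b * c), (y * k + z * l + z * y * Complex (sqnorm v) 0); split.
      exact: star_subM starB b c Bb Bc.
    apply/bopP => u.
    have bk' w : b (q w) = k *: q w by have := congr1 (fun a : bop R X => a w) bk.
    have cl' w : q (c w) = l *: q w by have := congr1 (fun a : bop R X => a w) cl.
    have qq' w : q (q w) = Complex (sqnorm v) 0 *: q w.
      by have := congr1 (fun a : bop R X => a w) qq.
    rewrite bopME !bopDE !bopZE bopME !bopDr !bopZr cl' bk' qq' !scalerDl !scalerDr !scalerA !addrA.
    by rewrite mulrA.
  - move=> _ [b [z [Bb ->]]]; exists (adj b), (z^*)%C; split; first exact: adjB.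
    by rewrite adj_add (adj_scale z q) adjq.
have aD : abelian_set D.
  move=> _ _ [b [z [Bb ->]]] [c [y [Bc ->]]].
  have [k [bk kb]] := bq b Bb; have [l [lc cl]] := bq c Bc.
  apply/bopP => u; rewrite !bopME !bopDE !bopZE !bopDr !bopZr.
  have E1 w : b (q w) = k *: q w by have := congr1 (fun a : bop R X => a w) bk.
  have E2 w : q (b w) = k *: q w by have := congr1 (fun a : bop R X => a w) kb.
  have E3 w : c (q w) = l *: q w by have := congr1 (fun a : bop R X => a w) lc.
  have E4 w : q (c w) = l *: q w by have := congr1 (fun a : bop R X => a w) cl.
  have E5 : b (c u) = c (b u) by have := congr1 (fun a : bop R X => a u) (comB Bb Bc).
  rewrite E1 E2 E3 E4 E5 !scalerDr !scalerA -!addrA; congr (_ + _).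
  by rewrite !addrA [y * z]mulrC [X in X + _ = _]addrC.
have DC : D `<=` C.
  move=> _ [b [z [Bb ->]]]; apply: quasi_localD; first exact: subB.
  by apply: quasi_localZ; rewrite qE; exact: quasi_local_outer.
have BD : B `<=` D by move=> b Bb; exists b, 0; rewrite scale0r addr0.
rewrite -((cartan_masa cartanB).2 D sD aD DC BD).
exists 0, 1; split; first exact: star_sub0 starB.
by rewrite scale1r add0r.
Qed.

Let atom_rank1 n : exists v, sqnorm v = 1 /\ forall u, p n u = inner u v *: v.
Proof.
have [u0 pu0] : exists u, p n u <> 0.
  apply: contrapT => H; apply: (atom_neq0 (n := n)); apply/bopP => u.
  by rewrite bop0E; apply: contrapT => ?; apply: H; exists u.
pose v := p n u0.
have pv : p n v = v by rewrite /v -bopME atom_mul eqxx.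
have [g lg qg] := phi_surj (outer_atom_in pv).
have E u : inner u v *: v = g n *: p n u.
  have : outer v v * p n = g n *: p n by rewrite qg mul_atom.
  by rewrite mul_outerl adj_atom pv => /(congr1 (fun a : bop R X => a u)).
have v0 : 0 < sqnorm v.
  by rewrite lt_def sqnorm_ge0 andbT; apply/eqP => /sqnorm_eq0.
have gn : g n = Complex (sqnorm v) 0.
  have := E v; rewrite pv sqnorm_inner => /esym H.
  have : inner (g n *: v) v = inner (Complex (sqnorm v) 0 *: v) v by rewrite H.
  have z : Complex (sqnorm v) 0 != 0.
    by apply/eqP => -[] /eqP; rewrite gt_eqF.
  by rewrite !inner_scalel sqnorm_inner => /(mulIf z).
pose c := Complex (l2norm v)^-1 0.
have ln0 : 0 < l2norm v by rewrite sqrtr_gt0.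
have cc : c * (c^*)%C * Complex (sqnorm v) 0 = 1.
  rewrite mulcJ_eq normc_real ?invr_ge0 ?ltW// exprVn sqr_l2norm complexME.
  by rewrite !mul0r subr0 mulr0 addr0 mulVf// gt_eqF.
exists (c *: v); split.
  rewrite sqnormZ normc_real ?invr_ge0 ?ltW// exprVn sqr_l2norm mulVf// gt_eqF//.
move=> u; rewrite -[LHS]scale1r -cc -scalerA -gn -E inner_scaler !scalerA.
have swap (x y z : R[i]) : x * y * z = y * z * x by rewrite -mulrA mulrC.
by congr (_ *: _); exact: swap.
Qed.

Let atoms : exists xi : nat -> l2 R X, (forall n, sqnorm (xi n) = 1) /\
  forall n u, p n u = inner u (xi n) *: xi n.
Proof.
have [xi Hxi] := choice atom_rank1.
by exists xi; split => [n|n u]; have [] := Hxi n.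
Qed.

(** For completeness: if [u] is orthogonal to all the vectors of the atoms, then
    the positive operator [outer u u] is compressed to [0] by every atom, hence is
    in the kernel of the conditional expectation, which is faithful. *)
Lemma cartan_linf_basis : exists xi : nat -> l2 R X, onb xi /\
  (forall f, linf f -> forall n, phi f (xi n) = f n *: xi n).
Proof.
have [xi [xi1 pE]] := atoms; exists xi.
have pxi n : p n (xi n) = xi n by rewrite pE sqnorm_inner xi1 scale1r.
have diag f : linf f -> forall n, phi f (xi n) = f n *: xi n.
  by move=> lf n; rewrite -[in LHS]pxi -bopME mul_atom// bopZE pxi.
have orth i j : inner (xi i) (xi j) = (i == j)%:R.
  have [->|ij] := eqVneq i j; first by rewrite sqnorm_inner xi1.
  have : p j (xi i) = 0.
    by rewrite -(pxi i) -bopME atom_mul eq_sym (negbTE ij) bop0E.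
  rewrite pE => /(congr1 (fun v => inner v (xi j))).
  by rewrite inner_scalel inner0l sqnorm_inner xi1 mulr1.
split => //; split => // u uxi.
have [E [EB _ EZ _ _ _ Emod] faith] := cartan_cexp cartanB.
have up n : p n * outer u u = 0.
  rewrite mul_outerr pE uxi scale0r.
  by apply/bopP => w; rewrite outerE scaler0 bop0E.
have Cu : C (outer u u) by exact: quasi_local_outer.
have C0 : C 0 by apply: subB; exact: star_sub0 starB.
have E0 : E 0 = 0 by have := EZ 0 0 C0; rewrite !scale0r.
have Eu : E (outer u u) = 0.
  have [g lg Eg] := phi_surj (EB _ Cu); rewrite Eg.
  suff -> : g = 0 by exact: phi0.
  apply/funext => n.
  have pB : B (p n) by exact: phi_in.
  have := Emod (p n) (outer u u) (p n) pB Cu pB.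
  rewrite up mul0r E0 Eg /p -(isoM isoB)// -/(p n) mul_atom; last exact: linfM.
  move=> /(congr1 (fun a : bop R X => inner (a (xi n)) (xi n))).
  rewrite bop0E inner0l bopZE pxi inner_scalel sqnorm_inner xi1.
  have e : ind n n * g n * 1 = g n by rewrite /ind eqxx mul1r mulr1.
  by move=> H; rewrite -e; exact: esym H.
have [u0|u0] := eqVneq (sqnorm u) 0; first exact: sqnorm_eq0.
have z : Complex (sqnorm u) 0 != 0 by apply: contra u0 => /eqP[->].
have uu : adj (outer u u) * outer u u = Complex (sqnorm u) 0 *: outer u u.
  by rewrite adj_outer mul_outerr outerE sqnorm_inner outerZl.
have : outer u u = 0.
  by apply: faith => //; rewrite uu EZ// Eu scaler0.
move=> /(congr1 (fun a : bop R X => inner (a u) u)).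
rewrite bop0E inner0l outerE inner_scalel sqnorm_inner => /eqP.
by rewrite mulf_eq0 orbb (negbTE z).
Qed.

End Atoms.

(** * Sparse matrices and normalizers *)

Section Sparse.
Context {R : realType} {T : choiceType} (xi : nat -> l2 R T).
Hypothesis xi_onb : onb xi.
Implicit Types (u v w : l2 R T) (a b : bop R T).

Definition supported (s : seq nat) v := forall i, i \notin s -> inner v (xi i) = 0.

(** Columns and rows of the matrix of [a] in the basis; the rows are seen through
    the adjoint, which makes the notion self-adjoint by construction. *)
Definition sparse (K : nat) a := forall j,
  (exists2 s, (size s <= K)%N & supported s (a (xi j))) /\
  (exists2 s, (size s <= K)%N & supported s (adj a (xi j))).

Definition sparse_limit a := forall e, 0 < e -> exists K, exists2 b, sparse K b &
  forall v, sqnorm (a v - b v) <= e * sqnorm v.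

(** Completeness of the basis: the difference of the two sides is orthogonal to
    every basis vector. *)
Lemma supported_sum s v : supported s v ->
  v = \sum_(i <- undup s) inner v (xi i) *: xi i.
Proof.
move=> sv; apply/eqP; rewrite -subr_eq0; apply/eqP; apply: xi_onb.2 => j.
rewrite innerDl -scaleN1r inner_scalel inner_sumZl.
have [js|js] := boolP (j \in s).
  rewrite (bigD1_seq j) ?mem_undup ?undup_uniq//= xi_onb.1 eqxx mulr1 big1 ?addr0 ?mulN1r ?subrr//.
  by move=> i ij; rewrite xi_onb.1 (negbTE ij) mulr0.
rewrite (sv _ js) add0r big_seq big1 ?mulr0// => i; rewrite mem_undup => is_.
rewrite xi_onb.1; case: eqVneq => [ij|_]; last by rewrite mulr0.
by move: js; rewrite -ij is_.
Qed.

Lemma supportedD s t u v : supported s u -> supported t v -> supported (s ++ t) (u + v).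
Proof.
move=> su tv i; rewrite mem_cat negb_or => /andP[/su hs /tv ht].
by rewrite innerDl hs ht addr0.
Qed.

Lemma supportedZ s (c : R[i]) u : supported s u -> supported s (c *: u).
Proof. by move=> su i /su h; rewrite inner_scalel h mulr0. Qed.

Lemma supported_comp a (K : nat) s v : supported s v ->
  (forall j, exists2 t, (size t <= K)%N & supported t (a (xi j))) ->
  exists2 t, (size t <= K * size s)%N & supported t (a v).
Proof.
move=> sv H.
have /choice[t Ht] j : exists t, (size t <= K)%N /\ supported t (a (xi j)).
  by have [t tK tS] := H j; exists t.
exists (flatten [seq t j | j <- undup s]).
  apply: (@leq_trans (K * size (undup s))); last by rewrite leq_mul2l size_undup orbT.
  elim: (undup s) => //= j l IH; by rewrite size_cat mulnS leq_add// (Ht _).1.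
rewrite (supported_sum sv) => i it; rewrite bop_sumr inner_suml big_seq big1// => j js.
rewrite bopZr inner_scalel (Ht j).2 ?mulr0//.
by apply: contra it => h; apply/flatten_mapP; exists j.
Qed.

Lemma sparse0 K : sparse K 0.
Proof.
have ad0 : adj (0 : bop R T) = 0.
  by apply/esym/adj_unique => u v; rewrite !bop0E inner0l innerC inner0l conjc0.
by move=> j; rewrite ad0; split; exists [::] => // i _; rewrite bop0E inner0l.
Qed.

Lemma sparseD K L a b : sparse K a -> sparse L b -> sparse (K + L) (a + b).
Proof.
move=> sa sb j; have [[s1 ? ?] [s2 ? ?]] := sa j; have [[t1 ? ?] [t2 ? ?]] := sb j.
split; first by exists (s1 ++ t1); [rewrite size_cat leq_add|exact: supportedD].
by exists (s2 ++ t2); [rewrite size_cat leq_add|rewrite adj_add; exact: supportedD].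
Qed.

Lemma sparseZ K (c : R[i]) a : sparse K a -> sparse K (c *: a).
Proof.
move=> sa j; have [[s1 ? ?] [s2 ? ?]] := sa j; rewrite adj_scale.
by split; [exists s1|exists s2] => //; rewrite bopZE; exact: supportedZ.
Qed.

Lemma sparseM K L a b : sparse K a -> sparse L b -> sparse (K * L) (a * b).
Proof.
move=> sa sb j; have [[s sL sS] _] := sb j; have [_ [t tK tS]] := sa j.
rewrite adj_mul !bopME; split.
  have [r rs rS] := supported_comp sS (fun j => (sa j).1).
  by exists r => //; apply: leq_trans rs _; rewrite leq_mul2l sL orbT.
have [r rs rS] := supported_comp tS (fun j => (sb j).2).
by exists r => //; apply: leq_trans rs _; rewrite mulnC leq_mul2r tK orbT.
Qed.

Lemma sparseJ K a : sparse K a -> sparse K (adj a).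
Proof. by move=> sa j; have [h1 h2] := sa j; rewrite adjK. Qed.

Lemma bop_sqbound a : exists2 M : R, 0 < M & forall v, sqnorm (a v) <= M * sqnorm v.
Proof. by have /bounded_sqnormP := bop_bounded a. Qed.

Lemma sparse_limit_sparse K a : sparse K a -> sparse_limit a.
Proof.
move=> sa e e0; exists K, a => // v.
by rewrite subrr sqnorm0 mulr_ge0 ?sqnorm_ge0// ltW.
Qed.

(** In a product the norm of the first sparse approximant enters the error; it is
    under control if that approximant is within distance 1. *)
Lemma sparse_limit_cstar : cstar_subalgebra sparse_limit.
Proof.
split; first split.
- exact: sparse_limit_sparse (sparse0 0).
- move=> a b Ha Hb e e0; have e4 : 0 < e / 4 by rewrite divr_gt0.
  have [K [a' sa Ea]] := Ha _ e4; have [L [b' sb Eb]] := Hb _ e4.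
  exists (K + L)%N, (a' + b'); first exact: sparseD.
  move=> v; rewrite !bopDE opprD addrACA; apply: le_trans (sqnormD_le _ _) _.
  have := Ea v; have := Eb v; lra.
- move=> c a Ha e e0; have c1 : 0 < normc c ^+ 2 + 1 by rewrite ltr_wpDl ?sqr_ge0.
  have [K [a' sa Ea]] := Ha _ (divr_gt0 e0 c1).
  exists K, (c *: a'); first exact: sparseZ.
  move=> v; rewrite !bopZE -scalerBr sqnormZ.
  apply: (@le_trans _ _ ((normc c ^+ 2 + 1) * (e / (normc c ^+ 2 + 1) * sqnorm v))).
    by rewrite ler_pM ?sqr_ge0 ?sqnorm_ge0// lerDl.
  by rewrite mulrA [_ * (e / _)]mulrC divfK// gt_eqF.
- move=> a b Ha Hb e e0.
  have [M M0 aM] := bop_sqbound a; have [N N0 bN] := bop_sqbound b.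
  have M1 : 0 < 4 * (2 * M + 2) by lra.
  have [L [b' sb Eb]] := Hb _ (divr_gt0 e0 M1).
  have N1 : 0 < 4 * N by lra.
  have d0 : 0 < Num.min 1 (e / (4 * N)) by rewrite lt_min ltr01 divr_gt0.
  have [K [a' sa Ea]] := Ha _ d0.
  exists (K * L)%N, (a' * b'); first exact: sparseM.
  move=> v; rewrite !bopME.
  have -> : a (b v) - a' (b' v) = (a (b v) - a' (b v)) + a' (b v - b' v).
    by rewrite bopDr bopNr addrA subrK.
  apply: le_trans (sqnormD_le _ _) _.
  have H1 : sqnorm (a (b v) - a' (b v)) <= e / 4 * sqnorm v.
    apply: le_trans (Ea _) _.
    apply: (@le_trans _ _ (e / (4 * N) * (N * sqnorm v))).
      apply: ler_pM; rewrite ?sqnorm_ge0 ?(ltW d0)// ge_min lexx orbT//.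
    by rewrite mulrA invfM mulrA divfK ?gt_eqF.
  have a'b w : sqnorm (a' w) <= (2 * M + 2) * sqnorm w.
    have -> : a' w = a w - (a w - a' w) by rewrite opprB addrC subrK.
    apply: le_trans (sqnormD_le _ _) _; rewrite sqnormN.
    have h : sqnorm (a w - a' w) <= 1 * sqnorm w.
      by apply: le_trans (Ea w) _; rewrite ler_wpM2r ?sqnorm_ge0// ge_min lexx.
    have := aM w; lra.
  have H2 : sqnorm (a' (b v - b' v)) <= e / 4 * sqnorm v.
    apply: le_trans (a'b _) _.
    apply: (@le_trans _ _ ((2 * M + 2) * (e / (4 * (2 * M + 2)) * sqnorm v))).
      by rewrite ler_wpM2l// addr_ge0 ?mulr_ge0// ltW.
    have Q0 : 0 < 2 * M + 2 by lra.
    rewrite le_eqVlt; apply/orP; left; apply/eqP; move: (2 * M + 2) (sqnorm v) Q0 => Q s Q0.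
    by field; rewrite gt_eqF.
  lra.
- move=> a Ha e e0; have [K [b sb Eb]] := Ha e e0.
  exists K, (adj b); first exact: sparseJ.
  have E v : adj a v - adj b v = adj (a - b) v.
    suff -> : adj (a - b) = adj a - adj b by [].
    apply/esym/adj_unique => u w; rewrite !bopDE !bopNE.
    by rewrite innerDl innerDr inner_scaleN -scaleN1r inner_scalel mulN1r !adjP.
  move=> v; rewrite E; apply: sqnorm_adj => w; exact: Eb.
- move=> a Ha e e0.
  have s0 : 0 < Num.sqrt (e / 4) by rewrite sqrtr_gt0 divr_gt0.
  have [b Hb ab] := Ha _ s0.
  have [K [c sc Ec]] := Hb _ (divr_gt0 e0 (ltr0n _ 4)).
  exists K, c => // v.
  have -> : a v - c v = (a - b) v + (b v - c v) by rewrite bopDE bopNE addrA subrK.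
  apply: le_trans (sqnormD_le _ _) _; have := Ec v.
  have H : sqnorm ((a - b) v) <= e / 4 * sqnorm v.
    apply: le_trans (opnorm_bound _ _) _; rewrite ler_wpM2r ?sqnorm_ge0//.
    rewrite -[leRHS]sqr_sqrtr ?divr_ge0 ?(ltW e0)//.
    by rewrite ler_sqr ?nnegrE ?opnorm_ge0 ?(ltW s0)// ltW.
  lra.
Qed.

End Sparse.

(** All that the sequel needs from a Cartan subalgebra isomorphic to l_infty. A
    normalizer [a] conjugates the projection onto a basis vector [v] to the
    rank-one operator of [a v], which must be diagonal: so [a v] is a multiple of a
    basis vector, and [a] is a monomial matrix. Such matrices generate the
    quasi-local algebra by regularity. *)
Lemma cartan_linf_structure (R : realType) (X : metricType R) (B : set (bop R X)) :
  cartan_subalgebra (@quasi_local R X) B -> isomorphic_to_linf B ->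
  exists xi : nat -> l2 R X, [/\ onb xi,
    (forall s : nat -> bool, exists b, [/\ quasi_local b,
       forall n, b (xi n) = (if s n then 1 else -1) *: xi n &
       forall u, sqnorm (b u) = sqnorm u]) &
    (forall a, quasi_local a -> sparse_limit xi a)].
Proof.
move=> cB [phi isoB]; have [xi [onb_xi diag]] := cartan_linf_basis cB isoB.
have phiB f : linf f -> B (phi f) by move=> lf; have [h _ _] := iso_bij isoB; exact: h.
have surj b : B b -> exists2 f, linf f & b = phi f.
  by move=> Bb; have [_ _ h] := iso_bij isoB; have [f lf <-] := h b Bb; exists f.
have onb_ext a b : (forall n, adj a (xi n) = adj b (xi n)) -> a = b.
  move=> H; apply/bopP => u; apply/eqP; rewrite -subr_eq0; apply/eqP.
  apply: onb_xi.2 => n; rewrite innerDl -scaleN1r inner_scalel mulN1r !adjP H.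
  by rewrite subrr.
exists xi; split => //.
- move=> s; pose f n : R[i] := if s n then 1 else -1.
  have lf : linf f.
    by exists 1 => n; rewrite /f; case: (s n); rewrite ?normc_opp normc1.
  have fJ : (fun n => (f n)^*%C) = f.
    by apply/funext => n; rewrite /f; case: (s n); rewrite ?rmorphN rmorph1.
  exists (phi f); split.
  + by apply: (cartan_sub cB); exact: phiB.
  + by move=> n; rewrite diag.
  have adjf : adj (phi f) = phi f by rewrite -(isoJ isoB)// fJ.
  have ff : phi f * phi f = 1.
    have a1 : adj (1 : bop R X) = 1 by apply/esym/adj_unique => u v.
    apply: onb_ext => n; rewrite adj_mul adjf a1 bopME !diag// bopZr diag// scalerA.
    by rewrite /f; case: (s n); rewrite ?mulrNN mulr1 scale1r.
  move=> u; have := adjP (phi f) u (phi f u).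
  by rewrite adjf -bopME ff bop1E !sqnorm_inner => -[].
- move=> a Ca.
  have regB := cartan_regular cB.
  have : cstar_generated (normalizer (@quasi_local R X) B) a by rewrite regB.
  apply: smallest_sub => {a Ca}; first exact: sparse_limit_cstar onb_xi.
  move=> a [Ca na]; apply: (@sparse_limit_sparse _ _ _ 1).
  pose e j (n : nat) : R[i] := (n == j)%:R.
  have le j : linf (e j).
    by exists 1 => n; rewrite /e; case: (n == j); rewrite ?normc1 ?normc0.
  have pE j : phi (e j) = outer (xi j) (xi j).
    have adjp : adj (phi (e j)) = phi (e j).
      rewrite -(isoJ isoB)//; congr phi; apply/funext => n; rewrite /e.
      by case: (n == j); rewrite ?conjc0 ?conjc1.
    apply: onb_ext => n; rewrite adjp adj_outer diag// outerE onb_xi.1 /e.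
    by have [->//|_] := eqVneq n j; rewrite !scale0r.
  have key v : B (outer v v) -> exists2 s, (size s <= 1)%N & supported xi s v.
    move=> /surj[f lf vf].
    have [H|/existsNP[i /eqP vi]] := pselect (forall i, inner v (xi i) = 0).
      by exists [::].
    exists [:: i] => // j; rewrite inE => ji.
    have : inner (outer v v (xi i)) (xi j) = 0.
      by rewrite vf diag// inner_scalel onb_xi.1 eq_sym (negbTE ji) mulr0.
    rewrite outerE inner_scalel => /eqP; rewrite mulf_eq0 => /orP[|/eqP//].
    by rewrite innerC conjc_eq0 (negbTE vi).
  have B1 j : B (phi (e j)) by exact: phiB.
  move=> j; have [] := na _ (B1 j); rewrite pE => H1 H2; split; apply: key.
    by rewrite mul_outerr mul_outerl adjK in H1.
  by rewrite mul_outerr mul_outerl in H2.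
Qed.

(** * Expansion and bounded geometry *)

Section GraphNeighbourhoods.
Context {V : finType} (e : rel V).
Implicit Types (A B : {set V}).

Definition nbhd A := A :|: vertex_boundary e A.

Lemma sub_nbhd A : A \subset nbhd A.
Proof. exact: finset.subsetUl. Qed.

Lemma sub_iter_nbhd i j A : (i <= j)%N -> iter i nbhd A \subset iter j nbhd A.
Proof.
move=> ij; rewrite -(subnK ij); elim: (j - i)%N => //= d IH.
by apply: (fintype.subset_trans IH); exact: sub_nbhd.
Qed.

Lemma path_iter_nbhd (se : symmetric e) x p A :
  path e x p -> x \in A -> last x p \in iter (size p) nbhd A.
Proof.
elim: p x A => //= y p IH x A /andP[xy yp] xA.
rewrite -iterS iterSr; apply: IH => //.
rewrite inE; have [//|yA] := boolP (y \in A); rewrite orFb !inE yA /=.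
by apply/exists_inP; exists x => //; rewrite se.
Qed.

Lemma card_nbhd k A : symmetric e -> (forall v, (#|[set u | e v u]| <= k)%N) ->
  (#|nbhd A| <= k.+1 * #|A|)%N.
Proof.
move=> se dk; rewrite mulSn; apply: leq_trans (leq_card_setU _ _) _.
rewrite leq_add2l.
have sub : vertex_boundary e A \subset (\bigcup_(u in A) [set v | e u v])%SET.
  apply/fintype.subsetP => v; rewrite !inE => /andP[_ /exists_inP[u uA vu]].
  by apply/finset.bigcupP; exists u => //; rewrite inE se.
apply: leq_trans (subset_leq_card sub) _.
apply: (@leq_trans (\sum_(u in A) #|[set v | e u v]|)); last first.
  by rewrite mulnC -sum_nat_const; apply: leq_sum => u _; exact: dk.
elim/big_ind2 : _ => [|A1 m1 A2 m2 h1 h2|i _]; first by rewrite cards0.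
  by apply: leq_trans (leq_card_setU _ _) _; exact: leq_add.
apply: eq_leq; apply: eq_card => j; rewrite finset.inE.
by apply/idP/idP => [eij|/set_mem//]; exact: mem_set.
Qed.

Lemma card_iter_nbhd k i A : symmetric e -> (forall v, (#|[set u | e v u]| <= k)%N) ->
  (#|iter i nbhd A| <= k.+1 ^ i * #|A|)%N.
Proof.
move=> se dk; elim: i => [|i IH]; first by rewrite mul1n.
rewrite iterS expnS -mulnA; apply: leq_trans (card_nbhd _ se dk) _.
by rewrite leq_mul2l IH orbT.
Qed.

(** The isoperimetric inequality only applies to sets of at most half of the
    vertices, whence the alternative. *)
Lemma iter_nbhd_expansion (R : realType) (h : R) k i A : 0 < h -> expander k h e ->
  #|V|%:R / 2 < #|iter i nbhd A|%:R :> R \/ (1 + h) ^+ i * #|A|%:R <= #|iter i nbhd A|%:R.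
Proof.
move=> h0 ex; elim: i => [|i [IH|IH]]; first by right; rewrite expr0 mul1r.
  left; apply: lt_le_trans IH _; rewrite ler_nat; apply: subset_leq_card.
  exact: sub_nbhd.
have [le2|] := leP (#|iter i nbhd A|%:R : R) (#|V|%:R / 2); last first.
  move=> lt2; left; apply: lt_le_trans lt2 _; rewrite ler_nat; apply: subset_leq_card.
  exact: sub_nbhd.
right; have := expander_iso ex le2.
rewrite iterS {3}/nbhd cardsU.
have -> : iter i nbhd A :&: vertex_boundary e (iter i nbhd A) = finset.set0.
  by apply/setP => v; rewrite !inE; case: (v \in _).
rewrite cards0 subn0 natrD exprS -mulrA => H.
apply: (@le_trans _ _ ((1 + h) * #|iter i nbhd A|%:R)); first by rewrite ler_wpM2l// addr_ge0// ltW.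
by rewrite mulrDl mul1r lerD2l.
Qed.

End GraphNeighbourhoods.

Section CoarseUnion.
Context {R : realType} (k : nat) (h : R) (h0 : 0 < h) (V : nat -> finType)
  (e : forall n, rel (V n)) (X : metricType R) (iota : forall n, V n -> X).
Hypothesis hX : coarse_union_of_expanders k h e iota.

Definition trace n (A : set X) : {set V n} := [set z | `[< A (iota z) >]]%SET.

Lemma iota_surj x : exists n (z : V n), x = iota z.
Proof.
have [g _ gK] := cue_bij hX; exists (tag (g x)), (tagged (g x)).
by rewrite -[LHS]gK.
Qed.

Lemma iota_tagged n m (z : V n) (y : V m) : iota z = iota y -> Tagged V z = Tagged V y.
Proof. by move=> E; apply: (bij_inj (cue_bij hX)). Qed.

Lemma iota_inj n : injective (@iota n).
Proof. by move=> z y /iota_tagged/eqP; rewrite eq_Tagged => /eqP. Qed.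

Lemma iota_index n m (z : V n) (y : V m) : iota z = iota y -> n = m.
Proof. by move=> /iota_tagged/(congr1 tag). Qed.

Lemma mdist_edge n (x y : V n) : e x y -> mdist (iota x) (iota y) <= 1.
Proof.
move=> xy; rewrite -lee_fin (cue_dist hX); apply: ereal_inf_lbound.
by exists [:: y] => //=; rewrite xy.
Qed.

Lemma iter_nbhd_mdist n i (A : {set V n}) v : v \in iter i (nbhd (@e n)) A ->
  exists2 u, u \in A & mdist (iota u) (iota v) <= i%:R.
Proof.
elim: i v => [|i IH] v /=; first by move=> vA; exists v => //; rewrite mdistxx.
rewrite inE => /orP[/IH[u uA ud]|].
  by exists u => //; apply: le_trans ud _; rewrite ler_nat.
rewrite !inE => /andP[_ /exists_inP[w /IH[u uA ud] vw]]; exists u => //.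
apply: le_trans (metric_triangle _ (iota w) _) _; rewrite -natr1 lerD//.
by apply: mdist_edge; rewrite (expander_sym (cue_expander hX n)).
Qed.

Lemma mdist_iter_nbhd n (x y : V n) (i : nat) : mdist (iota x) (iota y) <= i%:R ->
  y \in iter i (nbhd (@e n)) [set x]%SET.
Proof.
move=> xy; have : (graph_dist (@e n) x y < (i.+1%:R : R)%:E)%E.
  by rewrite -(cue_dist hX) lte_fin (le_lt_trans xy)// ltr_nat.
move=> /ereal_inf_lt[_ [p [ep <-] <-]]; rewrite lte_fin ltr_nat ltnS => pi.
apply: (fintype.subsetP (sub_iter_nbhd _ _ pi)).
by apply: path_iter_nbhd => //; [exact: expander_sym (cue_expander hX n)|rewrite finset.set11].
Qed.

(** If both traces had density more than [delta], their neighbourhoods would grow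
    geometrically until they fill more than half of the graph, hence meet after a
    number of steps that depends on [delta] only. *)
Lemma far_sets_small (delta : R) : 0 < delta -> exists2 r : R, 0 < r &
  forall (A B : set X), (r%:E < setdist A B)%E -> forall n,
    #|trace n A|%:R <= delta * #|V n|%:R \/ #|trace n B|%:R <= delta * #|V n|%:R.
Proof.
move=> d0.
have [i hi] : exists i : nat, 1 <= (1 + h) ^+ i * delta.
  have dh : 0 <= (delta * h)^-1 by rewrite invr_ge0 mulr_ge0// ltW.
  exists (Num.bound (delta * h)^-1).
  have /ltW lt := archi_boundP dh; move: (Num.bound _) lt => i lt.
  (* Bernoulli's inequality *)
  have bern : 1 + i%:R * h <= (1 + h) ^+ i.
    elim: i {lt} => [|i IH]; first by rewrite mul0r addr0 expr0.
    rewrite exprS mulrDl mul1r; apply: (@le_trans _ _ ((1 + i%:R * h) + h * 1)).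
      by rewrite -natr1 mulrDl mul1r mulr1 addrA.
    rewrite lerD// ler_wpM2l ?(ltW h0)//; by apply: exprn_ege1; rewrite lerDl ltW.
  apply: (@le_trans _ _ ((1 + i%:R * h) * delta)); last by rewrite ler_wpM2r// ltW.
  have : 1 <= i%:R * (delta * h) by rewrite -ler_pdivrMr ?mulr_gt0// div1r.
  by rewrite mulrDl mul1r -mulrA (mulrC h); lra.
exists (2 * i%:R + 1) => [|A B AB n]; first by rewrite ltr_wpDl// mulr_ge0.
apply: contrapT => /not_orP[/negP + /negP]; rewrite -!ltNge => HA HB.
have half (C : {set V n}) : delta * #|V n|%:R < #|C|%:R :> R ->
    #|V n|%:R / 2 < #|iter i (nbhd (@e n)) C|%:R :> R.
  move=> HC; have [//|HC'] := iter_nbhd_expansion i C h0 (cue_expander hX n).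
  apply: lt_le_trans HC'.
  have c0 : (0 : R) <= #|V n|%:R by [].
  have p0 : 0 < (1 + h) ^+ i by rewrite exprn_gt0// addr_gt0.
  have : (1 + h) ^+ i * (delta * #|V n|%:R) < (1 + h) ^+ i * #|C|%:R by rewrite ltr_pM2l.
  have : 1 * #|V n|%:R <= (1 + h) ^+ i * delta * #|V n|%:R by rewrite ler_wpM2r.
  rewrite mulrA; lra.
have /set0Pn[v] : iter i (nbhd (@e n)) (trace n A) :&: iter i (nbhd (@e n)) (trace n B) != finset.set0.
  apply: contraTneq (ltrD (half _ HA) (half _ HB)) => I0.
  rewrite -leNgt -splitr -natrD ler_nat -cardsUI I0 cards0 addn0.
  exact: max_card.
rewrite inE => /andP[/iter_nbhd_mdist[a + av] /iter_nbhd_mdist[b + bv]].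
rewrite !finset.inE => /asboolP Aa /asboolP Bb.
have := lt_setdist AB Aa Bb; have := metric_triangle (iota a) (iota v) (iota b).
rewrite (metric_sym (iota v)); lra.
Qed.

Lemma blocks_far (M : R) : exists N, forall n m, (N <= n)%N -> (N <= m)%N -> n <> m ->
  forall (z : V n) (y : V m), M <= mdist (iota z) (iota y).
Proof.
have [[P Q] /= [[N1 _ HP] [N2 _ HQ]] H] := cue_far hX M.
exists (maxn N1 N2) => n m; rewrite !geq_max => /andP[n1 n2] /andP[m1 m2] /eqP nm z y.
have /= := H (n, m) (conj (HP _ n1) (HQ _ m2)) nm.
move=> le; rewrite -lee_fin; apply: le_trans le _.
by apply: ereal_inf_lbound; exists (iota z) => //; exists (iota y).
Qed.

Lemma blocks_large (P : nat) : exists N, forall n, (N <= n)%N -> (P <= #|V n|)%N.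
Proof.
have /= [N _ HN] := cue_card hX (nbhs_infty_ge P).
by exists N => n Nn; exact: HN.
Qed.

(** Bounded geometry. A ball meets at most one of the late blocks, and inside
    a block the bounded degree controls it. *)
Lemma balls_bounded (r : nat) : exists M : nat, forall x : X, exists s : seq X,
  [/\ uniq s, (size s <= M)%N & forall y, mdist x y <= r%:R -> y \in s].
Proof.
have [N HN] := blocks_far (r%:R + r%:R + 1).
pose L := flatten [seq [seq iota z | z <- enum (V m)] | m <- index_iota 0 N].
have LP m (z : V m) : (m < N)%N -> iota z \in L.
  move=> mN; apply/flatten_mapP; exists m; first by rewrite mem_index_iota mN.
  by apply/mapP; exists z; rewrite ?mem_enum.
exists (size L + k.+1 ^ (r + r))%N => x.
suff [s [sM sP]] : exists s : seq X, (size s <= size L + k.+1 ^ (r + r))%N /\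
    forall y, mdist x y <= r%:R -> y \in s.
  exists (undup s); split; rewrite ?undup_uniq//.
    exact: leq_trans (size_undup _) sM.
  by move=> y /sP; rewrite mem_undup.
have [[m [z [Nm xz]]]|no] :=
    pselect (exists m (z : V m), (N <= m)%N /\ mdist x (iota z) <= r%:R).
  exists (L ++ [seq iota y | y <- enum (iter (r + r) (nbhd (@e m)) [set z]%SET)]); split.
    rewrite size_cat leq_add2l size_map -cardE.
    have := @card_iter_nbhd _ (@e m) k (r + r) [set z]%SET (expander_sym (cue_expander hX m))
      (expander_deg (cue_expander hX m)).
    by rewrite cards1 muln1.
  move=> y; have [m' [z' ->]] := iota_surj y => xy; rewrite mem_cat.
  have [/LP->//|Nm'] := ltnP m' N; apply/orP; right.
  have zz : mdist (iota z) (iota z') <= r%:R + r%:R.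
    apply: le_trans (metric_triangle _ x _) _.
    by rewrite (metric_sym (iota z)) lerD.
  have E : m = m'.
    apply: contrapT => mm; have := HN _ _ Nm Nm' mm z z'; lra.
  subst m'; apply/mapP; exists z' => //; rewrite mem_enum.
  by apply: mdist_iter_nbhd; rewrite natrD.
exists L; split; first by rewrite leq_addr.
move=> y; have [m' [z' ->]] := iota_surj y => xy.
have [/LP->//|Nm'] := ltnP m' N.
by exfalso; apply: no; exists m', z'.
Qed.

End CoarseUnion.

(** * Localization of the basis vectors *)

Section SignChoice.
Context {R : realType} {T : choiceType}.
Implicit Types (u v : l2 R T).

Definition sg (b : bool) : R[i] := if b then 1 else -1.

(** By the parallelogram law one of [u + v], [u - v] is at least as long as if
    [u] and [v] were orthogonal; so signs can be chosen one at a time. *)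
Lemma signs_large (v : nat -> l2 R T) (s : nat -> bool) J0 J1 :
  exists s', (forall i, (i < J0)%N -> s' i = s i) /\
    \sum_(i < J1 | (J0 <= i)%N) sqnorm (v i) <= sqnorm (\sum_(i < J1) sg (s' i) *: v i).
Proof.
elim: J1 => [|J1 [s' [s's IH]]].
  by exists s; split => //; rewrite big_ord0 sqnorm_ge0.
have [lt|ge] := ltnP J1 J0.
  exists s; split => //; rewrite big1 ?sqnorm_ge0// => i ge.
  by have := leq_trans lt ge; rewrite leqNgt ltn_ord.
set w := \sum_(i < J1) _ in IH.
have [b Hb] : exists b : bool, sqnorm w + sqnorm (v J1) <= sqnorm (w + sg b *: v J1).
  have P := parallelogram w (v J1).
  have [h|h] := leP (sqnorm w + sqnorm (v J1)) (sqnorm (w + v J1)).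
    by exists true; rewrite scale1r.
  by exists false; rewrite scaleN1r; lra.
exists (fun i => if i == J1 then b else s' i); split.
  by move=> i iJ; rewrite ltn_eqF ?s's// (leq_trans iJ).
rewrite big_mkcond big_ord_recr/= ge -big_mkcond/= big_ord_recr/= eqxx.
rewrite (eq_bigr (fun i : 'I_J1 => sg (s' i) *: v i)); last first.
  by move=> i _; rewrite ltn_eqF.
apply: le_trans Hb; exact: lerD.
Qed.

Lemma sqnorm_chi_split (A : set T) u :
  sqnorm u = sqnorm (chi A u) + sqnorm (chi (~` A) u).
Proof.
rewrite !sqnormE -rsumD; try exact: sqnorm_summable.
congr rsum; apply/funext => x; rewrite !chiE.
have [xA|xA] := boolP (x \in A).
  by rewrite (memNset (A := ~` A)) ?normc0 ?expr0n ?addr0//= => h; apply: h; exact: set_mem.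
by rewrite (mem_set (A := ~` A)) ?normc0 ?expr0n ?add0r//= => h; move/negP: xA; apply; exact: mem_set.
Qed.

Lemma sqnorm_chi_seq (s : seq T) u : uniq s ->
  sqnorm (chi [set` s] u) = \sum_(x <- s) normc (u x) ^+ 2.
Proof.
move=> us; rewrite (@sqnorm_finsupp _ _ s)//.
  by rewrite !big_seq; apply: eq_bigr => x xs; rewrite chiE mem_set.
by move=> x xs; rewrite chiE memNset//=; apply/negP.
Qed.

End SignChoice.

Section Localization.
Context {R : realType} {X : metricType R} (xi : nat -> l2 R X).
Hypothesis xi_onb : onb xi.
Hypothesis sign_ops : forall s : nat -> bool, exists b, [/\ quasi_local b,
  forall n, b (xi n) = sg (s n) *: xi n & forall u, sqnorm (b u) = sqnorm u].
Hypothesis balls : forall r : nat, exists M : nat, forall x : X, exists s : seq X,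
  [/\ uniq s, (size s <= M)%N & forall y, mdist x y <= r%:R -> y \in s].

Let signed_expansion (s : nat -> bool) J x :=
  \sum_(i < J) sg (s i) *: (inner (delta x) (xi i) *: xi i).

(** At scale [r], the signs [s] push a fixed proportion of the image of some
    [delta x] out of the ball of radius [r], and the signs from [J] on hardly
    matter for this. *)
Let hump (eps : R) (r : nat) (J : nat) (s : nat -> bool) := exists x (t : seq X),
  [/\ forall y, mdist x y <= r%:R -> y \in t,
      3 * eps <= 4 * sqnorm (chi (~` [set` t]) (signed_expansion s J x)) &
      64 * sqnorm (delta x - partial_expansion xi J (delta x)) <= eps].

(** The signs below [J0] are prescribed, which costs little because the basis vectors
    considered have coefficients less than [c] in [delta x]; nor can the ball
    hold much of them, as Bessel's inequality bounds by [M] the total mass that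
    the basis vectors have on [M] points. *)
Let hump_step (eps : R) : 0 < eps ->
  (forall c, 0 < c -> exists x J,
     eps < \sum_(i < J | normc (xi i x) < c) normc (xi i x) ^+ 2) ->
  forall J0 (s : nat -> bool) r, exists J1 s', [/\ (J0 < J1)%N,
    forall i, (i < J0)%N -> s' i = s i & hump eps r J1 s'].
Proof.
move=> e0 H J0 s r; have [M HM] := balls r.
pose K : R := J0%:R + M%:R + 1.
have K0 : 0 < K by rewrite ltr_wpDl// addr_ge0.
pose c := Num.sqrt (eps / (4 * K)).
have c0 : 0 < c by rewrite sqrtr_gt0 divr_gt0// mulr_gt0.
have cK : c ^+ 2 * (J0%:R + M%:R) <= eps / 4.
  have -> : eps / 4 = c ^+ 2 * K.
    rewrite sqr_sqrtr; last by rewrite divr_ge0 ?mulr_ge0// ltW.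
    by field; rewrite gt_eqF.
  by rewrite ler_wpM2l ?sqr_ge0// lerDl.
have [x [J HJ]] := H c c0.
have e64 : 0 < eps / 64 by rewrite divr_gt0.
have [J' HJ'] := parseval xi_onb (delta x) e64.
pose J1 := maxn (maxn J J') J0.+1.
have [t [ut tM tP]] := HM x.
pose A := ~` [set` t].
have [s' [s's HS]] := signs_large (fun i => chi A (inner (delta x) (xi i) *: xi i)) s J0 J1.
exists J1, s'; split => //; first by rewrite leq_max leqnn orbT.
exists x, t; split => //; last first.
  have := HJ' J1; rewrite !leq_max leqnn orbT => /(_ isT); lra.
have -> : chi A (signed_expansion s' J1 x) =
    \sum_(i < J1) sg (s' i) *: chi A (inner (delta x) (xi i) *: xi i).
  by rewrite bop_sumr; apply: eq_bigr => i _; rewrite bopZr.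
suff : eps <= \sum_(i < J1 | (J0 <= i)%N) sqnorm (chi A (inner (delta x) (xi i) *: xi i))
    + c ^+ 2 * (J0%:R + M%:R) by lra.
pose beta i := \sum_(y <- t) normc (xi i y) ^+ 2.
pose a i := normc (xi i x) ^+ 2.
have beta0 i : 0 <= beta i by rewrite sumr_ge0// => *; rewrite sqr_ge0.
have beta1 i : beta i <= 1 by rewrite -(sqnorm_onb xi_onb i); exact: sums_le_sqnorm.
have vE i : sqnorm (chi A (inner (delta x) (xi i) *: xi i)) = a i * (1 - beta i).
  rewrite bopZr sqnormZ inner_deltal normcJ_eq -/(a i); congr (_ * _).
  have := sqnorm_chi_split [set` t] (xi i); rewrite (sqnorm_onb xi_onb) sqnorm_chi_seq//.
  by rewrite -/(beta i) -/A => ->; rewrite addrC addKr.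
have term (i : nat) : (if normc (xi i x) < c then a i else 0) <=
    (if (J0 <= i)%N then a i * (1 - beta i) else 0) + c ^+ 2 * beta i
    + (if (i < J0)%N then c ^+ 2 else 0).
  have c20 : 0 <= c ^+ 2 := sqr_ge0 c.
  have a0 : 0 <= a i := sqr_ge0 _.
  have cb : 0 <= c ^+ 2 * beta i by rewrite mulr_ge0.
  have ab : 0 <= a i * (1 - beta i) by rewrite mulr_ge0// subr_ge0.
  case: ifP => [small|_]; last by case: ltnP => _; lra.
  have ac : a i <= c ^+ 2.
    by rewrite ler_sqr ?nnegrE ?normc_ge0 ?(ltW c0)// ltW.
  have : a i * beta i <= c ^+ 2 * beta i by rewrite ler_wpM2r.
  by case: ltnP => _; lra.
apply: (@le_trans _ _ (\sum_(i < J1) (if normc (xi i x) < c then a i else 0))).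
  apply: le_trans (ltW HJ) _; rewrite big_mkcond/=.
  have JJ : (J <= J1)%N by rewrite !leq_max leqnn.
  rewrite -!(big_mkord xpredT (fun i => if normc (xi i x) < c then a i else 0)).
  rewrite [leRHS](big_cat_nat (leq0n _) JJ)/= lerDl sumr_ge0// => i _.
  by case: ifP => // _; exact: sqr_ge0.
apply: le_trans (ler_sum _ (fun (i : 'I_J1) _ => term i)) _.
rewrite !big_split/= -addrA; apply: lerD.
  by rewrite [leRHS]big_mkcond; apply: ler_sum => i _; rewrite vE.
rewrite mulrDr addrC; apply: lerD.
  have J01 : (J0 <= J1)%N by rewrite leq_max leqnSn orbT.
  by rewrite -big_mkcond/= (big_ord_narrow J01) sumr_const card_ord mulr_natr.
rewrite -mulr_sumr ler_wpM2l ?sqr_ge0// exchange_big/=.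
apply: (@le_trans _ _ (\sum_(y <- t) 1)).
  by apply: ler_sum => y _; exact: bessel_pointwise.
by rewrite big_const_seq count_predT iter_addr_0 ler_nat.
Qed.

(** Otherwise some [delta x] spread over many basis vectors with small
    coefficients, and suitable signs push its image out of the ball of a given
    radius, which has too few points to carry much of that many orthogonal
    vectors. Sign patterns for all radii, glued together by a gliding hump, give
    a sign operator that is not quasi-local. Since at most [1 / c^2] of the
    coefficients of [delta x] are at least [c], this says that the rows of the
    change of basis are uniformly close to sparse ones. *)
Lemma points_spread_little (eps : R) : 0 < eps -> exists2 c : R, 0 < c &
  forall x J, \sum_(i < J | normc (xi i x) < c) normc (xi i x) ^+ 2 <= eps.
Proof.
move=> e0; apply: contrapT => noc.
have H c : 0 < c -> exists x J, eps < \sum_(i < J | normc (xi i x) < c) normc (xi i x) ^+ 2.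
  move=> c0; apply: contrapT => no; apply: noc; exists c => // x J.
  by rewrite leNgt; apply/negP => lt; apply: no; exists x, J.
have /choice[F HF] (p : nat * (nat -> bool) * nat) : exists q : nat * (nat -> bool),
    [/\ (p.1.1 < q.1)%N, forall i, (i < p.1.1)%N -> q.2 i = p.1.2 i & hump eps p.2 q.1 q.2].
  by have [J [s ?]] := hump_step e0 H p.1.1 p.1.2 p.2; exists (J, s).
(* the gliding hump: [st m] is a pair of a length and a sign sequence *)
pose st := fix st m := if m is m'.+1 then F (st m', m') else (0%N, fun=> true).
have stS m : st m.+1 = F (st m, m) by [].
have Jmono m n : (m <= n)%N -> ((st m).1 + (n - m) <= (st n).1)%N.
  elim: n => [|n IH]; first by rewrite leqn0 => /eqP->.
  rewrite leq_eqVlt => /predU1P[->|]; first by rewrite subnn addn0.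
  rewrite ltnS => mn; have [lt _ _] := HF (st n, n).
  by rewrite subSn// addnS (leq_ltn_trans (IH mn)).
have agree m n i : (m <= n)%N -> (i < (st m).1)%N -> (st n).2 i = (st m).2 i.
  move=> + im; elim: n => [|n IH]; first by rewrite leqn0 => /eqP->.
  rewrite leq_eqVlt => /predU1P[->//|]; rewrite ltnS => mn.
  have [_ ag _] := HF (st n, n); rewrite -IH// stS ag//=.
  by apply: leq_trans im _; apply: leq_trans (Jmono _ _ mn); rewrite leq_addr.
pose s i := (st i.+1).2 i.
have sE m i : (i < (st m).1)%N -> (st m).2 i = s i.
  move=> im; have iS : (i < (st i.+1).1)%N.
    by apply: leq_trans (Jmono 0%N i.+1 _); rewrite // add0n subn0.
  by have [le|/ltnW le] := leqP m i.+1; [rewrite /s (agree m)|rewrite (agree i.+1)].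
have [b [/quasi_localP qb bxi bn]] := sign_ops s.
have e16 : 0 < eps / 16 by rewrite divr_gt0.
have [r r0 Hr] := qb _ e16.
pose m := Num.bound r.
have rm : r < m%:R by apply: archi_boundP; exact: ltW.
have [_ _ [x [t [tP big tail]]]] := HF (st m, m).
rewrite -stS in big tail; set J := (st m.+1).1 in big tail.
have dA : (r%:E < setdist (~` [set` t]) [set x])%E.
  apply: (@lt_le_trans _ _ m%:R%:E); first by rewrite lte_fin.
  apply: setdist_ge => y z /= yt ->; rewrite leNgt; apply/negP => ym; apply: yt.
  by apply: tP; rewrite metric_sym ltW.
have near_x : sqnorm (chi (~` [set` t]) (b (delta x))) <= eps / 16.
  have := Hr _ _ dA (delta x).
  have -> : chi [set x] (delta x) = delta x :> l2 R X.
    apply/l2P => y; rewrite chiE deltaE; case: ifPn => //.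
    by case: eqVneq => // -> /negP[]; exact: mem_set.
  by rewrite sqnorm_delta mulr1.
have bE : signed_expansion (st m.+1).2 J x = b (partial_expansion xi J (delta x)).
  rewrite /signed_expansion /partial_expansion bop_sumr; apply: eq_bigr => i _.
  by rewrite bopZr bxi scalerA [RHS]scalerA [_ * sg _]mulrC sE.
have : sqnorm (chi (~` [set` t]) (signed_expansion (st m.+1).2 J x)) <=
    2 * (eps / 16) + 2 * (eps / 64).
  have -> : signed_expansion (st m.+1).2 J x =
      b (delta x) - b (delta x - partial_expansion xi J (delta x)).
    by rewrite bE bopDr bopNr opprB addrC subrK.
  rewrite bopDr bopNr; apply: le_trans (sqnormD_le _ _) _; rewrite sqnormN.
  have : sqnorm (chi (~` [set` t]) (b (delta x - partial_expansion xi J (delta x)))) <= eps / 64.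
    by apply: le_trans (sqnorm_chi_le _ _) _; rewrite bn; lra.
  lra.
lra.
Qed.

End Localization.

(** * Exponential sums and flat systems *)

Section ExponentialSums.
Context {R : rcfType}.
Implicit Types z : R[i].

Definition add_character (p : nat) (psi : 'F_p -> R[i]) : Prop :=
  [/\ forall x y, psi (x + y) = psi x * psi y,
      forall x, psi (- x) = (psi x)^*%C,
      forall x, normc (psi x) = 1 &
      \sum_x psi x = 0].

(** Powers of a root of [1 + X + ... + X^(p-1)]. *)
Lemma add_character_exists (p : nat) : prime p -> exists psi, @add_character p psi.
Proof.
move=> pp; have p1 := prime_gt1 pp; have p0 := prime_gt0 pp.
pose q : {poly R[i]} := \poly_(i < p) 1.
have sq : size q = p by rewrite size_poly_eq ?oner_eq0.
have /closed_rootP[w] : size q != 1%N by rewrite sq neq_ltn p1 orbT.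
rewrite /root horner_poly => /eqP w0.
have {}w0 : \sum_(i < p) w ^+ i = 0.
  by rewrite -[RHS]w0; apply: eq_bigr => i _; rewrite mul1r.
have wp : w ^+ p = 1.
  by apply/eqP; rewrite -subr_eq0 subrX1 w0 mulr0.
have nw : normc w = 1.
  apply/eqP; rewrite -(@pexpr_eq1 _ _ p) ?normc_ge0//.
  by rewrite -normcX wp normc1.
have modE m : (m %% (Zp_trunc (pdiv p)).+2 = m %% p)%N by rewrite Fp_cast.
have psiD (x y : 'F_p) : w ^+ (x + y)%R = w ^+ x * w ^+ y.
  rewrite -exprD /= -[in RHS](expr_mod _ wp); congr (_ ^+ _).
  exact: modE.
have psi1 (x : 'F_p) : normc (w ^+ x) = 1 by rewrite normcX nw expr1n.
exists (fun x => w ^+ x); split => //.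
  move=> x; have H : w ^+ x * w ^+ (- x)%R = 1 by rewrite -psiD subrr expr0.
  have J : w ^+ x * (w ^+ x)^*%C = 1 by rewrite mulcJ_eq psi1 expr1n.
  have nz : w ^+ x != 0.
    by apply: contraTneq (oner_neq0 R) => z0; rewrite -[X in X != 0](psi1 x) z0 normc0 eqxx.
  by apply: (mulfI nz); rewrite H J.
rewrite -[RHS]w0 -(big_mkord xpredT (fun i => w ^+ i)) -[in RHS](Fp_cast pp) big_mkord.
by [].
Qed.

Lemma sum_normc_sqr (S Z : finType) (d : S -> R[i]) (chi_ : S -> Z -> R[i]) :
  Complex (\sum_z normc (\sum_s d s * chi_ s z) ^+ 2) 0 =
  \sum_s \sum_s' d s * (d s')^*%C * \sum_z chi_ s z * (chi_ s' z)^*%C.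
Proof.
have -> : Complex (\sum_z normc (\sum_s d s * chi_ s z) ^+ 2) 0 =
    \sum_z Complex (normc (\sum_s d s * chi_ s z) ^+ 2) 0.
  by elim/big_ind2 : _ => // [x1 y1 x2 y2 <- <-]; rewrite complexDE addr0.
under [RHS]eq_bigr => s _ do (under eq_bigr => s' _ do rewrite mulr_sumr; rewrite exchange_big).
rewrite [RHS]exchange_big; apply: eq_bigr => z _.
rewrite -mulcJ_eq rmorph_sum big_distrlr /=; apply: eq_bigr => s _; apply: eq_bigr => s' _.
by rewrite rmorphM /= mulrACA.
Qed.

(** The relation [G] records which functions may fail to be orthogonal. *)
Lemma gram_bound (S Z : finType) (d : S -> R[i]) (chi_ : S -> Z -> R[i]) (N : R) (G : rel S) :
  (forall s s', G s s' -> normc (\sum_z chi_ s z * (chi_ s' z)^*%C) <= N) ->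
  (forall s s', ~~ G s s' -> \sum_z chi_ s z * (chi_ s' z)^*%C = 0) ->
  \sum_z normc (\sum_s d s * chi_ s z) ^+ 2 <=
    N * \sum_s \sum_(s' | G s s') normc (d s) * normc (d s').
Proof.
move=> GN G0; have := congr1 (@complex.Re R) (sum_normc_sqr d chi_); rewrite /= => ->.
apply: le_trans (Re_le_normc _) _; apply: le_trans (normc_sum _ _ _) _.
rewrite mulr_sumr; apply: ler_sum => s _; apply: le_trans (normc_sum _ _ _) _.
rewrite mulr_sumr [leRHS]big_mkcond; apply: ler_sum => s' _; case: ifPn => g.
  rewrite !normcM normcJ_eq mulrC ler_wpM2r ?mulr_ge0 ?normc_ge0//; exact: GN.
by rewrite G0// mulr0 normc0.
Qed.

Context (p : nat) (p_prime : prime p) (p_gt3 : (3 < p)%N).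
Context (psi : 'F_p -> R[i]) (psi_char : add_character psi).
Implicit Types x y t u v : 'F_p.

Let psiD x y : psi (x + y) = psi x * psi y. Proof. by case: psi_char. Qed.
Let psiN x : psi (- x) = (psi x)^*%C. Proof. by case: psi_char. Qed.
Let psi1 x : normc (psi x) = 1. Proof. by case: psi_char. Qed.
Let cardF : #|'F_p| = p. Proof. exact: card_Fp. Qed.

Let psi0 : psi 0 = 1.
Proof. by rewrite -(subrr 0) psiD psiN mulcJ_eq psi1 expr1n. Qed.

Lemma sum_character u : \sum_x psi (x * u) = if u == 0 then p%:R else 0.
Proof.
case: eqVneq => [->|u0].
  under eq_bigr do rewrite mulr0 psi0.
  by rewrite sumr_const cardF.
transitivity (\sum_x psi x); last by case: psi_char.
rewrite [RHS](reindex (fun x => x * u))//.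
by exists (fun x => x / u) => x _; rewrite ?mulfK ?divfK.
Qed.

Lemma sum_character2 u v : \sum_(z : 'F_p * 'F_p) psi (z.1 * u + z.2 * v) =
  if (u == 0) && (v == 0) then (p ^ 2)%:R else 0.
Proof.
rewrite -(pair_bigA _ (fun x y => psi (x * u + y * v)))/=.
under eq_bigr => x _ do (under eq_bigr => y _ do rewrite psiD; rewrite -mulr_sumr).
rewrite -mulr_suml !sum_character.
by case: (u == 0); case: (v == 0); rewrite ?mulr0 ?mul0r//= -natrM.
Qed.

(** The point is that [P (t + u) - P t] has lower degree in [t] than [P]. *)
Lemma weyl_differencing (P : 'F_p -> 'F_p) :
  Complex (normc (\sum_t psi (P t)) ^+ 2) 0 =
  \sum_u \sum_t psi (P (t + u) - P t).
Proof.
rewrite -mulcJ_eq rmorph_sum big_distrlr /= exchange_big [RHS]exchange_big.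
apply: eq_bigr => t _; rewrite (reindex (fun u => t + u))/=; last first.
  by exists (fun u => u - t) => u _; [rewrite addrAC subrr add0r|rewrite addrC subrK].
by apply: eq_bigr => u _; rewrite psiD psiN.
Qed.

Let nz2 : (2%:R : 'F_p) != 0.
Proof. by rewrite -(dvdn_pcharf (pchar_Fp p_prime)) gtnNdvd// (ltn_trans _ p_gt3). Qed.

Let nz3 : (3%:R : 'F_p) != 0.
Proof. by rewrite -(dvdn_pcharf (pchar_Fp p_prime)) gtnNdvd// (ltn_trans _ p_gt3). Qed.

(** Differencing leaves linear phases, which cancel except at [u = 0]. *)
Lemma quadratic_sum (a b c : 'F_p) : a != 0 ->
  normc (\sum_t psi (a * t ^+ 2 + b * t + c)) ^+ 2 = p%:R.
Proof.
move=> a0; have := weyl_differencing (fun t => a * t ^+ 2 + b * t + c).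
have E u : \sum_t psi (a * (t + u) ^+ 2 + b * (t + u) + c - (a * t ^+ 2 + b * t + c)) =
    if u == 0 then p%:R else 0.
  rewrite (eq_bigr (fun t => psi (a * u ^+ 2 + b * u) * psi (t * (2%:R * a * u)))).
    rewrite -mulr_sumr sum_character !mulf_eq0 (negbTE nz2) (negbTE a0)/=.
    by case: eqP => [->|_]; rewrite ?mulr0// expr0n/= !mulr0 addr0 psi0 mul1r.
  by move=> t _; rewrite -psiD; congr psi; ring.
under [X in _ = X -> _]eq_bigr do rewrite E.
rewrite -[X in _ = X -> _]big_mkcond big_pred1_eq => {}E.
have -> : (p%:R : R) = complex.Re (p%:R : R[i]) by rewrite raddfMn.
by rewrite -E.
Qed.

(** Differencing leaves quadratic phases. *)
Lemma cubic_sum (a b c : 'F_p) : a != 0 ->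
  normc (\sum_t psi (a * t ^+ 3 + b * t ^+ 2 + c * t)) ^+ 2 <= 2 * p%:R * Num.sqrt p%:R.
Proof.
move=> a0; have := weyl_differencing (fun t => a * t ^+ 3 + b * t ^+ 2 + c * t).
move=> /(congr1 (@complex.Re R))/= ->.
apply: le_trans (Re_le_normc _) _; apply: le_trans (normc_sum _ _ _) _.
have s1 : 1 <= Num.sqrt (p%:R : R).
  by rewrite -[leLHS]sqrtr1 ler_sqrt ?ler0n// ler1n prime_gt0.
apply: (@le_trans _ _ (\sum_u ((if u == 0 then p%:R else 0) + Num.sqrt (p%:R : R)))).
  apply: ler_sum => u _; case: eqVneq => [->|u0].
    apply: le_trans (normc_sum _ _ _) _.
    under eq_bigr do rewrite psi1.
    by rewrite sumr_const cardF lerDl sqrtr_ge0.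
  rewrite add0r (eq_bigr (fun t => psi ((3%:R * a * u) * t ^+ 2 + (3%:R * a * u ^+ 2 + 2%:R * b * u) * t
     + (a * u ^+ 3 + b * u ^+ 2 + c * u)))).
    rewrite -ler_sqr ?nnegrE ?normc_ge0 ?sqrtr_ge0// quadratic_sum ?sqr_sqrtr//.
    by rewrite !mulf_neq0.
  by move=> t _; congr psi; ring.
rewrite big_split/= -big_mkcond big_pred1_eq sumr_const cardF -[X in _ + X <= _]mulr_natl.
have p0 : 0 <= (p%:R : R) by [].
have : p%:R * 1 <= p%:R * Num.sqrt (p%:R : R) by rewrite ler_wpM2l.
lra.
Qed.

End ExponentialSums.

(** Orthogonal unimodular functions [r t] on [Z] whose linear combinations have
    comparable second and fourth moments, and whose kernel twisted by the weights
    [w t] is uniformly small compared with its trace norm. *)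
Record flat_system (R : rcfType) (I Z : finType) (r : I -> Z -> R[i])
    (w : I -> R[i]) (eta : R) : Prop := FlatSystem {
  flat_norm : forall t z, normc (r t z) = 1;
  flat_weight : forall t, normc (w t) = 1;
  flat_orth : forall s t, \sum_z r s z * (r t z)^*%C = if s == t then #|Z|%:R else 0;
  flat_fourth : forall c : I -> R[i], \sum_z normc (\sum_t c t * r t z) ^+ 4 <=
    2 * #|Z|%:R * (\sum_t normc (c t) ^+ 2) ^+ 2;
  flat_kernel : forall z z', normc (\sum_t (w t)^*%C * (r t z * (r t z')^*%C)) <=
    eta * #|I|%:R }.

(** The quadratic phases [psi (x t + y t^2)] on the plane over a prime field,
    weighted by cubic phases. The fourth moments are controlled since the points
    [(t, t^2)] of the parabola have distinct pairwise sums. *)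
Lemma flat_system_exists (R : realType) (eta : R) : 0 < eta ->
  exists (I Z : finType) (r : I -> Z -> R[i]) (w : I -> R[i]),
    [/\ (0 < #|I|)%N, (0 < #|Z|)%N & flat_system r w eta].
Proof.
(* [2 * p * sqrt p <= (eta * p) ^ 2] as soon as [4 / eta ^ 4 <= p] *)
move=> eta0; have [p pb pp] := prime_above (3 + Num.bound (4 / eta ^+ 4)).
have p3 : (3 < p)%N by apply: leq_ltn_trans pb; rewrite leq_addr.
have peta : 4 <= eta ^+ 4 * p%:R :> R.
  rewrite mulrC -ler_pdivrMr ?exprn_gt0//.
  have /ltW h := @archi_boundP R (4 / eta ^+ 4) (divr_ge0 (ler0n _ 4) (ltW (exprn_gt0 4 eta0))).
  apply: le_trans h _; rewrite ler_nat; apply: leq_trans (ltnW pb); exact: leq_addl.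
have [psi psiC] := @add_character_exists R p pp.
have [psiD psiN psi1 _] := psiC.
pose r (t : 'F_p) (z : 'F_p * 'F_p) := psi (z.1 * t + z.2 * t ^+ 2).
pose w (t : 'F_p) := psi (t ^+ 3).
have cardF : #|'F_p| = p by exact: card_Fp.
have cardZ : #|{: 'F_p * 'F_p}| = (p ^ 2)%N by rewrite card_prod cardF.
exists ('F_p : finType), ('F_p * 'F_p : finType)%type, r, w; split.
- by rewrite cardF prime_gt0.
- by rewrite cardZ expn_gt0 prime_gt0.
split => //.
- by move=> t z; exact: psi1.
- by move=> t; exact: psi1.
- move=> s t; rewrite (eq_bigr (fun z : 'F_p * 'F_p => psi (z.1 * (s - t) + z.2 * (s ^+ 2 - t ^+ 2)))); last first.
    by move=> z _; rewrite /r -psiN -psiD; congr psi; ring.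
  rewrite (sum_character2 pp psiC) subr_eq0; case: eqVneq => [->|//].
  by rewrite subrr eqxx cardZ.
- move=> c; pose S := ('F_p * 'F_p)%type.
  pose d (s : S) := c s.1 * c s.2.
  pose chi_ (s : S) (z : 'F_p * 'F_p) := r s.1 z * r s.2 z.
  pose G (s s' : S) := (s' == s) || (s' == (s.2, s.1)).
  have E z : normc (\sum_t c t * r t z) ^+ 4 = normc (\sum_s d s * chi_ s z) ^+ 2.
    rewrite (exprM _ 2 2) -normcX; congr (normc _ ^+ 2); rewrite expr2.
    rewrite big_distrlr /= pair_bigA; apply: eq_bigr => s _; exact: mulrACA.
  under eq_bigr do rewrite E.
  have chiE s s' : \sum_z chi_ s z * (chi_ s' z)^*%C =
      if (s.1 + s.2 - (s'.1 + s'.2) == 0) &&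
         (s.1 ^+ 2 + s.2 ^+ 2 - (s'.1 ^+ 2 + s'.2 ^+ 2) == 0) then (p ^ 2)%:R else 0.
    rewrite -(sum_character2 pp psiC); apply: eq_bigr => z _.
    by rewrite /chi_ /r -!psiD -psiN -psiD; congr psi; ring.
  have GN s s' : G s s' -> normc (\sum_z chi_ s z * (chi_ s' z)^*%C) <= (p ^ 2)%:R.
    move=> _; rewrite chiE; case: ifP => _; last by rewrite normc0.
    have -> : ((p ^ 2)%:R : R[i]) = Complex (p ^ 2)%:R 0 by rewrite -(rmorph_nat (real_complex R)).
    by rewrite normc_real.
  have G0 s s' : ~~ G s s' -> \sum_z chi_ s z * (chi_ s' z)^*%C = 0.
    move=> nG; rewrite chiE; case: ifP => // /andP[/eqP e1 /eqP e2]; case/negP: nG.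
    case: s s' e1 e2 => [t1 t3] [t2 t4] /= e1 e2.
    have nz2 : (2%:R : 'F_p) != 0.
      by rewrite -(dvdn_pcharf (pchar_Fp pp)) gtnNdvd// (ltn_trans _ p3).
    (* equal sums and equal sums of squares force equal pairs *)
    have : 2%:R * ((t1 - t2) * (t1 - t4)) = 0.
      have -> : 2%:R * ((t1 - t2) * (t1 - t4)) =
        (t1 ^+ 2 + t3 ^+ 2 - (t2 ^+ 2 + t4 ^+ 2)) + (t1 + t3 - (t2 + t4)) * (t1 - t3 - (t2 + t4)) by ring.
      by rewrite e1 e2 mul0r addr0.
    move/eqP; rewrite !mulf_eq0 (negbTE nz2)/= !subr_eq0 /G => /orP[/eqP e|/eqP e]; subst t1.
      by apply/orP; left; move: e1; rewrite opprD addrACA subrr add0r => /subr0_eq ->.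
    apply/orP; right; move: e1; rewrite (addrC t2) opprD addrACA subrr add0r => /subr0_eq ->.
    by [].
  apply: le_trans (gram_bound d GN G0) _; rewrite cardZ [2 * _]mulrC -mulrA ler_wpM2l//.
  have -> : (\sum_t normc (c t) ^+ 2) ^+ 2 = \sum_s normc (d s) ^+ 2.
    rewrite expr2 big_distrlr /= pair_bigA; apply: eq_bigr => s _.
    by rewrite normcM exprMn.
  rewrite mulr_sumr; apply: ler_sum => s _; rewrite -mulr_sumr.
  have dsw : normc (d (s.2, s.1)) = normc (d s) by rewrite /d !normcM mulrC.
  rewrite expr2 [leRHS]mulrCA ler_wpM2l ?normc_ge0// mulrDl !mul1r -{2}dsw.
  have [es|es] := eqVneq (s.2, s.1) s.
    rewrite (eq_bigl (pred1 s)) ?big_pred1_eq ?lerDl ?normc_ge0//.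
    by move=> s'; rewrite /G es orbb.
  rewrite (bigD1 s) ?/G ?eqxx//= (bigD1 (s.2, s.1)) ?eqxx ?orbT//= big1 ?addr0//.
  by move=> s' /andP[/andP[/orP[->//|->]]]; rewrite ?andbF.
- move=> z z'.
  rewrite (eq_bigr (fun t : 'F_p => psi ((-1) * t ^+ 3 + (z.2 - z'.2) * t ^+ 2 + (z.1 - z'.1) * t))); last first.
    by move=> t _; rewrite /w /r -!psiN -!psiD; congr psi; ring.
  have n1 : (-1 : 'F_p) != 0 by rewrite oppr_eq0 oner_eq0.
  have := cubic_sum pp p3 psiC (z.2 - z'.2) (z.1 - z'.1) n1 => H.
  have q0 : 0 < (p%:R : R) by rewrite ltr0n prime_gt0.
  rewrite cardF -ler_sqr ?nnegrE ?normc_ge0 ?mulr_ge0 ?(ltW eta0) ?(ltW q0)//.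
  apply: le_trans H _; rewrite exprMn.
  have -> : 2 * p%:R * Num.sqrt p%:R = (2 * Num.sqrt p%:R) * p%:R :> R by rewrite mulrAC.
  rewrite [X in _ <= _ * X]expr2 mulrA ler_wpM2r ?(ltW q0)//.
  rewrite -{2}[p%:R](sqr_sqrtr (ltW q0)) [X in _ <= _ * X]expr2 mulrA ler_wpM2r ?sqrtr_ge0//.
  have : 2 ^+ 2 <= (eta ^+ 2 * Num.sqrt p%:R) ^+ 2.
    by rewrite exprMn (sqr_sqrtr (ltW q0)) -exprM; lra.
  by rewrite ler_sqr ?nnegrE// mulr_ge0 ?sqr_ge0 ?sqrtr_ge0.
Qed.

(** * Choice of signs and finite sums *)

Section FiniteSums.
Context {R : realType}.

Lemma sum_sqr_le (I : finType) (P : pred I) (x : I -> R) :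
  (\sum_(i | P i) x i) ^+ 2 <= #|P|%:R * \sum_(i | P i) x i ^+ 2.
Proof.
rewrite expr2 big_distrlr /=.
apply: (@le_trans _ _ (\sum_(i | P i) \sum_(j | P j) (x i ^+ 2 / 2 + x j ^+ 2 / 2))).
  apply: ler_sum => i _; apply: ler_sum => j _.
  by have := sqr_ge0 (x i - x j); lra.
rewrite le_eqVlt; apply/orP; left; apply/eqP.
transitivity (\sum_(i | P i) (\sum_(j | P j) x i ^+ 2 / 2 + \sum_(j | P j) x j ^+ 2 / 2)).
  by apply: eq_bigr => i _; rewrite big_split.
rewrite big_split /= sumr_const.
under eq_bigr do rewrite sumr_const.
rewrite sumrMnl -mulr_suml -[X in X + _]mulr_natl -[X in _ + X]mulr_natl.
by rewrite -mulrDr -splitr.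
Qed.

Lemma uniform_index (I : finType) (P : I -> nat -> Prop) :
  (forall i, exists J, forall J', (J <= J')%N -> P i J') -> exists J, forall i, P i J.
Proof.
move=> /choice[f Hf]; exists (\max_i f i) => i; apply: Hf; exact: leq_bigmax.
Qed.

(** The other half of the parallelogram law: signs can be chosen so that all the
    sums together have at most the total mass of their terms. *)
Lemma signs_small (L V : finType) (z : L -> V -> R[i]) :
  exists theta : {ffun V -> bool},
    \sum_l normc (\sum_v sg (theta v) * z l v) ^+ 2 <= \sum_l \sum_v normc (z l v) ^+ 2.
Proof.
suff [th Hth] : exists th : V -> bool,
    \sum_l normc (\sum_(v <- enum V) sg (th v) * z l v) ^+ 2 <=
    \sum_l \sum_(v <- enum V) normc (z l v) ^+ 2.
  exists [ffun v => th v].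
  under eq_bigr do (rewrite -big_enum/=; under eq_bigr do rewrite ffunE).
  by under [leRHS]eq_bigr do rewrite -big_enum/=.
elim: (enum V) (enum_uniq V) => [_|v s IH /= /andP[vs us]].
  by exists (fun=> true); apply: ler_sum => l _; rewrite !big_nil normc0 expr0n.
have {IH us} [th IH] := IH us.
pose w l := \sum_(v <- s) sg (th v) * z l v.
have [b Hb] : exists b, \sum_l normc (sg b * z l v + w l) ^+ 2 <=
    \sum_l (normc (z l v) ^+ 2 + normc (w l) ^+ 2).
  pose A b := \sum_l normc (sg b * z l v + w l) ^+ 2.
  have E : A true + A false = 2 * \sum_l (normc (z l v) ^+ 2 + normc (w l) ^+ 2).
    rewrite /A -big_split mulr_sumr; apply: eq_bigr => l _.
    rewrite mul1r mulN1r !sqr_normcE; case: (z l v) (w l) => [p q] [p' q'] /=; ring.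
  have [h|h] := leP (A true) (\sum_l (normc (z l v) ^+ 2 + normc (w l) ^+ 2)).
    by exists true.
  by exists false; rewrite -/(A false); lra.
exists (fun u => if u == v then b else th u).
under eq_bigr => l _.
  rewrite big_cons eqxx.
  rewrite (_ : \sum_(j <- s) _ = w l); last first.
    rewrite /w !big_seq; apply: eq_bigr => u us.
    by case: eqVneq us vs => [->->|].
  over.
apply: le_trans Hb _; under [leRHS]eq_bigr do rewrite big_cons.
by rewrite !big_split /= lerD2l.
Qed.

(** Schur's test for a sparse set of pairs, with a weight [lambda] to balance the
    two families. *)
Lemma sparse_sum_le (J : nat) (S : rel 'I_J) (K lambda : R) (x y : 'I_J -> R) :
  0 < lambda ->
  (forall i, #|[pred j | S i j]|%:R <= K) -> (forall j, #|[pred i | S i j]|%:R <= K) ->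
  \sum_i \sum_(j | S i j) x i * y j <=
    K / 2 * (lambda * \sum_i x i ^+ 2 + lambda^-1 * \sum_j y j ^+ 2).
Proof.
move=> l0 HR HC.
apply: (@le_trans _ _ (\sum_i \sum_(j | S i j) (lambda / 2 * x i ^+ 2 + lambda^-1 / 2 * y j ^+ 2))).
  apply: ler_sum => i _; apply: ler_sum => j _; rewrite -subr_ge0.
  have -> : lambda / 2 * x i ^+ 2 + lambda^-1 / 2 * y j ^+ 2 - x i * y j =
      lambda^-1 / 2 * (lambda * x i - y j) ^+ 2 by field; rewrite gt_eqF.
  by rewrite mulr_ge0 ?sqr_ge0// mulr_ge0// invr_ge0 ltW.
under eq_bigr do rewrite big_split /=.
have -> (X Y : R) : K / 2 * (lambda * X + lambda^-1 * Y) =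
   lambda / 2 * (K * X) + lambda^-1 / 2 * (K * Y) by field; rewrite gt_eqF.
have li : 0 < lambda^-1 by rewrite invr_gt0.
rewrite big_split /=; apply: lerD.
  rewrite 2!mulr_sumr; apply: ler_sum => i _; rewrite sumr_const -[leLHS]mulr_natl.
  rewrite mulrCA ler_wpM2l ?divr_ge0 ?(ltW l0)//.
  by rewrite ler_wpM2r ?sqr_ge0//; exact: HR.
rewrite (exchange_big_dep xpredT)//= 2!mulr_sumr; apply: ler_sum => j _.
rewrite sumr_const -[leLHS]mulr_natl mulrCA ler_wpM2l ?divr_ge0 ?(ltW li)//.
by rewrite ler_wpM2r ?sqr_ge0//; exact: HC.
Qed.

End FiniteSums.

(** The enumeration of [V] is reduced modulo [#|Z|], after an incomplete last
    period has been dropped. *)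
Lemma equal_fibers (V Z : finType) : (0 < #|Z|)%N -> (#|Z| <= #|V|)%N ->
  exists (Y : {set V}) (pi_ : V -> Z) (q : nat),
    [/\ #|Y| = (q * #|Z|)%N, (#|V| <= 2 * #|Y|)%N &
      forall (M : nmodType) (F : Z -> M), \sum_(v in Y) F (pi_ v) = (\sum_z F z) *+ q].
Proof.
move=> Z0 ZV; set z := #|Z| in Z0 ZV *; set N := #|V| in ZV *.
pose q := (N %/ z)%N.
have qN : (q * z <= N)%N by exact: leq_trunc_div.
have zi (v : V) : (enum_rank v %% z < z)%N by rewrite ltn_mod.
pose pi_ v := enum_val (Ordinal (zi v)).
pose Y := [set v : V | (enum_rank v < q * z)%N]%SET.
have fib (M : nmodType) (F : Z -> M) : \sum_(v in Y) F (pi_ v) = (\sum_z F z) *+ q.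
  pose G (j : nat) : M := if insub j is Some o then F (enum_val (o : 'I_z)) else 0.
  have Gv v : F (pi_ v) = G (enum_rank v %% z)%N by rewrite /G (insubT (fun j => (j < z)%N) (zi v)).
  have GZ : \sum_(j < z) G j = \sum_z F z.
    rewrite [RHS](reindex (fun j : 'I_z => enum_val j)) /=; last exact/onW_bij/enum_val_bij.
    apply: eq_bigr => j _.
    by rewrite /G valK.
  rewrite -GZ; transitivity (\sum_(i < N | (i < q * z)%N) G (i %% z)%N).
    rewrite (reindex (@enum_rank V)) /=; last exact/onW_bij/enum_rank_bij.
    by apply: eq_big => v; [rewrite finset.inE|move=> _; rewrite Gv].
  rewrite (big_ord_narrow qN) /=.
  elim: q {qN Y} => [|q IH]; first by rewrite mul0n big_ord0 mulr0n.
  rewrite mulrSr -IH -!(big_mkord xpredT (fun i => G (i %% z)%N)) -(big_mkord xpredT G).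
  have le : (q * z <= q.+1 * z)%N by rewrite leq_mul2r leqnSn orbT.
  rewrite (big_cat_nat (leq0n _) le)/=; congr (_ + _).
  rewrite -{1}[(q * z)%N]add0n big_addn mulSn addnK.
  by apply: eq_big_nat => i /andP[_ iz]; rewrite addnC modnMDl modn_small.
have cY : #|Y| = (q * z)%N.
  have mn (a b : nat) : a *+ b = (b * a)%N by elim: b => // b IH; rewrite mulrS IH mulSn.
  by have := fib nat (fun=> 1%N); rewrite sum1_card mn sum1_card.
exists Y, pi_, q; split => //.
rewrite cY {1}(divn_eq N z) -/q mul2n -addnn leq_add2l.
have q1 : (0 < q)%N by rewrite divn_gt0.
by apply: (@leq_trans z); [rewrite ltnW// ltn_mod|rewrite leq_pmull].
Qed.

(** * Delocalized operators on a block *)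

Lemma l2_scaleE (R : realType) (T : choiceType) (c : R[i]) (u : l2 R T) x :
  (c *: u) x = c * u x.
Proof. by []. Qed.

Lemma sum_only1 (M : nmodType) (I : finType) (F : I -> M) i :
  (forall j, j != i -> F j = 0) -> \sum_j F j = F i.
Proof. by move=> F0; rewrite (bigD1 i)//= big1 ?addr0. Qed.

Section Embedding.
Context {R : realType} {T : choiceType} {V : finType} (iota : V -> T).
Hypothesis iota_inj : injective iota.
Implicit Types (f g : V -> R[i]) (u v : l2 R T).

Definition embed f : l2 R T := \sum_z f z *: delta (iota z).

Lemma embedE f z : embed f (iota z) = f z.
Proof.
rewrite l2_sumE (sum_only1 (i := z)) => [|y yz].
  by rewrite l2_scaleE deltaE eqxx mulr1.
by rewrite l2_scaleE deltaE (inj_eq iota_inj) eq_sym (negbTE yz) mulr0.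
Qed.

Lemma embed_out f x : ~ range iota x -> embed f x = 0.
Proof.
move=> nx; rewrite l2_sumE big1// => z _; rewrite l2_scaleE deltaE.
by case: eqVneq => [xz|_]; [case: nx; exists z|rewrite mulr0].
Qed.

Lemma inner_embed u f : inner u (embed f) = \sum_z u (iota z) * (f z)^*%C.
Proof.
by rewrite inner_sumZr; apply: eq_bigr => z _; rewrite inner_deltar mulrC.
Qed.

Lemma sqnorm_embed f : sqnorm (embed f) = \sum_z normc (f z) ^+ 2.
Proof.
have := sqnorm_inner (embed f); rewrite inner_embed.
rewrite (eq_bigr (fun z => Complex (normc (f z) ^+ 2) 0)); last first.
  by move=> z _; rewrite embedE mulcJ_eq.
have -> : \sum_z Complex (normc (f z) ^+ 2) 0 = Complex (\sum_z normc (f z) ^+ 2) 0.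
  by elim/big_ind2 : _ => // [x1 y1 x2 y2 -> ->]; rewrite complexDE addr0.
by case.
Qed.

Lemma chi_embed (A : set T) f :
  chi A (embed f) = embed (fun z => if `[< A (iota z) >] then f z else 0).
Proof.
apply/l2P => x; rewrite chiE.
have [[z _ <-]|nx] := pselect (range iota x); last by rewrite !embed_out// if_same.
by rewrite !embedE; congr (if _ then _ else _).
Qed.

Lemma chi_range_embed f : chi (range iota) (embed f) = embed f.
Proof.
apply/l2P => x; rewrite chiE; case: ifPn => // nx; rewrite embed_out// => h.
by move/negP: nx; apply; exact: mem_set.
Qed.

Lemma embed_comb (I : finType) (c : I -> R[i]) (g : I -> V -> R[i]) :
  \sum_t c t *: embed (g t) = embed (fun z => \sum_t c t * g t z).
Proof.
apply/l2P => x; rewrite l2_sumE; under eq_bigr do rewrite l2_scaleE.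
have [[z _ <-]|nx] := pselect (range iota x).
  by rewrite embedE; apply: eq_bigr => t _; rewrite embedE.
by rewrite embed_out// big1// => t _; rewrite embed_out// mulr0.
Qed.

End Embedding.

Lemma le_of_sqr_le (R : realType) (x c : R) : 0 <= x -> 0 <= c -> x ^+ 2 <= c * x -> x <= c.
Proof.
move=> x0 c0; have [->//|nz] := eqVneq x 0.
by rewrite expr2 ler_pM2r// lt_def nz.
Qed.

(** On an expander this forces quasi-locality, for two distant sets cannot both
    have positive density. *)
Record delocalized (R : realType) (T : choiceType) (V : finType) (iota : V -> T)
    (a : bop R T) : Prop := Delocalized {
  deloc_range : forall v, chi (range iota) (a v) = a v;
  deloc_contraction : forall v, sqnorm (a v) <= sqnorm (chi (range iota) v);
  deloc_out : forall (A : set T) (delta : R), 0 <= delta ->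
    #|[set z | `[< A (iota z) >]]%SET|%:R <= delta * #|V|%:R ->
    forall v, sqnorm (chi A (a v)) <= 2 * Num.sqrt delta * sqnorm v;
  deloc_in : forall (A : set T) (delta : R), 0 <= delta ->
    #|[set z | `[< A (iota z) >]]%SET|%:R <= delta * #|V|%:R ->
    forall v, sqnorm (a (chi A v)) <= 2 * Num.sqrt delta * sqnorm v }.

(** A flat system transported to the points of [V], up to a remainder on which
    the functions vanish; [y] is the number of points where they do not. *)
Record spread_system (R : realType) (I V : finType) (g : I -> V -> R[i])
    (w : I -> R[i]) (eta y : R) : Prop := SpreadSystem {
  spread_gt0 : 0 < y;
  spread_card : #|V|%:R <= 2 * y;
  spread_weight : forall t, normc (w t) = 1;
  spread_mass : forall t, \sum_v normc (g t v) ^+ 2 = y;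
  spread_orth : forall s t, \sum_v g s v * (g t v)^*%C = if s == t then Complex y 0 else 0;
  spread_fourth : forall c : I -> R[i], \sum_v normc (\sum_t c t * g t v) ^+ 4 <=
    2 * y * (\sum_t normc (c t) ^+ 2) ^+ 2;
  spread_kernel : forall v v', normc (\sum_t (w t)^*%C * (g t v * (g t v')^*%C)) <=
    eta * #|I|%:R }.

Lemma sg_sqr (R : realType) b : sg b * (sg b)^*%C = 1 :> R[i].
Proof. by case: b; rewrite /sg ?rmorphN rmorph1 ?mulrNN mulr1. Qed.

Lemma normc_sg (R : realType) b : normc (sg b : R[i]) = 1.
Proof. by case: b; rewrite /sg ?normc_opp normc1. Qed.

(** Arbitrary signs [theta] are allowed since they do not affect moduli and inner
    products. *)
Lemma spread_system_exists (R : realType) (I Z V : finType) (r : I -> Z -> R[i])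
    (w : I -> R[i]) (eta : R) : 0 <= eta -> (0 < #|Z|)%N -> (#|Z| <= #|V|)%N ->
  flat_system r w eta ->
  exists (g : I -> V -> R[i]) (y : R),
    forall theta : V -> bool, spread_system (fun t v => sg (theta v) * g t v) w eta y.
Proof.
move=> eta0 Z0 ZV [r1 w1 r_orth r4 rk].
have [Y [pi_ [q [cY VY fib]]]] := equal_fibers Z0 ZV.
pose g t v := if v \in Y then r t (pi_ v) else 0.
exists g, #|Y|%:R => theta.
have onY (M : nmodType) (F : Z -> M) (h : V -> M) :
    (forall v, h v = if v \in Y then F (pi_ v) else 0) -> \sum_v h v = (\sum_z F z) *+ q.
  by move=> H; under eq_bigr do rewrite H; rewrite -big_mkcond fib.
have Y0 : (0 < #|Y|)%N.
  by move: (#|Y|) (#|V|) (#|Z|) VY ZV Z0 => *; lia.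
have mass t : \sum_v normc (sg (theta v) * g t v) ^+ 2 = #|Y|%:R.
  rewrite (onY _ (fun=> 1)); first by rewrite sumr_const cY mulnC natrM mulr_natr.
  move=> v; rewrite normcM normc_sg mul1r /g; case: ifP; rewrite ?r1 ?normc0 ?expr0n//.
  by rewrite expr1n.
split => //.
- by rewrite ltr0n.
- by rewrite -natrM ler_nat.
- move=> s t; have -> : (if s == t then Complex #|Y|%:R 0 else 0 : R[i]) =
      (if s == t then #|Z|%:R else 0) *+ q.
    case: eqP => _; last by rewrite mul0rn.
    by rewrite cY mulnC -mulrnA -(rmorph_nat (real_complex R)).
  rewrite -r_orth; apply: onY => v; rewrite rmorphM mulrACA sg_sqr mul1r /g.
  by case: ifP => _; rewrite ?mul0r.
- move=> c; rewrite (onY _ (fun z => normc (\sum_t c t * r t z) ^+ 4)); last first.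
    move=> v; rewrite (eq_bigr (fun t => sg (theta v) * (c t * g t v))); last first.
      by move=> t _; rewrite mulrCA.
    rewrite -mulr_sumr normcM normc_sg mul1r /g; case: ifP => // _.
    by rewrite big1 ?normc0 ?expr0n// => t _; rewrite mulr0.
  rewrite cY mulnC natrM -[leLHS]mulr_natr mulrA [leRHS]mulrAC ler_wpM2r//; exact: r4.
- move=> v v'; rewrite /g.
  have [vY|_] := boolP (v \in Y); last first.
    rewrite big1 ?normc0 ?mulr_ge0// => t _; by rewrite mulr0 mul0r mulr0.
  have [vY'|_] := boolP (v' \in Y); last first.
    rewrite big1 ?normc0 ?mulr_ge0// => t _; by rewrite mulr0 conjc0 !mulr0.
  rewrite (eq_bigr (fun t => sg (theta v) * (sg (theta v'))^*%C *
     ((w t)^*%C * (r t (pi_ v) * (r t (pi_ v'))^*%C)))); last first.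
    have swap (a b c d f : R[i]) : a * (b * c * (d * f)) = b * d * (a * (c * f)) by ring.
    by move=> t _; rewrite rmorphM; exact: swap.
  by rewrite -mulr_sumr !normcM normcJ_eq !normc_sg !mul1r.
Qed.

Section SpreadOperator.
Context {R : realType} {T : choiceType} {I V : finType} (iota : V -> T).
Hypothesis iota_inj : injective iota.
Context (g : I -> V -> R[i]) (w : I -> R[i]) (eta y : R).
Hypothesis gS : spread_system g w eta y.
Implicit Types (u v : l2 R T).

Let y0 : 0 < y := spread_gt0 gS.
Let rr (t : I) : l2 R T := embed iota (g t).

(** On the span of the mutually orthogonal vectors [rr t], of squared norm [y],
    this is the diagonal operator with eigenvalues [w t]; it vanishes on the
    orthogonal complement. *)
Definition spread_op : bop R T :=
  \sum_t (w t * Complex y^-1 0) *: outer (rr t) (rr t).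

Lemma spread_opE u : spread_op u = \sum_t (w t * Complex y^-1 0 * inner u (rr t)) *: rr t.
Proof.
rewrite /spread_op; transitivity (\sum_t ((w t * Complex y^-1 0) *: outer (rr t) (rr t)) u).
  by elim/big_ind2 : _ => // a1 u1 a2 u2 <- <-.
by apply: eq_bigr => t _; rewrite bopZE outerE scalerA.
Qed.

Lemma inner_spread s t : inner (rr s) (rr t) = if s == t then Complex y 0 else 0.
Proof.
rewrite inner_embed -(spread_orth gS s t); apply: eq_bigr => v _.
by rewrite embedE.
Qed.

Lemma sqnorm_spread t : sqnorm (rr t) = y.
Proof. by rewrite sqnorm_embed// (spread_mass gS). Qed.

Lemma spread_eigen t : spread_op (rr t) = w t *: rr t.
Proof.
rewrite spread_opE (sum_only1 (i := t)) => [|s st].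
  rewrite inner_spread eqxx -mulrA complexME !mulr0 mul0r subr0 addr0 mulVf ?gt_eqF//.
  by rewrite mulr1.
by rewrite inner_spread eq_sym (negbTE st) mulr0 scale0r.
Qed.

Lemma sqnorm_spread_comb (c : I -> R[i]) :
  sqnorm (\sum_t c t *: rr t) = y * \sum_t normc (c t) ^+ 2.
Proof.
have := sqnorm_inner (\sum_t c t *: rr t); rewrite inner_sumZr.
rewrite (eq_bigr (fun t => Complex (y * normc (c t) ^+ 2) 0)); last first.
  move=> t _; rewrite inner_sumZl (sum_only1 (i := t)) => [|s st].
    rewrite inner_spread eqxx mulrA mulrC [_ * c t]mulrC mulcJ_eq complexME.
    by rewrite !mulr0 !mul0r subr0 addr0.
  by rewrite inner_spread (negbTE st) mulr0.
have -> : \sum_t Complex (y * normc (c t) ^+ 2) 0 = Complex (\sum_t y * normc (c t) ^+ 2) 0.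
  by elim/big_ind2 : _ => // [x1 y1 x2 y2 -> ->]; rewrite complexDE addr0.
by move=> [<-]; rewrite mulr_sumr.
Qed.

Let density (A : set T) (delta : R) :=
  #|[set z | `[< A (iota z) >]]%SET|%:R <= delta * #|V|%:R.

(** Cauchy-Schwarz on the set and the bound on fourth moments. *)
Lemma sqnorm_chi_spread (A : set T) (delta : R) (c : I -> R[i]) : 0 <= delta ->
  density A delta ->
  sqnorm (chi A (\sum_t c t *: rr t)) <= 2 * Num.sqrt delta * y * \sum_t normc (c t) ^+ 2.
Proof.
move=> d0 Ad; rewrite embed_comb// chi_embed// sqnorm_embed//.
set f := fun z => \sum_t c t * g t z; set S := \sum_t normc (c t) ^+ 2.
have S0 : 0 <= S by rewrite sumr_ge0// => *; rewrite sqr_ge0.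
have RHS0 : 0 <= 2 * Num.sqrt delta * y * S.
  by rewrite !mulr_ge0 ?sqrtr_ge0// ltW.
rewrite -ler_sqr ?nnegrE//; last by rewrite sumr_ge0// => *; rewrite sqr_ge0.
pose P := [pred z : V | `[< A (iota z) >]].
rewrite (eq_bigr (fun z => if P z then normc (f z) ^+ 2 else 0)); last first.
  by move=> z _ /=; case: ifP; rewrite ?normc0 ?expr0n.
rewrite -big_mkcond; apply: le_trans (sum_sqr_le _ _) _.
have cP : #|P|%:R <= delta * (2 * y).
  apply: le_trans (_ : delta * #|V|%:R <= _); last by rewrite ler_wpM2l ?(spread_card gS).
  apply: le_trans Ad; rewrite ler_nat; apply: eq_leq; apply: eq_card => z.
  by rewrite finset.inE.
have f4 : \sum_(z | P z) (normc (f z) ^+ 2) ^+ 2 <= 2 * y * S ^+ 2.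
  apply: le_trans (spread_fourth gS c); rewrite big_mkcond; apply: ler_sum => z _.
  by rewrite -exprM; case: ifP => // _; rewrite exprn_ge0 ?normc_ge0.
have sd : Num.sqrt delta ^+ 2 = delta by rewrite sqr_sqrtr.
apply: (@le_trans _ _ (delta * (2 * y) * (2 * y * S ^+ 2))).
  by apply: ler_pM => //; rewrite sumr_ge0// => *; rewrite sqr_ge0.
move: sd; move: (Num.sqrt delta) => s <-.
by rewrite le_eqVlt; apply/orP; left; apply/eqP; ring.
Qed.

(** The adjoint form of the preceding estimate. *)
Lemma bessel_spread_chi (B : set T) (delta : R) u : 0 <= delta -> density B delta ->
  \sum_t normc (inner (chi B u) (rr t)) ^+ 2 <= 2 * Num.sqrt delta * y * sqnorm u.
Proof.
move=> d0 Bd; pose d t := inner (chi B u) (rr t).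
have D0 : 0 <= \sum_t normc (d t) ^+ 2 by rewrite sumr_ge0// => *; rewrite sqr_ge0.
apply: le_of_sqr_le => //; first by rewrite !mulr_ge0 ?sqrtr_ge0 ?sqnorm_ge0// ltW.
have E : inner u (chi B (\sum_t d t *: rr t)) = Complex (\sum_t normc (d t) ^+ 2) 0.
  rewrite -inner_chi inner_sumZr (eq_bigr (fun t => Complex (normc (d t) ^+ 2) 0)).
    by elim/big_ind2 : _ => // [x1 y1 x2 y2 -> ->]; rewrite complexDE addr0.
  by move=> t _; rewrite mulrC mulcJ_eq.
have := cauchy_schwarz u (chi B (\sum_t d t *: rr t)); rewrite E normc_real// => H.
apply: le_trans H _; rewrite [leRHS]mulrAC [leRHS]mulrC ler_wpM2l ?sqnorm_ge0//.
exact: sqnorm_chi_spread.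
Qed.

Lemma bessel_spread u : \sum_t normc (inner u (rr t)) ^+ 2 <= y * sqnorm u.
Proof.
pose d t := inner u (rr t).
have D0 : 0 <= \sum_t normc (d t) ^+ 2 by rewrite sumr_ge0// => *; rewrite sqr_ge0.
apply: le_of_sqr_le => //; first by rewrite mulr_ge0 ?sqnorm_ge0// ltW.
have E : inner u (\sum_t d t *: rr t) = Complex (\sum_t normc (d t) ^+ 2) 0.
  rewrite inner_sumZr (eq_bigr (fun t => Complex (normc (d t) ^+ 2) 0)).
    by elim/big_ind2 : _ => // [x1 y1 x2 y2 -> ->]; rewrite complexDE addr0.
  by move=> t _; rewrite mulrC mulcJ_eq.
have := cauchy_schwarz u (\sum_t d t *: rr t); rewrite E normc_real// => H.
apply: le_trans H _; rewrite sqnorm_spread_comb mulrCA mulrA.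
by rewrite le_eqVlt; apply/orP; left; apply/eqP; ring.
Qed.

Lemma spread_op_delocalized : delocalized iota spread_op.
Proof.
have wd u t : normc (w t * Complex y^-1 0 * inner u (rr t)) ^+ 2 =
    y^-1 ^+ 2 * normc (inner u (rr t)) ^+ 2.
  by rewrite !normcM (spread_weight gS) mul1r normc_real ?exprMn// invr_ge0 ltW.
have aE u : sqnorm (spread_op u) = y^-1 * \sum_t normc (inner u (rr t)) ^+ 2.
  rewrite spread_opE sqnorm_spread_comb; under eq_bigr do rewrite wd.
  by rewrite -mulr_sumr mulrA expr2 mulrA mulfV ?mul1r// gt_eqF.
have inner_range u t : inner u (rr t) = inner (chi (range iota) u) (rr t).
  by rewrite inner_chi chi_range_embed.
have yi : 0 < y^-1 by rewrite invr_gt0.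
split.
- move=> v; rewrite spread_opE bop_sumr; apply: eq_bigr => t _.
  by rewrite bopZr chi_range_embed.
- move=> v; rewrite aE; under eq_bigr do rewrite inner_range.
  rewrite mulrC ler_pdivrMr// mulrC; exact: bessel_spread.
- move=> A delta d0 Ad v; rewrite spread_opE.
  apply: le_trans (sqnorm_chi_spread _ d0 Ad) _; under eq_bigr do rewrite wd.
  rewrite -mulr_sumr -!mulrA 2?ler_wpM2l ?sqrtr_ge0//.
  rewrite mulVKf ?gt_eqF// mulrC ler_pdivrMr// mulrC.
  exact: bessel_spread.
- move=> A delta d0 Ad v; rewrite aE mulrC ler_pdivrMr// [leRHS]mulrAC.
  exact: bessel_spread_chi.
Qed.

End SpreadOperator.

(** * The trace of a flat operator against a sparse one *)

Lemma card_ord_pred_le (J : nat) (P : pred 'I_J) (s : seq nat) :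
  (forall j, P j -> (j : nat) \in s) -> (#|P| <= size s)%N.
Proof.
move=> H; rewrite cardE -(size_map (@nat_of_ord J)); apply: uniq_leq_size.
  by rewrite map_inj_uniq ?enum_uniq//; exact: val_inj.
by move=> _ /mapP[j + ->]; rewrite mem_enum => /H.
Qed.

Section TraceEstimate.
Context {R : realType} {T : choiceType} (xi : nat -> l2 R T).
Hypothesis xi_onb : onb xi.
Context {I V : finType} (iota : V -> T).
Hypothesis iota_inj : injective iota.
Context (g : I -> V -> R[i]) (w : I -> R[i]) (eta y : R).
Hypothesis gS : spread_system g w eta y.
Hypothesis eta0 : 0 <= eta.
Context (J : nat) (c : R).
Hypothesis c0 : 0 < c.

Let m : R := #|I|%:R.
Let y0 : 0 < y := spread_gt0 gS.
Let rr (t : I) : l2 R T := embed iota (g t).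
Let rho t (i : nat) := inner (rr t) (xi i).
Let big_part (i : nat) z := if normc (xi i (iota z)) < c then 0 else xi i (iota z).
Let small_part (i : nat) z := if normc (xi i (iota z)) < c then xi i (iota z) else 0.
Let sigma t i := \sum_z g t z * (big_part i z)^*%C.
Let tau t i := \sum_z g t z * (small_part i z)^*%C.

Let rhoE t i : rho t i = sigma t i + tau t i.
Proof.
rewrite /rho innerC inner_embed rmorph_sum -big_split /=; apply: eq_bigr => z _.
rewrite /big_part /small_part rmorphM /= conjcK mulrC.
by case: ifP => _; rewrite conjc0 mulr0 ?addr0 ?add0r.
Qed.

Let lam i := \sum_z normc (big_part i z).

Let big_part_le i z : normc (big_part i z) <= normc (xi i (iota z)) ^+ 2 / c.
Proof.
rewrite /big_part; case: ifPn => [_|]; first by rewrite normc0 divr_ge0 ?sqr_ge0// ltW.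
by rewrite -leNgt => h; rewrite ler_pdivlMr// expr2 ler_wpM2l ?normc_ge0.
Qed.

Let mass_le i : \sum_z normc (xi i (iota z)) ^+ 2 <= 1.
Proof.
rewrite -(sqnorm_onb xi_onb i) -big_enum /= -(big_map iota xpredT (fun x => normc (xi i x) ^+ 2)).
by apply: sums_le_sqnorm; rewrite map_inj_uniq ?enum_uniq.
Qed.

Let lam0 i : 0 <= lam i.
Proof. by rewrite sumr_ge0// => *; rewrite normc_ge0. Qed.

Let lam_le i : lam i <= (\sum_z normc (xi i (iota z)) ^+ 2) / c.
Proof. by rewrite mulr_suml; apply: ler_sum => z _; exact: big_part_le. Qed.

Let sum_lam_sqr : \sum_(i < J) lam i ^+ 2 <= 2 * y / c ^+ 2.
Proof.
have lam1 i : lam i <= 1 / c.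
  by apply: le_trans (lam_le i) _; rewrite ler_wpM2r ?invr_ge0 ?(ltW c0).
apply: (@le_trans _ _ (\sum_(i < J) 1 / c * ((\sum_z normc (xi i (iota z)) ^+ 2) / c))).
  by apply: ler_sum => i _; rewrite expr2 ler_pM.
rewrite -mulr_sumr -mulr_suml exchange_big /=.
have : \sum_z \sum_(i < J) normc (xi i (iota z)) ^+ 2 <= 2 * y.
  apply: le_trans (spread_card gS); apply: (@le_trans _ _ (\sum_(z : V) 1)).
    by apply: ler_sum => z _; exact: bessel_pointwise.
  by rewrite sumr_const.
move: (\sum_z _) => s s2.
have -> : 1 / c * (s / c) = s / c ^+ 2 by field; rewrite gt_eqF.
by rewrite ler_wpM2r// invr_ge0 sqr_ge0.
Qed.

Let kernel_bound i j :
  normc (\sum_t (w t)^*%C * (sigma t i * (sigma t j)^*%C)) <= eta * m * (lam i * lam j).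
Proof.
have -> : \sum_t (w t)^*%C * (sigma t i * (sigma t j)^*%C) =
    \sum_z \sum_z' (big_part i z)^*%C * big_part j z' *
      \sum_t (w t)^*%C * (g t z * (g t z')^*%C).
  rewrite (eq_bigr (fun t => \sum_z \sum_z' (big_part i z)^*%C * big_part j z' *
      ((w t)^*%C * (g t z * (g t z')^*%C)))).
    rewrite exchange_big; apply: eq_bigr => z _; rewrite exchange_big.
    by apply: eq_bigr => z' _; rewrite -mulr_sumr.
  move=> t _; rewrite rmorph_sum big_distrlr mulr_sumr /=; apply: eq_bigr => z _.
  rewrite mulr_sumr; apply: eq_bigr => z' _; rewrite rmorphM /= conjcK.
  have swap (a b d f k : R[i]) : a * (b * d * (f * k)) = d * k * (a * (b * f)) by ring.
  exact: swap.
apply: le_trans (normc_sum _ _ _) _; rewrite /lam big_distrlr mulr_sumr /=.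
apply: ler_sum => z _; apply: le_trans (normc_sum _ _ _) _; rewrite mulr_sumr.
apply: ler_sum => z' _; rewrite !normcM normcJ_eq mulrC ler_wpM2r ?mulr_ge0 ?normc_ge0//.
exact: (spread_kernel gS).
Qed.

(** For the operator with eigenvalues [w t] on the vectors [rr t] instead of [a], the
    left-hand side would be about [m * y]. For a sparse [a] it is much smaller:
    the basis vectors are cut into large entries, on which the kernel is flat, and
    small entries [tau], which have little mass by assumption. *)
Lemma trace_estimate (K : nat) (e : R) (a : bop R T) :
  0 < e -> e <= 1 -> sparse xi K a -> (forall v, sqnorm (a v) <= 4 * sqnorm v) ->
  \sum_t \sum_(i < J) normc (tau t i) ^+ 2 <= e ^+ 2 * (m * y) ->
  normc (\sum_t (w t)^*%C * inner (a (partial_expansion xi J (rr t)))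
                                  (partial_expansion xi J (rr t))) <=
    (7 * K%:R * e + 4 * K%:R * eta / c ^+ 2) * (m * y).
Proof.
move=> e0 e1 sa aM tau_small; pose M := m * y.
have m0 : 0 <= m by exact: ler0n.
have M0 : 0 <= M by rewrite mulr_ge0// ltW.
pose alpha (i j : 'I_J) := inner (a (xi i)) (xi j).
pose S : rel 'I_J := fun i j => alpha i j != 0.
have SR i : #|[pred j | S i j]|%:R <= K%:R :> R.
  have [[s sK sS] _] := sa i; rewrite ler_nat; apply: leq_trans sK.
  by apply: card_ord_pred_le => j; apply: contraR => /sS h; apply/eqP.
have SC j : #|[pred i | S i j]|%:R <= K%:R :> R.
  have [_ [s sK sS]] := sa j; rewrite ler_nat; apply: leq_trans sK.
  apply: card_ord_pred_le => i; apply: contraR => /sS h; apply/eqP.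
  by rewrite /alpha adjP innerC h conjc0.
have alpha2 i j : normc (alpha i j) <= 2.
  rewrite -ler_sqr ?nnegrE ?normc_ge0//; apply: le_trans (cauchy_schwarz _ _) _.
  by have := aM (xi i); rewrite !(sqnorm_onb xi_onb); lra.
pose Gam (i j : 'I_J) := \sum_t (w t)^*%C * (rho t i * (rho t j)^*%C).
have -> : \sum_t (w t)^*%C * inner (a (partial_expansion xi J (rr t))) (partial_expansion xi J (rr t)) =
    \sum_i \sum_j alpha i j * Gam i j.
  rewrite (eq_bigr (fun t => \sum_i \sum_j alpha i j * ((w t)^*%C * (rho t i * (rho t j)^*%C)))).
    rewrite exchange_big; apply: eq_bigr => i _; rewrite exchange_big.
    by apply: eq_bigr => j _; rewrite -mulr_sumr.
  move=> t _; rewrite {1}/partial_expansion bop_sumr inner_suml mulr_sumr; apply: eq_bigr => i _.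
  rewrite bopZr inner_scalel /partial_expansion inner_sumZr !mulr_sumr; apply: eq_bigr => j _.
  have swap (a1 b d f : R[i]) : a1 * (b * (d * f)) = f * (a1 * (b * d)) by ring.
  exact: swap.
pose B (i j : 'I_J) := eta * m * (lam i * lam j) + \sum_t normc (tau t i) * normc (rho t j)
   + \sum_t normc (sigma t i) * normc (tau t j).
have GamB i j : normc (Gam i j) <= B i j.
  have -> : Gam i j = \sum_t (w t)^*%C * (sigma t i * (sigma t j)^*%C) +
      \sum_t (w t)^*%C * (tau t i * (rho t j)^*%C) +
      \sum_t (w t)^*%C * (sigma t i * (tau t j)^*%C).
    have expand (a1 s1 t1 s2 t2 : R[i]) : a1 * ((s1 + t1) * (s2 + t2)^*%C) =
        a1 * (s1 * (s2)^*%C) + a1 * (t1 * (s2 + t2)^*%C) + a1 * (s1 * (t2)^*%C).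
      by rewrite rmorphD /=; ring.
    rewrite /Gam (eq_bigr (fun t => (w t)^*%C * (sigma t i * (sigma t j)^*%C) +
      (w t)^*%C * (tau t i * (rho t j)^*%C) + (w t)^*%C * (sigma t i * (tau t j)^*%C))).
      by rewrite !big_split.
    by move=> t _; rewrite (rhoE t i) (rhoE t j) expand.
  apply: le_trans (normcD_le _ _) _; apply: lerD.
    apply: le_trans (normcD_le _ _) _; apply: lerD; first exact: kernel_bound.
    apply: le_trans (normc_sum _ _ _) _; apply: ler_sum => t _.
    by rewrite !normcM !normcJ_eq (spread_weight gS) mul1r.
  apply: le_trans (normc_sum _ _ _) _; apply: ler_sum => t _.
  by rewrite !normcM !normcJ_eq (spread_weight gS) mul1r.
have B0 i j : 0 <= B i j by exact: le_trans (normc_ge0 _) (GamB i j).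
apply: (@le_trans _ _ (2 * \sum_i \sum_(j | S i j) B i j)).
  apply: le_trans (normc_sum _ _ _) _; rewrite mulr_sumr; apply: ler_sum => i _.
  apply: le_trans (normc_sum _ _ _) _; rewrite mulr_sumr [leRHS]big_mkcond.
  apply: ler_sum => j _; case: ifPn => [_|]; last by move/negPn/eqP ->; rewrite mul0r normc0.
  by rewrite normcM ler_pM ?normc_ge0.
have rho_mass : \sum_t \sum_(i < J) normc (rho t i) ^+ 2 <= M.
  rewrite /M /m -sum1_card natr_sum mulr_suml; apply: ler_sum => t _; rewrite mul1r.
  by rewrite -(sqnorm_spread iota_inj gS t); exact: bessel.
have e2 : e ^+ 2 * M <= M.
  by rewrite -[leRHS]mul1r ler_wpM2r// expr_le1// ltW.
have sigma_mass : \sum_t \sum_(i < J) normc (sigma t i) ^+ 2 <= 4 * M.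
  apply: (@le_trans _ _ (\sum_t \sum_(i < J) (2 * normc (rho t i) ^+ 2 + 2 * normc (tau t i) ^+ 2))).
    apply: ler_sum => t _; apply: ler_sum => i _; have := normc_sqrB (rho t i) (sigma t i).
    have -> : rho t i - sigma t i = tau t i by rewrite rhoE addrAC subrr add0r.
    by [].
  have lin (a1 b1 : I -> 'I_J -> R) : \sum_t \sum_i (2 * a1 t i + 2 * b1 t i) =
      2 * \sum_t \sum_i a1 t i + 2 * \sum_t \sum_i b1 t i.
    rewrite !mulr_sumr -big_split; apply: eq_bigr => t _.
    by rewrite !mulr_sumr -big_split.
  by rewrite lin; have := tau_small; rewrite -/M; lra.
have part1 : \sum_i \sum_(j | S i j) eta * m * (lam i * lam j) <= 2 * K%:R * eta / c ^+ 2 * M.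
  under eq_bigr do rewrite -mulr_sumr.
  rewrite -mulr_sumr.
  have := sparse_sum_le (fun i : 'I_J => lam i) (fun i : 'I_J => lam i) ltr01 SR SC.
  rewrite invr1 !mul1r => H.
  apply: (@le_trans _ _ (eta * m * (K%:R / 2 * (2 * y / c ^+ 2 + 2 * y / c ^+ 2)))).
    rewrite ler_wpM2l ?mulr_ge0//; apply: le_trans H _.
    by rewrite ler_wpM2l ?divr_ge0// lerD.
  by rewrite le_eqVlt; apply/orP; left; apply/eqP; rewrite /M; field; rewrite gt_eqF.
have cross (x z : I -> 'I_J -> R) :
    \sum_i \sum_(j | S i j) \sum_t x t i * z t j <=
    K%:R / 2 * (e^-1 * \sum_t \sum_i x t i ^+ 2 + e * \sum_t \sum_j z t j ^+ 2).
  rewrite (eq_bigr (fun i => \sum_t \sum_(j | S i j) x t i * z t j)); last first.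
    by move=> i _; rewrite exchange_big.
  rewrite exchange_big /= 2!mulr_sumr -big_split mulr_sumr; apply: ler_sum => t _.
  have ei : 0 < e^-1 by rewrite invr_gt0.
  by have := sparse_sum_le (x t) (z t) ei SR SC; rewrite invrK.
have cross' (x z : I -> 'I_J -> R) :
    \sum_i \sum_(j | S i j) \sum_t x t i * z t j <=
    K%:R / 2 * (e * \sum_t \sum_i x t i ^+ 2 + e^-1 * \sum_t \sum_j z t j ^+ 2).
  rewrite (eq_bigr (fun i => \sum_t \sum_(j | S i j) x t i * z t j)); last first.
    by move=> i _; rewrite exchange_big.
  rewrite exchange_big /= 2!mulr_sumr -big_split mulr_sumr; apply: ler_sum => t _.
  exact: sparse_sum_le.
have etau : e^-1 * \sum_t \sum_(i < J) normc (tau t i) ^+ 2 <= e * M.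
  by rewrite mulrC ler_pdivrMr// mulrAC -expr2.
have K2 : 0 <= K%:R / 2 :> R by rewrite divr_ge0.
have part2 : \sum_i \sum_(j | S i j) \sum_t normc (tau t i) * normc (rho t j) <=
    K%:R / 2 * (e * M + e * M).
  apply: le_trans (cross (fun t i => normc (tau t i)) (fun t j => normc (rho t j))) _.
  by rewrite ler_wpM2l// lerD// ler_wpM2l ?(ltW e0).
have part3 : \sum_i \sum_(j | S i j) \sum_t normc (sigma t i) * normc (tau t j) <=
    K%:R / 2 * (e * (4 * M) + e * M).
  apply: le_trans (cross' (fun t i => normc (sigma t i)) (fun t j => normc (tau t j))) _.
  by rewrite ler_wpM2l// lerD// ler_wpM2l ?(ltW e0).
have -> : \sum_i \sum_(j | S i j) B i j = \sum_i \sum_(j | S i j) eta * m * (lam i * lam j) +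
    \sum_i \sum_(j | S i j) \sum_t normc (tau t i) * normc (rho t j) +
    \sum_i \sum_(j | S i j) \sum_t normc (sigma t i) * normc (tau t j).
  by rewrite -!big_split; apply: eq_bigr => i _; rewrite -!big_split.
rewrite -/M; move: part1 part2 part3; move: (\sum_i _) => X1; move: (\sum_i _) => X2.
move: (\sum_i _) => X3 P1 P2 P3.
apply: (@le_trans _ _ (2 * (2 * K%:R * eta / c ^+ 2 * M + K%:R / 2 * (e * M + e * M)
   + K%:R / 2 * (e * (4 * M) + e * M)))); first by lra.
by rewrite le_eqVlt; apply/orP; left; apply/eqP; field; rewrite gt_eqF.
Qed.

End TraceEstimate.

(** * A delocalized operator far from sparse ones *)

Lemma normc_le_of_sqr (R : rcfType) (z : R[i]) (b : R) : 0 <= b ->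
  normc z ^+ 2 <= b ^+ 2 -> normc z <= b.
Proof. by move=> b0; rewrite ler_sqr ?nnegrE ?normc_ge0. Qed.

(** The operator is that of a flat system, with signs that average out the small
    entries of the basis vectors. Its trace against itself is [m * y], while that of
    an operator at distance [1/4] is at least half of this, more than a sparse
    operator can reach by [trace_estimate]. *)
Lemma delocalized_far_from_sparse (R : realType) (T : choiceType) (xi : nat -> l2 R T) :
  onb xi ->
  (forall eps : R, 0 < eps -> exists2 c : R, 0 < c &
     forall x J, \sum_(i < J | normc (xi i x) < c) normc (xi i x) ^+ 2 <= eps) ->
  forall K : nat, exists P : nat, forall (V : finType) (iota : V -> T),
    injective iota -> (P <= #|V|)%N -> exists a : bop R T, delocalized iota a /\
    forall a1 a2 : bop R T, (forall v, chi (range iota) v = v -> a1 v = a v) ->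
      sparse xi K a2 -> (forall v, sqnorm (a2 v) <= 4 * sqnorm v) ->
      ~ forall v, 16 * sqnorm (a1 v - a2 v) <= sqnorm v.
Proof.
move=> xi_onb loc K; pose K1 : R := K.+1%:R.
have K10 : 0 < K1 by rewrite ltr0n.
have KK1 : K%:R <= K1 by rewrite ler_nat.
have K11 : 1 <= K1 by rewrite ler1n.
(* [e] and [eta] make the two terms of [trace_estimate] at most 7/32 and 8/32. *)
pose e := (32 * K1)^-1.
have e0 : 0 < e by rewrite invr_gt0 mulr_gt0.
have Ke : 32 * (K1 * e) = 1 by rewrite mulrA mulfV// gt_eqF// mulr_gt0.
have e1 : e <= 1.
  have : 1 * e <= K1 * e by rewrite ler_wpM2r// ltW.
  lra.
have [c c0 cP] := loc (e ^+ 2) (exprn_gt0 2 e0).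
pose eta := c ^+ 2 / (16 * K1).
have eta0 : 0 < eta by rewrite divr_gt0 ?exprn_gt0// mulr_gt0.
have [I [Z [r [w [I0 Z0 rw]]]]] := flat_system_exists eta0.
exists #|Z| => V iota iota_inj ZV.
have [g [y gS]] := spread_system_exists (ltW eta0) Z0 ZV rw.
pose G (theta : V -> bool) t v := sg (theta v) * g t v.
pose rr theta t : l2 R T := embed iota (G theta t).
have y0 : 0 < y := spread_gt0 (gS (fun=> true)).
pose m : R := #|I|%:R.
have m0 : 0 < m by rewrite ltr0n.
(* The truncation has to be fixed before the signs, which depend on it; it works
   for all the finitely many signs. *)
have [J HJ] : exists J, forall p : {ffun V -> bool} * I,
    sqnorm (rr p.1 p.2 - partial_expansion xi J (rr p.1 p.2)) <= y / 256.
  by apply: uniform_index => p; apply: (parseval xi_onb); rewrite divr_gt0.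
pose small (i : nat) z := if normc (xi i (iota z)) < c then xi i (iota z) else 0.
have [theta Htheta] := signs_small (fun (l : I * 'I_J) v => g l.1 v * (small l.2 v)^*%C).
have gSt := gS theta.
have tau_small : \sum_t \sum_(i < J) normc (\sum_z G theta t z * (small i z)^*%C) ^+ 2 <=
    e ^+ 2 * (m * y).
  rewrite pair_bigA /=.
  rewrite (eq_bigr (fun p : I * 'I_J => normc (\sum_v sg (theta v) * (g p.1 v * (small p.2 v)^*%C)) ^+ 2)).
    2: by move=> p _; congr (normc _ ^+ 2); apply: eq_bigr => v _; rewrite mulrA.
  apply: le_trans Htheta _.
  rewrite -(pair_bigA _ (fun t (i : 'I_J) => \sum_v normc (g t v * (small i v)^*%C) ^+ 2)) /=.
  rewrite /m -sum1_card natr_sum mulr_suml mulr_sumr; apply: ler_sum => t _.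
  rewrite mul1r -(spread_mass gSt t) exchange_big mulr_sumr; apply: ler_sum => v _ /=.
  rewrite normcM normc_sg mul1r.
  rewrite (eq_bigr (fun i : 'I_J => normc (g t v) ^+ 2 * (if normc (xi i (iota v)) < c then
      normc (xi i (iota v)) ^+ 2 else 0))); last first.
    move=> i _; rewrite normcM normcJ_eq exprMn /small; congr (_ * _).
    by case: ifP; rewrite ?normc0 ?expr0n.
  rewrite -mulr_sumr [leLHS]mulrC -big_mkcond ler_wpM2r ?sqr_ge0//; exact: cP.
pose a := spread_op iota (G theta) w y.
exists a; split; first exact: spread_op_delocalized gSt.
move=> a1 a2 a1a sa2 a2M close.
have main := trace_estimate xi_onb iota_inj gSt (ltW eta0) c0 e0 e1 sa2 a2M tau_small.
have per t : y / 2 <= complex.Re ((w t)^*%C *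
    inner (a2 (partial_expansion xi J (rr theta t))) (partial_expansion xi J (rr theta t))).
  have QJ := HJ (theta, t); rewrite /= in QJ.
  have Rn : sqnorm (rr theta t) = y by exact: (sqnorm_spread iota_inj gSt t).
  have a1R : a1 (rr theta t) = w t *: rr theta t.
    by rewrite a1a ?chi_range_embed//; exact: (spread_eigen iota_inj gSt t).
  set Q := partial_expansion xi J _ in QJ *.
  have Qn : sqnorm Q <= y by rewrite -Rn sqnorm_expansion//; exact: bessel.
  move: (rr theta t) Q QJ Rn a1R Qn => u Q QJ Rn a1R Qn.
  have yn0 : 0 <= y by exact: ltW.
  have d1 : normc (inner (a1 u - a2 u) u) <= y / 4.
    apply: normc_le_of_sqr; first by rewrite divr_ge0.
    apply: le_trans (cauchy_schwarz _ _) _; rewrite Rn.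
    apply: (@le_trans _ _ (y / 16 * y)); last by rewrite le_eqVlt; apply/orP; left; apply/eqP; field.
    by rewrite ler_wpM2r//; have := close u; rewrite Rn; lra.
  have d2 : normc (inner (a2 (u - Q)) u) <= y / 8.
    apply: normc_le_of_sqr; first by rewrite divr_ge0.
    apply: le_trans (cauchy_schwarz _ _) _; rewrite Rn.
    apply: (@le_trans _ _ (4 * (y / 256) * y)); last by rewrite le_eqVlt; apply/orP; left; apply/eqP; field.
    by rewrite ler_wpM2r//; have := a2M (u - Q); lra.
  have d3 : normc (inner (a2 Q) (u - Q)) <= y / 8.
    apply: normc_le_of_sqr; first by rewrite divr_ge0.
    apply: le_trans (cauchy_schwarz _ _) _.
    apply: (@le_trans _ _ ((4 * y) * (y / 256))); last by rewrite le_eqVlt; apply/orP; left; apply/eqP; field.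
    by rewrite ler_pM ?sqnorm_ge0//; have := a2M Q; lra.
  have -> : inner (a2 Q) Q = w t * Complex y 0 - (inner (a1 u - a2 u) u +
      inner (a2 (u - Q)) u + inner (a2 Q) (u - Q)).
    have E1 : w t * Complex y 0 = inner (a1 u) u by rewrite a1R inner_scalel sqnorm_inner Rn.
    rewrite E1 bopDr bopNr !innerDl !innerDr -[- a2 u]scaleN1r -[- a2 Q]scaleN1r !inner_scalel.
    rewrite inner_scaleN; move: (inner _ _) (inner _ _) (inner _ _) (inner _ _) => p1 p2 p3 p4.
    by ring.
  set D := inner (a1 u - a2 u) u + _ + _.
  have Dn : normc D <= y / 2.
    apply: le_trans (normcD_le _ _) _; have := normcD_le (inner (a1 u - a2 u) u) (inner (a2 (u - Q)) u).
    lra.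
  rewrite mulrBr mulrA [_ * w t]mulrC mulcJ_eq (spread_weight gSt) expr1n.
  rewrite ReD; have -> : complex.Re (Complex 1 0 * Complex y 0) = y by rewrite complexME /=; ring.
  have := Re_le_normc ((w t)^*%C * D); rewrite normcM normcJ_eq (spread_weight gSt) mul1r.
  have ReN (z : R[i]) : complex.Re (- z) = - complex.Re z by case: z.
  by rewrite ReN; lra.
have low : m * y / 2 <= normc (\sum_t (w t)^*%C *
    inner (a2 (partial_expansion xi J (rr theta t))) (partial_expansion xi J (rr theta t))).
  apply: le_trans (Re_le_normc _); rewrite raddf_sum /m -sum1_card natr_sum !mulr_suml.
  by apply: ler_sum => t _; rewrite mul1r; exact: per.
have := le_trans low main; rewrite -/m.
have my0 : 0 < m * y by rewrite mulr_gt0.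
have coef : 7 * K%:R * e + 4 * K%:R * eta / c ^+ 2 <= 15 / 32.
  have -> : 4 * K%:R * eta / c ^+ 2 = K%:R / (4 * K1).
    by rewrite /eta; field; rewrite !gt_eqF.
  have q4 : K%:R / (4 * K1) <= 1 / 4 by rewrite ler_pdivrMr ?mulr_gt0//; lra.
  have ke : K%:R * e <= K1 * e by rewrite ler_wpM2r// ltW.
  have arith (k1 d k q : R) : 32 * (k1 * d) = 1 -> k * d <= k1 * d -> q <= 1 / 4 ->
    7 * k * d + q <= 15 / 32 by move=> *; lra.
  exact: arith Ke ke q4.
have : (7 * K%:R * e + 4 * K%:R * eta / c ^+ 2) * (m * y) <= 15 / 32 * (m * y).
  by rewrite ler_wpM2r// ltW.
lra.
Qed.

(** * Block sums and the theorem *)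

Section BlockSum.
Context {R : realType} {T : choiceType} (idx : T -> nat).
Implicit Types (u v : l2 R T).

Let block n := [set x | idx x = n].

Lemma sum_blocks_le N v : \sum_(n < N) sqnorm (chi (block n) v) <= sqnorm v.
Proof.
suff H : \sum_(n < N) sqnorm (chi (block n) v) <= sqnorm (chi [set x | (idx x < N)%N] v).
  by apply: le_trans H _; exact: sqnorm_chi_le.
elim: N => [|N IH]; first by rewrite big_ord0 sqnorm_ge0.
rewrite big_ord_recr/= [leRHS](sqnorm_chi_split [set x | (idx x < N)%N]); apply: lerD.
  apply: le_trans IH _; rewrite le_eqVlt; apply/orP; left; apply/eqP; congr sqnorm.
  apply/l2P => x; rewrite !chiE; case: ifPn => // xN; rewrite mem_set//=.
  by rewrite (ltn_trans (set_mem xN)).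
rewrite le_eqVlt; apply/orP; left; apply/eqP; congr sqnorm; apply/l2P => x; rewrite !chiE.
have [/set_mem/= xN|xN] := boolP (x \in block N).
  by rewrite !mem_set//= xN ?ltnn.
case: ifPn => // /set_mem/= /negP; rewrite -leqNgt => Nx; rewrite memNset//= ltnS => xN'.
by move/negP: xN; apply; apply: mem_set; apply/eqP; rewrite eqn_leq xN' Nx.
Qed.

Lemma sum_by_blocks (f : T -> R[i]) (e : R) v : 0 <= e ->
  (forall n s, uniq s -> (forall x, x \in s -> idx x = n) ->
     \sum_(x <- s) normc (f x) ^+ 2 <= e * sqnorm (chi (block n) v)) ->
  forall s, uniq s -> \sum_(x <- s) normc (f x) ^+ 2 <= e * sqnorm v.
Proof.
move=> e0 H s us; pose N := (\max_(x <- s) idx x).+1.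
rewrite (_ : \sum_(x <- s) _ = \sum_(n < N) \sum_(x <- s | idx x == n) normc (f x) ^+ 2); last first.
  rewrite (exchange_big_dep xpredT)//= big_seq [RHS]big_seq; apply: eq_bigr => x xs.
  have xN : (idx x < N)%N by rewrite ltnS (@leq_bigmax_seq _ s xpredT idx).
  by rewrite (big_pred1 (Ordinal xN))// => n; rewrite /= -val_eqE eq_sym.
apply: (@le_trans _ _ (\sum_(n < N) e * sqnorm (chi (block n) v))).
  apply: ler_sum => n _; rewrite -big_filter; apply: H; first by rewrite filter_uniq.
  by move=> x; rewrite mem_filter => /andP[/eqP].
by rewrite -mulr_sumr ler_wpM2l//; exact: sum_blocks_le.
Qed.

Context (a_ : nat -> bop R T).
Hypothesis a_le : forall n v, sqnorm (a_ n v) <= sqnorm (chi (block n) v).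

Let sum_val v := fun x => a_ (idx x) v x.

Let sum_val_le v s : uniq s -> \sum_(x <- s) normc (sum_val v x) ^+ 2 <= 1 * sqnorm v.
Proof.
apply: (sum_by_blocks ler01) => n t ut tn; rewrite mul1r.
apply: le_trans (a_le n v); apply: le_trans (sums_le_sqnorm (a_ n v) ut).
by rewrite !big_seq; apply: ler_sum => x /tn xn; rewrite /sum_val xn.
Qed.

Let sum_val_l2 v : sum_val v \in l2_pred.
Proof.
by rewrite l2_predE; apply: le_lt_trans (sqsum_le (@sum_val_le v)) (ltry _).
Qed.

Let sum_fun v : l2 R T := L2 (sum_val_l2 v).

Let sum_linear : linear sum_fun.
Proof.
by move=> z u v; apply/l2P => x; rewrite l2DE l2_scaleE /= /sum_val linearP.
Qed.

Let sum_bounded : bounded_op sum_fun.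
Proof.
apply/bounded_sqnormP; exists 1 => // v; apply: sqnorm_le_sums => s us.
exact: sum_val_le.
Qed.

(** The direct sum of the operators [a_ n]. *)
Lemma block_sum_exists : exists a : bop R T, (forall v x, a v x = a_ (idx x) v x) /\
  forall v, sqnorm (a v) <= sqnorm v.
Proof.
exists (Bop sum_linear sum_bounded); split => // v; rewrite -[leRHS]mul1r.
by apply: sqnorm_le_sums => s us; exact: sum_val_le.
Qed.

Lemma block_absorb n v : a_ n (chi (block n) v) = a_ n v.
Proof.
apply/esym/eqP; rewrite -subr_eq0 -bopNr -bopDr; apply/eqP/sqnorm_eq0/eqP.
rewrite eq_le sqnorm_ge0 andbT; apply: le_trans (a_le _ _) _.
rewrite (_ : chi _ _ = 0) ?sqnorm0//; apply/l2P => x; rewrite chiE l2DE l2NE chiE.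
case: (x \in block n) => //; exact: subrr.
Qed.

End BlockSum.

Lemma delocalized0 (R : realType) (T : choiceType) (V : finType) (iota : V -> T) :
  delocalized iota (0 : bop R T).
Proof.
split => [v|v|A d d0 _ v|A d d0 _ v]; rewrite ?bop0E ?linear0 ?sqnorm0 ?sqnorm_ge0//.
- by rewrite !mulr_ge0 ?sqrtr_ge0 ?sqnorm_ge0.
- by rewrite !mulr_ge0 ?sqrtr_ge0 ?sqnorm_ge0.
Qed.

Lemma chiC (R : realType) (T : choiceType) (A B : set T) (v : l2 R T) :
  chi A (chi B v) = chi B (chi A v).
Proof. by apply/l2P => x; rewrite !chiE; case: ifP; case: ifP. Qed.

Theorem theorem1p1 (R : realType) (k : nat) (h : R) (hpos : 0 < h)
    (V : nat -> finType) (e : forall n, rel (V n))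
    (X : metricType R) (iota : forall n, V n -> X)
    (hX : coarse_union_of_expanders k h e iota) :
  ~ exists B : set (bop R X),
      cartan_subalgebra (@quasi_local R X) B /\ isomorphic_to_linf B.
Proof.
move=> [B [cartanB isoB]].
have [xi [xi_onb signs approx]] := cartan_linf_structure cartanB isoB.
have loc := points_spread_little xi_onb signs (balls_bounded hX).
have [P HP] := choice (delocalized_far_from_sparse xi_onb loc).
pose far n K (a : bop R X) := forall a1 a2 : bop R X,
  (forall v, chi (range (iota n)) v = v -> a1 v = a v) ->
  sparse xi K a2 -> (forall v, sqnorm (a2 v) <= 4 * sqnorm v) ->
  ~ forall v, 16 * sqnorm (a1 v - a2 v) <= sqnorm v.
have far_mono n K L a : (K <= L)%N -> far n L a -> far n K a.
  move=> KL fL a1 a2 a1a sa; apply: fL => // j; have [[s sK ?] [t tK ?]] := sa j.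
  by split; [exists s|exists t] => //; apply: leq_trans KL.
(* On each block, take the operator for the largest sparsity that the block is
   large enough for. *)
have [a_ Ha] : exists a_ : nat -> bop R X, forall n, delocalized (iota n) (a_ n) /\
    forall K, (K < n)%N -> (P K <= #|V n|)%N -> far n K (a_ n).
  suff H n : exists a, delocalized (iota n) a /\
      forall K, (K < n)%N -> (P K <= #|V n|)%N -> far n K a by have [f Hf] := choice H; exists f.
  suff H N : exists a, delocalized (iota n) a /\
      forall K, (K < N)%N -> (P K <= #|V n|)%N -> far n K a by exact: H.
  elim: N => [|N [a [da fa]]]; first by exists 0; split => //; exact: delocalized0.
  have [big|small] := leqP (P N) #|V n|.
    have [b [db fb]] := HP N (V n) (iota n) (@iota_inj _ _ _ _ _ _ _ hX n) big.
    exists b; split => // K; rewrite ltnS => KN _; exact: far_mono KN fb.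
  exists a; split => // K; rewrite ltnS leq_eqVlt => /predU1P[->|]; last exact: fa.
  by rewrite leqNgt small.
have [idx Hidx] : exists idx : X -> nat, forall x, exists z : V (idx x), x = iota _ z.
  by have [f Hf] := choice (iota_surj hX); exists f.
have idxE n (z : V n) : idx (iota n z) = n.
  by have [y zy] := Hidx (iota n z); apply/esym/(iota_index hX zy).
have rangeE n : range (iota n) = [set x | idx x = n].
  apply/seteqP; split => [_ [z _ <-]|x /= <-]; first exact: idxE.
  by have [z xz] := Hidx x; exists z.
have a_le n v : sqnorm (a_ n v) <= sqnorm (chi [set x | idx x = n] v).
  by rewrite -rangeE; exact: deloc_contraction (Ha n).1 v.
have [a [aE a1]] := block_sum_exists a_le.
have Ca : quasi_local a.
  apply/quasi_localP => eps eps0.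
  (* the density for which the norm bound of [delocalized] is [eps] *)
  pose delta := (eps / 2) ^+ 2.
  have d0 : 0 < delta by rewrite exprn_gt0// divr_gt0.
  have sd : 2 * Num.sqrt delta = eps.
    by rewrite sqrtr_sqr ger0_norm ?divr_ge0 ?(ltW eps0)// mulrC divfK.
  have [r r0 Hr] := far_sets_small hpos hX d0.
  exists r => // A C AC v.
  apply: sqnorm_le_sums => s us; apply: (sum_by_blocks (idx := idx) (ltW eps0) _ us) => n t ut tn.
  set w := chi [set x | idx x = n] v.
  have E : chi A (a_ n (chi C w)) = chi A (a_ n (chi C v)).
    by rewrite /w chiC (block_absorb a_le).
  apply: (@le_trans _ _ (sqnorm (chi A (a_ n (chi C w))))).
    rewrite E; apply: le_trans (sums_le_sqnorm _ ut).
    by rewrite !big_seq; apply: ler_sum => x /tn xn; rewrite !chiE aE xn.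
  have [dn _] := Ha n.
  have [An|Cn] := Hr A C AC n.
    have := deloc_out dn (ltW d0) An (chi C w); rewrite sd => H; apply: le_trans H _.
    by rewrite ler_wpM2l ?(ltW eps0)//; exact: sqnorm_chi_le.
  apply: le_trans (sqnorm_chi_le _ _) _.
  by have := deloc_in dn (ltW d0) Cn w; rewrite sd.
have [K [b sb ab]] := approx a Ca (1 / 16) (divr_gt0 ltr01 (ltr0n _ 16)).
have [N HN] := blocks_large hX (P K).
pose n := maxn N K.+1.
have [_ /(_ K)] := Ha n; rewrite leq_max ltnSn orbT => /(_ isT).
move=> /(_ (HN n (leq_maxl _ _))) /(_ a b); apply => //.
- move=> v vn; apply/l2P => x; rewrite aE.
  have [<-//|xn] := eqVneq (idx x) n.
  have out (m : nat) (u : l2 R X) : idx x != m -> chi (range (iota m)) u = u -> u x = 0.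
    move=> xm <-; rewrite chiE memNset// rangeE /=; exact/eqP.
  rewrite [RHS](out n)//; last exact: deloc_range (Ha n).1 v.
  have -> : a_ (idx x) v = 0; last by [].
  apply: sqnorm_eq0; apply/eqP; rewrite eq_le sqnorm_ge0 andbT.
  apply: le_trans (a_le _ v) _; rewrite (_ : chi _ v = 0) ?sqnorm0//.
  apply/l2P => z; rewrite chiE; case: ifPn => // /set_mem /= zx.
  rewrite -vn chiE memNset// rangeE /= zx; exact/eqP.
- move=> v; have -> : b v = a v - (a v - b v) by rewrite opprB addrC subrK.
  apply: le_trans (sqnormD_le _ _) _; rewrite sqnormN.
  have := ab v; have := a1 v; have := sqnorm_ge0 v; lra.
- by move=> v; have := ab v; lra.
Qed.
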